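(* Let $G=\mathrm{SO}_{2n+1}(q)$ with $n\ge3$ and $q$ odd, and let $x\in G$ be unipotent. Then $\mathrm{Sub}_G(x)\ne G$ if and only if either $x$ is regular, or $x$ has Jordan form $(2n-1,1^2)$ and $|\mathbf{C}_G(x)|=2q^{n+1}(q+1)$; in the latter case $\mathrm{Sub}_G(x)$ is $G$-conjugate to $P_n$.
   Context: For $H\le G$ put $S_G(H):=\{g\in G\mid H \text{ is subnormal in } \langle g,H\rangle\}$, and $\mathrm{Sub}_G(x):=\langle S_G(\langle x\rangle)\rangle$ for $x\in G$. Regular means regular unipotent in the algebraic group $\mathrm{SO}_{2n+1}$. The Jordan form refers to the natural $(2n+1)$-dimensional representation. With respect to a Borel subgroup $B$ of $G$ with maximally split torus, let $\alpha_1,\dots,\alpha_n$ be the simple roots of type $B_n$ numbered along the Dynkin diagram so that $\alpha_n$ is the short simple root; $P_n$ is the standard parabolic subgroup containing $B$ whose Levi subgroup has $\alpha_n$ as its only simple root (Levi subgroup of semisimple type $B_1$). *)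

(* Defs.v *)
From HB Require Import structures.
From mathcomp Require Import all_boot all_order all_algebra all_fingroup.
From mathcomp Require Import all_solvable.
From mathcomp Require mpoly.

Set Implicit Arguments.
Unset Strict Implicit.
Unset Printing Implicit Defensive.

Import GRing.Theory GroupScope.
Local Open Scope ring_scope.

Definition subnormaliser_set (gT : finGroupType) (G H : {set gT}) : {set gT} :=
  [set g in G | H <|<| <<g |: H>>].

Definition subnormaliser (gT : finGroupType) (G : {set gT}) (x : gT) : {set gT} :=
  << subnormaliser_set G <[x]> >>.

(* Zariski topology and Krull dimension in the affine space 'rV[K]_m. *)
Section Zariski.
Variables (K : fieldType) (m : nat).
Implicit Types Z : 'rV[K]_m -> Prop.

Definition zsub Z1 Z2 := forall v, Z1 v -> Z2 v.

Definition zclosed Z :=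
  exists I : mpoly.mpoly m K -> Prop,
    forall v, Z v <-> (forall p, I p -> mpoly.meval (v 0) p = 0).

Definition zirreducible Z :=
  (exists v, Z v) /\
  forall Z1 Z2, zclosed Z1 -> zclosed Z2 ->
    (forall v, Z v -> Z1 v \/ Z2 v) -> zsub Z Z1 \/ zsub Z Z2.

(* For a closed set Z, the closed irreducible subsets of the subspace Z are
   those of the affine space that are contained in Z. *)
Definition zchain Z (d : nat) :=
  exists C : nat -> 'rV[K]_m -> Prop,
    (forall i, (i <= d)%N ->
       [/\ zclosed (C i), zirreducible (C i) & zsub (C i) Z]) /\
    (forall i, (i < d)%N -> zsub (C i) (C i.+1) /\ ~ zsub (C i.+1) (C i)).

Definition zdim Z (d : nat) :=
  zchain Z d /\ forall e, zchain Z e -> (e <= d)%N.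

End Zariski.

(* The split symmetric form is given by the antidiagonal matrix of ones; in odd
   dimension and odd characteristic every nondegenerate quadratic form over a
   finite field is similar to it, so there is only one group SO_(2n+1)(q). *)
Definition antidiag (R : pzRingType) (N : nat) : 'M[R]_N :=
  \matrix_(i, j) (j == rev_ord i)%:R.

Definition is_SO (R : comPzRingType) (N : nat) (A : 'M[R]_N) : bool :=
  (A *m antidiag R N *m A^T == antidiag R N) && (\det A == 1).

(* Regular unipotent elements of the algebraic group SO_(2n+1) over the
   algebraically closed field K: unipotent elements whose centraliser has
   dimension n, the rank of SO_(2n+1). *)
Definition unipotent_mx (R : pzRingType) (N : nat) (A : 'M[R]_N.+1) : Prop :=
  exists k : nat, (A - 1) ^+ k = 0.

Definition SO_centraliser (K : fieldType) (N : nat) (A : 'M[K]_N) :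
    'rV[K]_(N * N) -> Prop :=
  fun v => is_SO (vec_mx v : 'M[K]_N) /\ comm_mx A (vec_mx v).

Definition regular_unipotent (K : closedFieldType) (n : nat)
    (A : 'M[K]_(n.*2.+1)) : Prop :=
  [/\ is_SO A, unipotent_mx A & zdim (SO_centraliser A) n].

Definition unipotent_jordan_block (R : pzRingType) (k : nat) : 'M[R]_k :=
  \matrix_(i, j) ((i == j) || (i.+1 == j :> nat))%:R.

(* A is unipotent and s lists the sizes of its Jordan blocks. *)
Definition unipotent_jordan_form (R : fieldType) (N : nat) (A : 'M[R]_N)
    (s : seq nat) : Prop :=
  exists (e : (\sum_(i < size s) nth 0 s i)%N = N) (P : 'M[R]_N),
    P \in unitmx /\
    P *m A *m invmx P =
      castmx (e, e) (\mxdiag_(i < size s) unipotent_jordan_block R (nth 0%N s i)).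

Section OrthogonalGroup.
Variables (F : finFieldType) (n : nat).
Implicit Types g : {'GL_(n.*2.+1)[F]}.

Definition mx_of g : 'M[F]_(n.*2.+1) := GLval g.

Definition SO_set : {set {'GL_(n.*2.+1)[F]}} := [set g | is_SO (mx_of g)].

Lemma SO_group_set : group_set SO_set.
Proof.
apply/group_setP; split=> [|g h].
  by rewrite inE /is_SO /mx_of /= mul1mx trmx1 mulmx1 det1 !eqxx.
rewrite !inE /is_SO => /andP[/eqP gJ /eqP g1] /andP[/eqP hJ /eqP h1].
have -> : mx_of (g * h)%g = mx_of g *m mx_of h by [].
rewrite trmx_mul det_mulmx g1 h1 mulr1 eqxx andbT !mulmxA.
by rewrite -[mx_of g *m mx_of h *m _]mulmxA -[mx_of g *m _ *m _]mulmxA hJ gJ.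
Qed.

Canonical SO : {group {'GL_(n.*2.+1)[F]}} := Group SO_group_set.

(* Upper triangular Borel subgroup and its maximally split torus
   diag(t_1, .., t_n, 1, t_n^-1, .., t_1^-1); the simple roots are
   t_i / t_(i+1) for i < n and the short root alpha_n = t_n. *)
Definition Borel : {set {'GL_(n.*2.+1)[F]}} :=
  [set g in SO | [forall i : 'I_(n.*2.+1), forall j : 'I_(n.*2.+1),
    (j < i)%N ==> (mx_of g i j == 0)]].

Definition Torus : {set {'GL_(n.*2.+1)[F]}} :=
  [set g in SO | is_diag_mx (mx_of g)].

(* The rank one subgroup of alpha_n is the SO_3 acting on the three middle
   coordinates n-1, n, n+1 (counted from 0); its root subgroups U_(alpha_n) and
   U_(-alpha_n) consist of its upper, resp. lower, unitriangular elements. *)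
Definition middle (i : 'I_(n.*2.+1)) : bool := (n.-1 <= i <= n.+1)%N.

Definition root_subgroup_n : {set {'GL_(n.*2.+1)[F]}} :=
  [set g in SO | [forall i : 'I_(n.*2.+1), forall j : 'I_(n.*2.+1),
    [&& middle i, middle j & (i < j)%N] || (mx_of g i j == (i == j)%:R)]].

Definition root_subgroup_opp_n : {set {'GL_(n.*2.+1)[F]}} :=
  [set g in SO | [forall i : 'I_(n.*2.+1), forall j : 'I_(n.*2.+1),
    [&& middle i, middle j & (j < i)%N] || (mx_of g i j == (i == j)%:R)]].

Definition Levi_n : {set {'GL_(n.*2.+1)[F]}} :=
  <<Torus :|: root_subgroup_n :|: root_subgroup_opp_n>>.

Definition parabolic_n : {set {'GL_(n.*2.+1)[F]}} := <<Borel :|: Levi_n>>.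

End OrthogonalGroup.

(* Main.v *)
Require Import Defs.
From HB Require Import structures.
From mathcomp Require Import all_boot all_order all_algebra all_fingroup.
From mathcomp Require Import all_solvable all_field.
From mathcomp Require Import mpoly.
From Stdlib Require Import Classical.
From mathcomp Require Import ring zify.

Set Implicit Arguments.
Unset Strict Implicit.
Unset Printing Implicit Defensive.

Import GRing.Theory GroupScope.
Local Open Scope ring_scope.

(* Let X = x - 1 and Sub = Sub_G(x). The stabiliser of a full x-stable flag of
   totally isotropic spaces has a normal p-subgroup containing x, so it lies in
   Sub. If Sub is irreducible it therefore contains the Siegel transformations of
   all singular vectors and equals G; otherwise Sub fixes a totally isotropic
   space, which must be the only x-stable one of its rank. Conversely, climbing
   subnormal series shows that Sub fixes every such space. One exists iff x fixes
   exactly one singular line pointwise, and this happens iff X^(2n) <> 0, or x has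
   Jordan form (2n-1,1,1) and its fixed vectors form, modulo their radical, an
   anisotropic plane. The type of that plane is read off the order of the
   centraliser through the number of points of a conic, and in this case Sub is
   the stabiliser of the flag of images of the powers of X.

   It remains to see that X^(2n) <> 0 means that the centraliser has dimension n.
   The Cayley transform turns a space of skew matrices commuting with x into a
   chain of irreducible closed subsets of the centraliser. If X^(2n) <> 0 the odd
   powers of x - x^-1 give such a space of dimension n, and the Cayley transforms
   of its elements parametrise the whole centraliser; if X^(2n) = 0 there is one
   of dimension n + 1. *)

(** * Orthogonal geometry and Siegel transformations *)

(** Regularity is given through Krull dimension, that is, through chains of irreducible closed sets.
    A lower bound needs an explicit chain; an upper bound needs a polynomial map from affine
    [n]-space whose image covers the centraliser. The Cayley transform [(1 + H)(1 - H)^-1] serves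
    both purposes, being rational in [H] and polynomial when [H] is nilpotent, and it also counts
    points over [F].

    The order of the centraliser is [2 q^(n+1) (q + e)] with [e = 1] or [e = -1]. Admitting
    determinant [-1] doubles it, since [-1] is such an isometry; the larger group acts on orthogonal
    pairs of fixed vectors with prescribed norms, with an orbit of size [2 q^2 (q + e)] and a
    stabiliser of size [2 q^(n-1)].

    If [X^(2n) = 0] while [X^(2n-1)] is nonzero, then [(y X^(2n-1), z)] would be an alternating form
    of rank one; this is why only the block size [2n-1] occurs besides the regular case.

    The bound [n + 1] counts entries that conjugation by a unitriangular isometry leaves alone: [n]
    diagonal ones, and a superdiagonal one where the isometry has a zero. Matrices act on row
    vectors from the right. *)

Section Form.
Variables (R : fieldType) (N : nat).
Implicit Types (u v w y : 'rV[R]_N) (a : R) (g A : 'M[R]_N).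
Local Notation J := (antidiag R N).

Lemma tr_antidiag : J^T = J.
Proof.
apply/matrixP=> i j; rewrite !mxE; congr (_%:R).
by rewrite -(inj_eq (@rev_ord_inj _) i) rev_ordK eq_sym.
Qed.

Lemma mul_antidiagE u i : (u *m J) 0 i = u 0 (rev_ord i).
Proof.
rewrite mxE (bigD1 (rev_ord i)) //= !mxE rev_ordK eqxx mulr1 big1 ?addr0 // => j jne.
by rewrite mxE -(inj_eq (@rev_ord_inj _)) rev_ordK eq_sym (negPf jne) mulr0.
Qed.

Lemma antidiag_sq : J *m J = 1%:M.
Proof.
apply/row_matrixP=> i; rewrite row_mul; apply/rowP=> j.
by rewrite mul_antidiagE !mxE (inj_eq (@rev_ord_inj _)) eq_sym.
Qed.

Lemma antidiag_unit : J \in unitmx.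
Proof. by have [] := mulmx1_unit antidiag_sq. Qed.

Definition form u v : R := (u *m J *m v^T) 0 0.

Lemma formE u v : form u v = \sum_i u 0 (rev_ord i) * v 0 i.
Proof. by rewrite /form mxE; apply: eq_bigr => i _; rewrite mul_antidiagE mxE. Qed.

Lemma form_mx u v : u *m J *m v^T = (form u v)%:M.
Proof. by rewrite -mx11_scalar. Qed.

Lemma formC u v : form u v = form v u.
Proof.
have -> : form u v = (u *m J *m v^T)^T 0 0 by rewrite mxE.
by rewrite !trmx_mul trmxK tr_antidiag mulmxA.
Qed.

Lemma formDl u v w : form (u + v) w = form u w + form v w.
Proof. by rewrite /form !mulmxDl mxE. Qed.
Lemma formDr u v w : form u (v + w) = form u v + form u w.
Proof. by rewrite formC formDl !(formC _ u). Qed.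
Lemma formZl a u v : form (a *: u) v = a * form u v.
Proof. by rewrite /form -!scalemxAl mxE. Qed.
Lemma formZr a u v : form u (a *: v) = a * form u v.
Proof. by rewrite formC formZl formC. Qed.
Lemma formNl u v : form (- u) v = - form u v.
Proof. by rewrite -scaleN1r formZl mulN1r. Qed.
Lemma formNr u v : form u (- v) = - form u v.
Proof. by rewrite formC formNl formC. Qed.
Lemma formBl u v w : form (u - v) w = form u w - form v w.
Proof. by rewrite formDl formNl. Qed.
Lemma formBr u v w : form u (v - w) = form u v - form u w.
Proof. by rewrite formDr formNr. Qed.
Lemma form0l u : form 0 u = 0.
Proof. by rewrite -(scale0r 0) formZl mul0r. Qed.
Lemma form0r u : form u 0 = 0.
Proof. by rewrite formC form0l. Qed.

Definition formS := (formDl, formDr, formZl, formZr, formNl, formNr, form0l, form0r).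

Lemma form_nondeg v : (forall w, form v w = 0) -> v = 0.
Proof.
move=> h; have: v *m J = 0.
  apply/rowP=> i; rewrite [RHS]mxE; have := h (delta_mx 0 i).
  by rewrite /form trmx_delta -colE mxE.
by move/(congr1 (mulmx^~ J)); rewrite -mulmxA antidiag_sq mulmx1 mul0mx.
Qed.

Definition perp k (E : 'M[R]_(k, N)) : 'M[R]_N := kermx (J *m E^T).
Definition isot k (E : 'M[R]_(k, N)) : bool := (E <= perp E)%MS.

Lemma sub_perp k l (E : 'M[R]_(k, N)) (D : 'M[R]_(l, N)) :
  (D <= perp E)%MS = (D *m J *m E^T == 0).
Proof. by rewrite -mulmxA; apply/sub_kermxP/eqP. Qed.

Lemma perpP k (E : 'M[R]_(k, N)) y :
  reflect (forall e, (e <= E)%MS -> form y e = 0) (y <= perp E)%MS.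
Proof.
rewrite sub_perp; apply: (iffP eqP) => [h e /submxP[c ->]|h].
  by rewrite /form trmx_mul mulmxA h mul0mx mxE.
apply/rowP=> i; rewrite [RHS]mxE -(h _ (row_sub i E)) /form !mxE.
by apply: eq_bigr => j _; rewrite !mxE.
Qed.

Lemma perpC k l (E : 'M[R]_(k, N)) (D : 'M[R]_(l, N)) :
  (D <= perp E)%MS = (E <= perp D)%MS.
Proof.
by rewrite !sub_perp -trmx_eq0 !trmx_mul trmxK tr_antidiag mulmxA.
Qed.

Lemma perpS k l (E : 'M[R]_(k, N)) (D : 'M[R]_(l, N)) :
  (E <= D)%MS -> (perp D <= perp E)%MS.
Proof. by move=> ED; rewrite perpC (submx_trans ED) // -perpC. Qed.

Lemma rank_perp k (E : 'M[R]_(k, N)) : \rank (perp E) = (N - \rank E)%N.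
Proof.
rewrite /perp mxrank_ker -mxrank_tr trmx_mul trmxK tr_antidiag mxrankMfree //.
by rewrite row_free_unit antidiag_unit.
Qed.

Lemma perpK k (E : 'M[R]_(k, N)) : (perp (perp E) :=: E)%MS.
Proof.
apply/eqmx_sym/eqmxP.
have h : (E <= perp (perp E))%MS by rewrite -perpC.
by rewrite -(mxrank_leqif_eq h) !rank_perp subKn // rank_leq_col.
Qed.

Lemma isotP k (E : 'M[R]_(k, N)) :
  reflect (forall u v, (u <= E)%MS -> (v <= E)%MS -> form u v = 0) (isot E).
Proof.
apply: (iffP idP) => [h u v uE|h].
  by apply/perpP; apply: submx_trans h.
by apply/row_subP=> i; apply/perpP=> e; apply: h; apply: row_sub.
Qed.

Lemma isotS k l (E : 'M[R]_(k, N)) (D : 'M[R]_(l, N)) :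
  (D <= E)%MS -> isot E -> isot D.
Proof. by move=> DE /isotP h; apply/isotP=> u v uD vD; apply: h; apply: submx_trans DE. Qed.

Lemma isot_rank k (E : 'M[R]_(k, N)) : isot E -> (\rank E <= N./2)%N.
Proof.
move/mxrankS; rewrite rank_perp => h.
rewrite geq_half_double -addnn -leq_subRL //; exact: rank_leq_col.
Qed.

Lemma isot_sub_perp k l (E : 'M[R]_(k, N)) (D : 'M[R]_(l, N)) :
  (D <= E)%MS -> isot E -> (E <= perp D)%MS.
Proof. by move=> DE iE; apply: submx_trans iE (perpS DE). Qed.

(** Polarisation. *)
Lemma singular_isot k (E : 'M[R]_(k, N)) : 2%:R != 0 :> R ->
  (forall u, (u <= E)%MS -> form u u = 0) -> isot E.
Proof.
move=> R2 h; apply/isotP=> u v uE vE.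
have := h _ (addmx_sub uE vE); rewrite formDl !formDr (h u) // (h v) // add0r addr0.
rewrite (formC v) -mulr2n -mulr_natl => /eqP; rewrite mulf_eq0 (negPf R2) /=.
by move/eqP.
Qed.

Lemma singular_row_isot u : form u u = 0 -> isot u.
Proof.
move=> uu; apply/isotP=> _ _ /sub_rVP[a ->] /sub_rVP[b ->].
by rewrite !formS uu !mulr0.
Qed.

Lemma isotD_row k (D : 'M[R]_(k, N)) y : isot D -> (y <= perp D)%MS -> form y y = 0 ->
  isot (D + y)%MS.
Proof.
move=> iD yD yy; apply/isotP=> _ _ /sub_addsmxP[[d c] /= ->] /sub_addsmxP[[d' c'] /= ->].
have /isotP hD := iD; have /perpP hy := yD.
rewrite (mx11_scalar c) (mx11_scalar c') !mul_scalar_mx !formS yy hD ?submxMl //.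
by rewrite hy ?submxMl // formC hy ?submxMl // !(mulr0, addr0).
Qed.

Definition isometry g : bool := g *m J *m g^T == J.

Lemma form_isometry g u v : isometry g -> form (u *m g) (v *m g) = form u v.
Proof.
move/eqP=> h; rewrite /form.
have -> : u *m g *m J *m (v *m g)^T = u *m (g *m J *m g^T) *m v^T.
  by rewrite trmx_mul !mulmxA.
by rewrite h.
Qed.

Lemma isometryP g : (forall u v, form (u *m g) (v *m g) = form u v) -> isometry g.
Proof.
move=> h; apply/eqP/matrixP=> i j.
have := h (delta_mx 0 i) (delta_mx 0 j).
rewrite /form; set u := delta_mx 0 i; set v := delta_mx 0 j.
have e B : (u *m B *m v^T) 0 0 = B i j.
  by rewrite /u /v trmx_delta -rowE -colE !mxE.
have -> : u *m g *m J *m (v *m g)^T = u *m (g *m J *m g^T) *m v^T.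
  by rewrite trmx_mul !mulmxA.
by rewrite !e.
Qed.

Lemma is_SOE g : is_SO g = isometry g && (\det g == 1).
Proof. by []. Qed.

End Form.

Lemma mulmx_rowP (R : pzSemiRingType) m n (A B : 'M[R]_(m, n)) :
  (forall y : 'rV_m, y *m A = y *m B) -> A = B.
Proof. by move=> h; apply/row_matrixP=> i; rewrite !rowE. Qed.

(** Orthogonality to [D] amounts to [\rank D] linear conditions. *)
Lemma rank_cap_perp (R : fieldType) N k l (T : 'M[R]_(k, N)) (D : 'M[R]_(l, N)) :
  (\rank T <= \rank (T :&: perp D)%MS + \rank D)%N.
Proof.
have := mxrank_sum_cap T (perp D); rewrite rank_perp.
have := rank_leq_col (T + perp D)%MS; have := rank_leq_col D; lia.
Qed.

Lemma nonzero_row (R : fieldType) m n (A : 'M[R]_(m, n)) : (0 < \rank A)%N ->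
  exists2 y : 'rV_n, (y <= A)%MS & y != 0.
Proof.
rewrite lt0n mxrank_eq0 => /rowV0Pn[y]; by exists y.
Qed.

Lemma sub_rowPn (R : fieldType) m k n (A : 'M[R]_(m, n)) (B : 'M[R]_(k, n)) :
  ~~ (A <= B)%MS -> exists2 y : 'rV_n, (y <= A)%MS & ~~ (y <= B)%MS.
Proof. by move/row_subPn=> [i h]; exists (row i A); rewrite ?row_sub. Qed.

Section Eichler.
Variables (R : fieldType) (N : nat).
Hypothesis R2 : 2%:R != 0 :> R.
Implicit Types (u v w y : 'rV[R]_N) (a : R) (g A : 'M[R]_N).
Local Notation J := (antidiag R N).

(** The Siegel transformation of a singular [v] and of [w] orthogonal to [v]; [mul_eichler] gives
    its action. The quadratic term in [w] makes it an isometry. *)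
Definition eichler v w : 'M[R]_N :=
  1%:M + (J *m v^T) *m w - (J *m w^T) *m v - (2^-1 * form w w) *: (J *m v^T *m v).

Lemma mul_eichler y v w : y *m eichler v w =
  y + form y v *: w - form y w *: v - (2^-1 * form w w * form y v) *: v.
Proof.
rewrite /eichler !(mulmxDr, mulmxN) mulmx1 -scalemxAr !mulmxA !form_mx.
by rewrite !mul_scalar_mx scalerA.
Qed.

Lemma eichler_isometry v w : form v v = 0 -> form v w = 0 -> isometry (eichler v w).
Proof.
move=> vv vw; apply: isometryP => y z.
rewrite !mul_eichler !formS !vv !(formC w v) !vw !(formC w z) !(formC v z).
by field.
Qed.

(** For fixed [v] the Siegel transformations form a group, an image of the additive group of the
    vectors orthogonal to [v]. *)
Lemma eichlerD v w w' : form v v = 0 -> form v w = 0 -> form v w' = 0 ->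
  eichler v w *m eichler v w' = eichler v (w + w').
Proof.
move=> vv vw vw'; apply: mulmx_rowP => y; rewrite mulmxA !mul_eichler !formS.
rewrite !vv !(formC w v) !vw !vw' !(formC w' w).
by apply/rowP=> i; rewrite !mxE; field.
Qed.

Lemma eichlerZ a v w : eichler (a *: v) w = eichler v (a *: w).
Proof.
apply: mulmx_rowP => y; rewrite !mul_eichler !formS.
by apply/rowP=> i; rewrite !mxE; field.
Qed.

Lemma eichlerJ g v w : isometry g ->
  eichler v w *m g = g *m eichler (v *m g) (w *m g).
Proof.
move=> ig; apply: mulmx_rowP => y; rewrite !mulmxA !mul_eichler !form_isometry //.
by rewrite !mulmxBl !mulmxDl -!scalemxAl.
Qed.

Lemma isometry_unit g : isometry g -> g \in unitmx.
Proof.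
move/eqP/(congr1 (mulmx^~ J)); rewrite antidiag_sq -!mulmxA => /mulmx1_unit.
by case.
Qed.

Lemma isometry_det g : isometry g -> (\det g == 1) || (\det g == -1).
Proof.
move/eqP/(congr1 determinant); rewrite !det_mulmx det_tr => h.
have dJ : \det J != 0 by rewrite -unitfE -unitmxE antidiag_unit.
have : \det g ^+ 2 == 1.
  by rewrite -(inj_eq (mulIf dJ)) mul1r -{2}h expr2; apply/eqP; ring.
by rewrite sqrf_eq1.
Qed.

(** The determinant is [1] because the transformation is the square of the one with parameter
    [w / 2]. *)
Lemma eichler_SO v w : form v v = 0 -> form v w = 0 -> is_SO (eichler v w).
Proof.
move=> vv vw; rewrite is_SOE eichler_isometry //=.
have h : form v (2^-1 *: w) = 0 by rewrite formZr vw mulr0.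
have -> : w = 2^-1 *: w + 2^-1 *: w.
  have h2 : 2^-1 + 2^-1 = 1 :> R by field.
  by rewrite -scalerDl h2 scale1r.
rewrite -eichlerD // det_mulmx -expr2.
by have /orP[] := isometry_det (eichler_isometry vv h) => /eqP->; rewrite ?sqrrN expr1n.
Qed.

(** The source of all transitivity statements: singular vectors having the same pairing with [v] are
    conjugate under the Siegel group of [v]. *)
Lemma eichler_move v u u' : form u u = 0 -> form u' u' = 0 ->
  form u v = 1 -> form u' v = 1 -> u *m eichler v (u' - u) = u'.
Proof.
move=> uu uu' uv uv'; rewrite mul_eichler !formS uu uu' uv (formC u' u).
by apply/rowP=> i; rewrite !mxE; field.
Qed.

End Eichler.

(** * Isotropic vectors over a finite field *)

Section Ternary.
Variable F : finFieldType.

(** The fibres of squaring have at most two elements, and the fibre of [0] has one; hence the strict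
    inequality. *)
Lemma card_squares : (#|F| < 2 * #|[set s ^+ 2 | s : F]|)%N.
Proof.
set S := [set _ | s in _].
have S0 : 0 \in S by apply/imsetP; exists 0; rewrite ?expr0n.
have -> : #|F| = (\sum_(y in S) #|[set s : F | (s ^+ 2 == y)]|)%N.
  rewrite -sum1_card (partition_big (fun s : F => s ^+ 2) (mem S)) /=; last first.
    by move=> s _; apply: imset_f.
  by apply: eq_bigr => y _; rewrite -sum1_card; apply: eq_bigl => s; rewrite inE.
rewrite (bigD1 0) //= (cardsD1 0 S) S0 mulnDr.
have -> : [set s : F | s ^+ 2 == 0] = [set 0].
  by apply/setP=> s; rewrite !inE sqrf_eq0.
rewrite cards1 -[(2 * 1)%N]/(1 + 1)%N -addnA ltn_add2l add1n ltnS.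
rewrite mulnC -sum_nat_const [X in (_ <= X)%N](eq_bigl (fun y => (y \in S) && (y != 0))); last first.
  by move=> y; rewrite !inE andbC.
apply: leq_sum => y /andP[/imsetP[s _ ->] _].
have -> : [set t : F | t ^+ 2 == s ^+ 2] = [set s; - s].
  by apply/setP=> t; rewrite !inE eqf_sqr.
by rewrite cards2; case: (_ == _).
Qed.

(** Pigeonhole: the values of [a s^2] and of [-(b t^2 + c)] each fill more than half of the
    field. *)
Lemma conic_solution (a b c : F) : a != 0 -> b != 0 ->
  exists s t, a * s ^+ 2 + b * t ^+ 2 + c = 0.
Proof.
move=> a0 b0; pose S := [set s ^+ 2 | s : F].
pose A := [set a * z | z in S]; pose B := [set - (b * z + c) | z in S].
have cA : #|A| = #|S| by apply: card_imset; apply: mulfI.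
have cB : #|B| = #|S| by apply: card_imset => z z' /oppr_inj/addIr/(mulfI b0).
have : A :&: B != set0.
  apply/eqP=> AB0; have := cardsUI A B; rewrite AB0 cards0 addn0 cA cB.
  have h1 : (#|A :|: B| <= #|F|)%N := max_card _.
  by have := card_squares; rewrite -/S => h2 h3; lia.
case/set0Pn=> z /setIP[/imsetP[_ /imsetP[s _ ->] ->] /imsetP[_ /imsetP[t _ ->]] e].
by exists s, t; rewrite e -addrA addNr.
Qed.

Lemma ternary_isotropic N k (T : 'M[F]_(k, N)) : (3 <= \rank T)%N ->
  exists2 y, (y <= T)%MS & (y != 0) && (form y y == 0).
Proof.
move=> rT.
have [|y1 y1T n1] := @nonzero_row F _ _ T; first lia.
have [s1|s1] := eqVneq (form y1 y1) 0; first by exists y1; rewrite ?n1 ?s1 //=.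
pose T1 := (T :&: perp y1)%MS.
have rT1 : (2 <= \rank T1)%N.
  by have := rank_cap_perp T y1; rewrite rank_rV -/T1; case: eqP => _ /=; lia.
have [|y2 y2T n2] := @nonzero_row F _ _ T1; first lia.
have y2T' : (y2 <= T)%MS by apply: submx_trans y2T (capmxSl _ _).
have [s2|s2] := eqVneq (form y2 y2) 0; first by exists y2; rewrite ?n2 ?s2 //=.
have [|y3 y3T n3] := @nonzero_row F _ _ (T1 :&: perp y2)%MS.
  by have := rank_cap_perp T1 y2; rewrite rank_rV; case: eqP => _ /=; lia.
have y3T' : (y3 <= T)%MS.
  by apply: submx_trans y3T _; apply: submx_trans (capmxSl _ _) (capmxSl _ _).
have [s3|s3] := eqVneq (form y3 y3) 0; first by exists y3; rewrite ?n3 ?s3 //=.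
(* The vectors [y1], [y2], [y3] are nonsingular and pairwise orthogonal; the coefficient of [y3] is
   set to [1]. *)
have [s [t st]] := conic_solution (form y3 y3) s1 s2.
have f21 : form y2 y1 = 0.
  by apply: (perpP _ _ (submx_trans y2T (capmxSr _ _))); apply: submx_refl.
have f31 : form y3 y1 = 0.
  apply: (perpP _ _ (submx_trans y3T (submx_trans (capmxSl _ _) (capmxSr _ _)))).
  exact: submx_refl.
have f32 : form y3 y2 = 0.
  by apply: (perpP _ _ (submx_trans y3T (capmxSr _ _))); apply: submx_refl.
exists (s *: y1 + t *: y2 + y3); first by rewrite !addmx_sub ?scalemx_sub.
have e u : form (s *: y1 + t *: y2 + y3) u = s * form y1 u + t * form y2 u + form y3 u.
  by rewrite !formS.
apply/andP; split; last first.
  apply/eqP; rewrite -[RHS]st e !formDr !formZr f21 f31 f32 (formC y1 y3) (formC y2 y3).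
  by rewrite (formC y1 y2) f21 f31 f32; ring.
(* The pairing of the combination with [y3] is [form y3 y3], so it is not zero. *)
apply: contraNneq s3 => h; have := e y3.
by rewrite h form0l (formC y1) (formC y2) f31 f32 !mulr0 !add0r => <-.
Qed.

End Ternary.

Section Unipotent.
Variables (R : fieldType) (N : nat).
Implicit Types (A g X : 'M[R]_N).

(** Take the least [i] for which [M X^i] lies in [D]; it is positive, and any vector of [M X^(i-1)]
    outside [D] will do. No stability of [D] is involved. *)
Lemma nilp_fixed_mod m l (X : 'M[R]_N) (M : 'M[R]_(m, N)) (D : 'M[R]_(l, N)) k :
  X ^+ k = 0 -> stablemx M X -> ~~ (M <= D)%MS ->
  exists y : 'rV_N, [/\ (y <= M)%MS, ~~ (y <= D)%MS & (y *m X <= D)%MS].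
Proof.
move=> Xk MX MD.
have ex : exists i, (M *m X ^+ i <= D)%MS by exists k; rewrite Xk mulmx0 sub0mx.
case: (ex_minnP ex) => [[|i] hi imin]; first by rewrite expr0 mulmx1 (negPf MD) in hi.
have /sub_rowPn[y yM yD] : ~~ (M *m X ^+ i <= D)%MS.
  by apply/negP=> /imin; rewrite ltnn.
exists y; split=> //.
  apply: submx_trans yM _; elim: i {hi imin yD} => [|i IH]; first by rewrite expr0 mulmx1.
  by rewrite exprSr mulmxA; apply: submx_trans (submxMr _ IH) MX.
by apply: submx_trans (submxMr X yM) _; rewrite -mulmxA mulmxE -exprSr.
Qed.

End Unipotent.

(** * Stable isotropic flags *)

Section Stable.
Variables (R : fieldType) (N : nat).
Implicit Types (g A : 'M[R]_N).

Lemma stablemx_eq k (E : 'M[R]_(k, N)) g : g \in unitmx -> stablemx E g ->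
  (E *m g :=: E)%MS.
Proof.
move=> gU sE; apply/eqmxP; rewrite -(mxrank_leqif_eq sE).
by rewrite mxrankMfree // row_free_unit.
Qed.

Lemma stablemx_eqmx k l (E : 'M[R]_(k, N)) (D : 'M[R]_(l, N)) g :
  (E :=: D)%MS -> stablemx E g = stablemx D g.
Proof. by move=> ED; rewrite ED (eqmxMr g ED). Qed.

Lemma stablemx_inv k (E : 'M[R]_(k, N)) g : g \in unitmx -> stablemx E g ->
  stablemx E (invmx g).
Proof.
by move=> gU sE; rewrite -(eqmxMr _ (stablemx_eq gU sE)) mulmxK.
Qed.

Lemma stablemx_sub1 k (E : 'M[R]_(k, N)) g : stablemx E (g - 1%:M) = stablemx E g.
Proof.
rewrite mulmxBr mulmx1; apply/idP/idP => h.
  by rewrite -(subrK E (E *m g)) addmx_sub.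
by rewrite addmx_sub // -scaleN1r scalemx_sub.
Qed.

Lemma stablemx_perp k (E : 'M[R]_(k, N)) g : isometry g -> stablemx E g ->
  stablemx (perp E) g.
Proof.
move=> ig sE; apply/row_subP=> i; rewrite row_mul; apply/perpP=> e eE.
have gU := isometry_unit ig.
have [c ->] : exists c, e = c *m E *m g.
  by have /submxP[c ->] : (e <= E *m g)%MS; [rewrite stablemx_eq | exists c; rewrite mulmxA].
rewrite form_isometry //; apply: (perpP _ _ (row_sub i _)); exact: submxMl.
Qed.

Lemma rank_add_row k (D : 'M[R]_(k, N)) (y : 'rV[R]_N) : ~~ (y <= D)%MS ->
  \rank (D + y)%MS = (\rank D).+1.
Proof.
move=> yD; apply/eqP; rewrite eqn_leq; apply/andP; split.
  by have := mxrank_adds_leqif D y; case=> h _; have := rank_leq_row y; lia.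
have : (D < D + y)%MS by rewrite ltmxE addsmxSl addsmx_sub submx_refl.
by rewrite ltmxErank => /andP[].
Qed.

Lemma stablemx_add_row k (D : 'M[R]_(k, N)) (y : 'rV_N) g : stablemx D g ->
  (y *m (g - 1%:M) <= D)%MS -> stablemx (D + y)%MS g.
Proof.
move=> sD yD; rewrite addsmxMr addsmx_sub (submx_trans sD (addsmxSl _ _)) /=.
rewrite -[y *m g](subrK y) addmx_sub ?addsmxSr //.
by rewrite -{2}[y]mulmx1 -mulmxBr (submx_trans yD) ?addsmxSl.
Qed.

(** Moves [g - 1] across the form, at the price of a sign and a factor [g]. *)
Lemma form_unip_perp g (y w : 'rV[R]_N) : isometry g ->
  form (y *m (g - 1%:M)) w = - form (y *m g) (w *m (g - 1%:M)).
Proof.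
move=> ig; rewrite !mulmxBr !mulmx1 formBl formBr form_isometry //.
by rewrite opprB.
Qed.

End Stable.

Definition flag (R : fieldType) (N l : nat) (W : nat -> 'M[R]_N) : Prop :=
  [/\ forall j, (j <= l)%N -> \rank (W j) = j,
      isot (W l) & forall j, (j < l)%N -> (W j <= W j.+1)%MS].

Definition stable_flag (R : fieldType) (N l : nat) (W : nat -> 'M[R]_N) (g : 'M[R]_N) : bool :=
  [forall j : 'I_l.+1, stablemx (W j) g].

Section Flags.
Variables (R : fieldType) (N : nat).
Implicit Types (g A : 'M[R]_N).

Lemma stable_flagP l W g :
  reflect (forall j, (j <= l)%N -> stablemx (W j) g) (@stable_flag R N l W g).
Proof.
apply: (iffP forallP) => [h j jl|h j]; last by apply: h; rewrite -ltnS.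
by rewrite -ltnS in jl; have := h (Ordinal jl).
Qed.

Lemma flag_sub l (W : nat -> 'M[R]_N) i j : flag l W -> (i <= j <= l)%N ->
  (W i <= W j)%MS.
Proof.
case=> _ _ h /andP[ij jl]; elim: j ij jl => [|j IH]; first by rewrite leqn0 => /eqP->.
rewrite leq_eqVlt => /predU1P[->//|ij jl].
by apply: submx_trans (IH _ _) (h j jl); rewrite // ltnW.
Qed.

Lemma flag_isot l (W : nat -> 'M[R]_N) j : flag l W -> (j <= l)%N -> isot (W j).
Proof.
move=> fW jl; have [_ il _] := fW; apply: isotS il.
by apply: (flag_sub fW); rewrite jl leqnn.
Qed.

End Flags.

Section Extension.
Variables (F : finFieldType) (n : nat).
Local Notation N := n.*2.+1.
Hypothesis F2 : 2%:R != 0 :> F.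
Variables (A : 'M[F]_N) (k : nat).
Hypothesis iA : isometry A.
Hypothesis Ak : (A - 1%:M) ^+ k = 0.

Lemma isot_rank_n l (E : 'M[F]_(l, N)) : isot E -> (\rank E <= n)%N.
Proof. by move/isot_rank; rewrite /= uphalf_double. Qed.

(** If [A] is trivial on [perp E] modulo [E], a space of dimension at least three, any isotropic
    vector there serves. Otherwise a vector of the image of [A - 1] is taken, and singularity comes
    for free. *)
Lemma extend_isot (E : 'M[F]_N) : isot E -> stablemx E A -> (\rank E < n)%N ->
  exists y : 'rV_N, [/\ ~~ (y <= E)%MS, isot (E + y)%MS & stablemx (E + y)%MS A].
Proof.
move=> iE sE rE.
have [h|h] := boolP (perp E *m (A - 1%:M) <= E)%MS.
  have [|y yT /andP[y0 /eqP yy]] := @ternary_isotropic F _ _ (perp E :\: E)%MS.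
    have := mxrank_cap_compl (perp E) E; rewrite rank_perp.
    by move/capmx_idPr: (iE) => ->; lia.
  have yP : (y <= perp E)%MS by apply: submx_trans yT (diffmxSl _ _).
  exists y; split; last 2 first.
  - exact: isotD_row.
  - by apply: stablemx_add_row => //; apply: submx_trans h; apply: submxMr.
  apply: contra y0 => yE; rewrite -submx0.
  by rewrite -(capmx_diff (perp E) E) sub_capmx yT.
have [|y [yM yE yX]] := @nilp_fixed_mod F _ _ _ (A - 1%:M) (perp E *m (A - 1%:M)) E k Ak _ h.
  apply: submxMr.
  by rewrite stablemx_sub1 stablemx_perp.
have yP : (y <= perp E)%MS.
  apply: submx_trans yM _.
  by rewrite stablemx_sub1 stablemx_perp.
exists y; split=> //; last exact: stablemx_add_row.
apply: isotD_row => //; case/submxP: yM => z yz.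
(* With [y = z (A - 1)], the value [(y, y)] is [-(z A, y (A - 1))], a pairing of [perp E] with
   [E]. *)
rewrite {1}yz mulmxA form_unip_perp // (perpP _ _ _ _ yX) ?oppr0 //.
rewrite -mulmxA; apply: submx_trans (submxMl _ _) _.
exact: stablemx_perp.
Qed.

(** The flag grows one dimension at a time among stable isotropic spaces comparable with [E]: inside
    [E] by unipotence, above [E] by [extend_isot]. *)
Lemma flag_through (E : 'M[F]_N) : isot E -> stablemx E A ->
  exists W, [/\ flag n W, stable_flag n W A & (W (\rank E) :=: E)%MS].
Proof.
move=> iE sE.
pose ok (D : 'M[F]_N) := [&& isot D, stablemx D A & (D <= E)%MS || (E <= D)%MS].
pose next (D D' : 'M[F]_N) := [&& ok D', (D <= D')%MS & \rank D' == (\rank D).+1].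
have step D : ok D -> (\rank D < n)%N -> exists D', next D D'.
  case/and3P=> iD sD DE rD.
  suff [y [yD iy sy ey]] : exists y : 'rV_N, [/\ ~~ (y <= D)%MS, isot (D + y)%MS,
      stablemx (D + y)%MS A & ((D + y)%MS <= E)%MS || (E <= (D + y)%MS)%MS].
    by exists (D + y)%MS; rewrite /next /ok iy sy ey addsmxSl rank_add_row ?eqxx.
  have [ED|ED] := boolP (E <= D)%MS.
    have [y [h1 h2 h3]] := extend_isot iD sD rD.
    by exists y; split; rewrite // (submx_trans ED) ?addsmxSl ?orbT.
  rewrite (negPf ED) orbF in DE.
  have [|y [yM yD yX]] := nilp_fixed_mod Ak _ ED; first by rewrite stablemx_sub1.
  exists y; split; rewrite ?addsmx_sub ?DE ?yM //.
    by apply: isotS iE; rewrite addsmx_sub DE.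
  exact: stablemx_add_row.
(* For [j] up to [n] the default of [odflt] is never taken, by [step]. *)
pose W := fix W j := if j is i.+1 then odflt 0 [pick D' | next (W i) D'] else 0 : 'M[F]_N.
have WS j : ok (W j) -> (\rank (W j) < n)%N -> next (W j) (W j.+1).
  move=> okj rj /=; case: pickP => //= h.
  by have [D'] := step _ okj rj; rewrite h.
have okW j : (j <= n)%N -> ok (W j) /\ \rank (W j) = j.
  elim: j => [|j IH] jn; first by rewrite /ok /isot mul0mx !sub0mx mxrank0.
  have [okj rj] := IH (ltnW jn).
  by have := WS j okj; rewrite rj => /(_ jn) /and3P[? _ /eqP ->]; rewrite rj.
have rE := isot_rank_n iE.
exists W; split; first split.
- by move=> j /okW[].
- by have [/and3P[]] := okW n (leqnn n).
- by move=> j jn; have [okj rj] := okW j (ltnW jn); have := WS j okj; rewrite rj => /(_ jn) /and3P[].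
- by apply/stable_flagP=> j /okW[/and3P[]].
have [/and3P[_ _ h] r] := okW _ rE.
apply/eqmxP; case/orP: h => h.
  by rewrite -(mxrank_leqif_eq h) r.
by apply/eqmxP/eqmx_sym/eqmxP; rewrite -(mxrank_leqif_eq h) r.
Qed.

End Extension.

(** * Subnormalisers and stable isotropic subspaces *)

Lemma mem_conjV_normal (gT : finGroupType) (H0 H1 : {group gT}) (x h : gT) :
  H0 <| H1 -> x \in H0 -> h \in H1 -> (x ^ h^-1)%g \in H0.
Proof. by move=> H01 xH hH; rewrite -mem_conjg (normsP (normal_norm H01) h hH). Qed.

Lemma odd_card_two_neq0 (F : finFieldType) : odd #|F| -> 2%:R != 0 :> F.
Proof.
move=> oF; apply/eqP=> F2.
have : (#[1%R : F]%g %| #|[set: F]|)%N by apply: order_dvdG; rewrite inE.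
have -> : #[1%R : F]%g = 2%N.
  apply: nt_prime_order => //; last exact: oner_neq0.
by rewrite cardsT dvdn2 oF.
Qed.

Section LinearGroups.
Variables (F : finFieldType) (n : nat).
Local Notation N := n.*2.+1.
Local Notation GL := {'GL_N[F]}.
Implicit Types (g h x : GL).

Lemma mx_ofM g h : mx_of (g * h)%g = mx_of g *m mx_of h. Proof. by []. Qed.
Lemma mx_of1 : mx_of (1%g : GL) = 1%:M. Proof. by []. Qed.
Lemma mx_ofV g : mx_of g^-1%g = invmx (mx_of g). Proof. by []. Qed.
Lemma mx_of_unit g : mx_of g \in unitmx. Proof. exact: (valP g). Qed.
Lemma mx_ofX g k : mx_of (g ^+ k)%g = mx_of g ^+ k.
Proof. by elim: k => [|k IH]; rewrite ?expg0 ?expr0 // expgS exprS -IH. Qed.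

Lemma mx_of_inj : injective (@mx_of F n). Proof. exact: val_inj. Qed.

Lemma mem_SO g : (g \in SO F n) = is_SO (mx_of g). Proof. by rewrite inE. Qed.

Lemma SO_isometry g : g \in SO F n -> isometry (mx_of g).
Proof. by rewrite mem_SO is_SOE => /andP[]. Qed.

Lemma mx_of_SO (M : 'M[F]_N) : is_SO M -> exists2 g, g \in SO F n & mx_of g = M.
Proof.
move=> sM; have MU : M \in unitmx by have /andP[/isometry_unit] := sM.
have e : mx_of (Sub M MU : GL) = M by rewrite /mx_of SubK.
by exists (Sub M MU : GL); rewrite // mem_SO e.
Qed.

Section FamilyStab.
Variables (l : nat) (W : nat -> 'M[F]_N).

Definition flag_stab : {set GL} := [set g | stable_flag l W (mx_of g)].

Lemma flag_stab_group_set : group_set flag_stab.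
Proof.
apply/group_setP; split=> [|g h].
  by rewrite inE; apply/stable_flagP=> j _; rewrite mx_of1 mulmx1.
rewrite !inE => /stable_flagP sg /stable_flagP sh; apply/stable_flagP=> j jl.
by rewrite mx_ofM mulmxA (submx_trans (submxMr _ (sg j jl))) // sh.
Qed.
Canonical flag_stab_group := Group flag_stab_group_set.

Lemma flag_stabP g : reflect (forall j, (j <= l)%N -> stablemx (W j) (mx_of g)) (g \in flag_stab).
Proof. by rewrite inE; apply: stable_flagP. Qed.

End FamilyStab.

(** In characteristic [p], [(g - 1)^(p^j) = g^(p^j) - 1]. *)
Lemma unipotent_pelt (p : nat) g k : p \in [pchar F] -> (mx_of g - 1%:M) ^+ k = 0 -> p.-elt g.
Proof.
move=> pF gk; have pM : p \in [pchar 'M[F]_N].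
  have [pp /eqP p0] := andP pF; apply/andP; split=> //.
  have -> : p%:R = (p%:R)%:M :> 'M[F]_N by rewrite [RHS]raddfMn.
  by rewrite p0 raddf0.
have e j : (mx_of g - 1%:M) ^+ (p ^ j) = mx_of g ^+ (p ^ j) - 1%:M.
  elim: j => [|j IH]; first by rewrite expn0 !expr1.
  rewrite expnSr exprM IH -(pFrobenius_autE pM) pFrobenius_autB_comm ?pFrobenius_autE; last first.
    by rewrite /GRing.comm mulr1 mul1r.
  by rewrite -exprM expr1n.
have : (g ^+ (p ^ k) = 1)%g.
  apply: mx_of_inj; rewrite mx_ofX mx_of1; apply/eqP; rewrite -subr_eq0 -e.
  have kp : (k <= p ^ k)%N by apply/ltnW/ltn_expl/prime_gt1; case/andP: pF.
  by rewrite -(subnKC kp) exprD gk mul0r.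
move/eqP => h1; have d : (#[g]%g %| p ^ k)%N by rewrite order_dvdn.
apply: pnat_dvd d _.
by rewrite pnatX pnat_id ?orbT //; case/andP: pF.
Qed.

Section Chain.
Variables (m : nat) (C : nat -> 'M[F]_N).
Hypotheses (C0 : C 0%N = 0) (Cm : (1%:M <= C m)%MS)
  (CS : forall j, (j < m)%N -> (C j <= C j.+1)%MS).

(** The elements acting trivially on every factor of the chain: a [p]-group normalised by the
    stabiliser of the chain. *)
Definition chain_ker : {set GL} :=
  [set g | [forall j : 'I_m, (C j.+1 *m (mx_of g - 1%:M) <= C j)%MS]].

Lemma chain_kerP g : reflect (forall j, (j < m)%N -> (C j.+1 *m (mx_of g - 1%:M) <= C j)%MS)
  (g \in chain_ker).
Proof.
rewrite inE; apply: (iffP forallP) => [h j jl|h j]; last exact: h.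
exact: (h (Ordinal jl)).
Qed.

Lemma chain_ker_stab g : g \in chain_ker -> g \in flag_stab m C.
Proof.
move/chain_kerP=> h; apply/flag_stabP=> -[|j] jm; first by rewrite C0 mul0mx.
by rewrite -stablemx_sub1 (submx_trans (h j jm)) ?CS.
Qed.

Lemma chain_ker_group_set : group_set chain_ker.
Proof.
apply/group_setP; split=> [|g h].
  by apply/chain_kerP=> j _; rewrite mx_of1 subrr mulmx0 sub0mx.
move=> /chain_kerP sg hC; have /flag_stabP sh := chain_ker_stab hC.
move/chain_kerP: hC => hC; apply/chain_kerP=> j jm.
have -> : mx_of (g * h)%g - 1%:M = (mx_of g - 1%:M) *m mx_of h + (mx_of h - 1%:M).
  by rewrite mulmxBl mul1mx addrA subrK.
rewrite mulmxDr addmx_sub ?hC // mulmxA (submx_trans (submxMr _ (sg j jm))) // sh //.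
exact: ltnW.
Qed.
Canonical chain_ker_group := Group chain_ker_group_set.

Lemma chain_ker_nilp g : g \in chain_ker -> (mx_of g - 1%:M) ^+ m = 0.
Proof.
move/chain_kerP=> h; have e j : (j <= m)%N -> (C m *m (mx_of g - 1%:M) ^+ j <= C (m - j)%N)%MS.
  elim: j => [|j IH] jm; first by rewrite expr0 mulmx1 subn0.
  rewrite exprSr mulmxA (submx_trans (submxMr _ (IH (ltnW jm)))) //.
  by have := h (m - j.+1)%N; rewrite -subSn // subSS; apply; lia.
have := e m (leqnn m); rewrite subnn C0 submx0 => /eqP h0.
case/submxP: Cm => D eD; have := congr1 (mulmx D) h0.
by rewrite mulmx0 mulmxA -eD mul1mx.
Qed.

Lemma chain_ker_pgroup p : p \in [pchar F] -> p.-group chain_ker.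
Proof.
move=> pF; apply/pgroupP=> r rp rd; have [y yC oy] := Cauchy rp rd.
have : p.-elt y := unipotent_pelt pF (chain_ker_nilp yC).
by rewrite /p_elt oy pnatE.
Qed.

(* [x] lies in a normal [p]-subgroup of [<g, x>], and every subgroup of a
   [p]-group is subnormal. *)
Lemma subnormal_chain x g : g \in flag_stab m C -> x \in chain_ker ->
  <[x]>%g <|<| <<g |: <[x]>%g >>%g.
Proof.
move=> gC xC; pose H := <<g |: <[x]>%g >>%G.
have xH : x \in H by rewrite mem_gen // inE cycle_id orbT.
have HT : H \subset flag_stab m C.
  by rewrite gen_subG subUset sub1set gC cycle_subG chain_ker_stab.
pose K := (chain_ker :&: H)%G.
have KH : K <| H.
  apply/andP; split; first exact: subsetIr.
  apply/subsetP=> h hH; rewrite inE; apply/subsetP=> _ /imsetP[k /setIP[kC kH] ->].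
  apply/setIP; split; last by rewrite groupJ.
  apply/chain_kerP=> j jm.
  have /flag_stabP sh := subsetP HT _ hH; have /chain_kerP sk := kC.
  rewrite /conjg !mx_ofM mx_ofV.
  have -> : invmx (mx_of h) *m (mx_of k *m mx_of h) - 1%:M =
      invmx (mx_of h) *m (mx_of k - 1%:M) *m mx_of h.
    by rewrite mulmxBr mulmxBl mulmx1 mulVmx ?mx_of_unit // !mulmxA.
  rewrite !mulmxA; apply: submx_trans (sh j (ltnW jm)); apply: submxMr.
  apply: submx_trans (sk j jm); apply: submxMr.
  by apply: stablemx_inv; rewrite ?mx_of_unit ?sh.
have [p pp pF] := finPcharP F.
apply: subnormal_trans (normal_subnormal KH).
apply: nilpotent_subnormal; last by rewrite cycle_subG inE xC.
by apply: (@pgroup_nil _ p); apply: pgroupS (subsetIl _ _) (chain_ker_pgroup pF).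
Qed.

End Chain.

Section Subnormaliser.
Variable x : GL.
Hypothesis xG : x \in SO F n.
Local Notation A := (mx_of x).

Definition sole_isot (E : 'M[F]_N) : Prop :=
  [/\ isot E, stablemx E A & forall E' : 'M[F]_N, isot E' -> stablemx E' A ->
    \rank E' = \rank E -> (E' :=: E)%MS].

Lemma subnormaliser_sub : subnormaliser (SO F n) x \subset SO F n.
Proof. by rewrite gen_subG; apply/subsetP=> g; rewrite inE => /andP[]. Qed.

(* Climb a subnormal series from [<x>]: if [H] normalises a subgroup [H0] that
   contains [x] and stabilises [E], then any [H]-translate of [E] is [H0]-stable,
   hence [x]-stable, hence equal to [E]. *)
Lemma subnormaliser_sole E g : sole_isot E -> g \in subnormaliser (SO F n) x ->
  stablemx E (mx_of g).
Proof.
case=> iE sE uE; pose T := flag_stab 0 (fun=> E).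
have TP h : (h \in T) = stablemx E (mx_of h).
  by apply/flag_stabP/idP => [/(_ 0%N)|h1 j _]; first apply.
suff: subnormaliser (SO F n) x \subset T by move/subsetP=> h /h; rewrite TP.
rewrite gen_subG; apply/subsetP=> {}g; rewrite inE => /andP[gG /subnormalP[s]].
set H := <<_>>%G => ser lst.
have gH : g \in H by rewrite mem_gen // inE set11.
have HG : H \subset SO F n by rewrite gen_subG subUset sub1set gG cycle_subG.
suff: H \subset T by move/subsetP; apply.
have x0 : x \in <[x]>%G by apply: cycle_id.
have s0 : <[x]>%G \subset T by rewrite cycle_subG TP.
elim: s (<[x]>%G) ser lst x0 s0 => [|H1 s IH] H0 /=; first by move=> _ ->.
case/andP=> H01 ser lst x0 s0; apply: (IH H1) => //.
  by apply: (subsetP (normal_sub H01)).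
have H1H : H1 \subset H.
  rewrite -lst; elim: s H1 ser {IH H01 lst} => //= H2 s IH H1 /andP[H12 /IH].
  exact/subset_trans/normal_sub.
apply/subsetP=> h hH; rewrite TP.
have hG : h \in SO F n by apply: (subsetP HG); apply: (subsetP H1H).
have xh := mem_conjV_normal H01 x0 hH.
suff -> : (E *m mx_of h :=: E)%MS by [].
apply: uE.
- apply/isotP=> u v /submxP[c ->] /submxP[d ->]; rewrite !mulmxA form_isometry ?SO_isometry //.
  by move/isotP: iE; apply; apply: submxMl.
- have := subsetP s0 _ xh; rewrite TP conjgE invgK !mx_ofM => h1.
  have -> : E *m mx_of h *m mx_of x = E *m (mx_of h *m (mx_of x *m mx_of h^-1)) *m mx_of h.
    by rewrite mx_ofV -!mulmxA mulVmx ?mx_of_unit // mulmx1.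
  exact: submxMr.
- by rewrite mxrankMfree // row_free_unit mx_of_unit.
Qed.

End Subnormaliser.

End LinearGroups.

Lemma rank_add_row_le (R : fieldType) N k (D : 'M[R]_(k, N)) (y : 'rV[R]_N) :
  (\rank (D + y)%MS <= (\rank D).+1)%N.
Proof.
have [yD|/rank_add_row->//] := boolP (y <= D)%MS.
by rewrite (addsmx_idPl yD).
Qed.

(** * Overgroups of flag stabilisers *)

Section Transitivity.
Variables (F : finFieldType) (n : nat).
Local Notation N := n.*2.+1.
Local Notation GL := {'GL_N[F]}.
Hypothesis F2 : 2%:R != 0 :> F.
Implicit Types (g h : GL) (v w y : 'rV[F]_N).

(** The space [perp E] has dimension greater than [n], too large to be totally isotropic. *)
Lemma nonsingular_perp k (E : 'M[F]_(k, N)) : (\rank E <= n)%N ->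
  exists2 w, (w <= perp E)%MS & form w w != 0.
Proof.
move=> rE; case: (pickP [pred w : 'rV[F]_N | (w <= perp E)%MS && (form w w != 0)]) => [w /andP[]|h].
  by exists w.
have /isot_rank_n : isot (perp E).
  apply: singular_isot => // w wE; apply/eqP; have := h w; rewrite /= wE /=.
  by move/negbT; rewrite negbK.
by rewrite rank_perp; move: rE; move: (\rank E); clear; lia.
Qed.

Lemma nonorth_perp k (E : 'M[F]_(k, N)) y : ~~ (y <= E)%MS ->
  exists2 w, (w <= perp E)%MS & form y w != 0.
Proof.
move=> yE; case: (pickP [pred w : 'rV[F]_N | (w <= perp E)%MS && (form y w != 0)]) => [w /andP[]|h].
  by exists w.
case/negP: yE; rewrite -(perpK E); apply/perpP=> w wE.
by apply/eqP; have := h w; rewrite /= wE /= => /negbT; rewrite negbK.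
Qed.

Lemma row_singular k (E : 'M[F]_(k, N)) y : isot E -> (y <= E)%MS -> form y y = 0.
Proof. by move/isotP=> h yE; apply: h. Qed.

(** Such a [v] lets one Siegel transformation move the line of [a] to the line of [a'] while fixing
    [D] pointwise. *)
Lemma common_nonorth (D : 'M[F]_N) a a' : isot D -> (\rank D < n)%N ->
  (a <= perp D)%MS -> (a' <= perp D)%MS -> ~~ (a <= D)%MS -> ~~ (a' <= D)%MS ->
  form a a = 0 -> form a' a' = 0 ->
  exists v, [/\ (v <= perp D)%MS, form v v = 0, form a v != 0 & form a' v != 0].
Proof.
move=> iD rD aP a'P aD a'D aa aa'.
have [al0|al] := eqVneq (form a a') 0.
  have [c [cP ca ca']] : exists c, [/\ (c <= perp D)%MS, form a c != 0 & form a' c != 0].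
    have [c1 c1P c1a] := nonorth_perp aD; have [c2 c2P c2a] := nonorth_perp a'D.
    have [h1|h1] := eqVneq (form a' c1) 0; last by exists c1.
    have [h2|h2] := eqVneq (form a c2) 0; last by exists c2.
    by exists (c1 + c2); rewrite addmx_sub // !formDr h1 h2 addr0 add0r.
  (* The multiple of [a] makes [c] singular; the pairings with [a] and [a'] do not change, because
     [a] is orthogonal to both. *)
  exists (c - (form c c / (2%:R * form a c)) *: a); split.
  - by rewrite addmx_sub // -scaleNr scalemx_sub.
  - by rewrite !formS aa (formC c a); field; rewrite ca F2.
  - by rewrite !formS aa mulr0 subr0.
  - by rewrite !formS (formC a' a) al0 mulr0 subr0.
pose Z := perp (D + a + a')%MS.
have aZ : (a <= perp Z)%MS.
  by rewrite perpK; apply: submx_trans (addsmxSl _ _); apply: addsmxSr.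
have a'Z : (a' <= perp Z)%MS by rewrite perpK addsmxSr.
(* Otherwise [Z] is isotropic of rank at least [n], and adjoining [a] gives an isotropic space of
   rank above [n]. *)
have [z zZ zz] : exists2 z, (z <= Z)%MS & form z z != 0.
  case: (pickP [pred z : 'rV[F]_N | (z <= Z)%MS && (form z z != 0)]) => [z /andP[]|h].
    by exists z.
  have iZ : isot Z.
    apply: singular_isot => // w wE; apply/eqP; have := h w; rewrite /= wE /=.
    by move/negbT; rewrite negbK.
  have aNZ : ~~ (a <= Z)%MS.
    apply: contra al => aZ'; apply/eqP; apply: (perpP _ _ aZ').
    exact: addsmxSr.
  have := isot_rank_n (isotD_row iZ aZ aa); rewrite rank_add_row //.
  rewrite rank_perp; have := rank_add_row_le (D + a)%MS a'.
  by have := rank_add_row_le D a; move: (\rank _) (\rank _) (\rank _) rD; clear; lia.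
have za : form a z = 0 by apply: (perpP _ _ aZ).
have za' : form a' z = 0 by apply: (perpP _ _ a'Z).
exists (a + z - (form z z / (2%:R * form a a')) *: a'); split.
- rewrite !addmx_sub //; last by rewrite -scaleNr scalemx_sub.
  by apply: submx_trans zZ _; apply: perpS; rewrite -addsmxA addsmxSl.
- rewrite !formS aa aa' (formC z a) (formC z a') za za' (formC a' a).
  by field; rewrite al F2.
- rewrite !formS aa za !add0r oppr_eq0 mulf_neq0 // mulf_neq0 // invr_eq0 mulf_neq0 //.
- by rewrite !formS aa' za' mulr0 subr0 addr0 formC.
Qed.

Section Overgroup.
Variable S : {group GL}.
Hypothesis SG : S \subset SO F n.

Definition has_eichler v : Prop :=
  forall w, form v w = 0 -> exists2 g, g \in S & mx_of g = eichler v w.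

(** A constructive form of Witt's theorem for flags: once the members up to [j] agree, a single
    Siegel transformation adjusts the next one. *)
Lemma flag_move l (W W' : nat -> 'M[F]_N) : (l <= n)%N ->
  (forall v, v != 0 -> form v v = 0 -> has_eichler v) -> flag l W -> flag l W' ->
  exists2 h, h \in S & forall j, (j <= l)%N -> (W j *m mx_of h :=: W' j)%MS.
Proof.
move=> ln eS fW fW'.
suff: forall j, (j <= l)%N -> exists2 h, h \in S &
    forall i, (i <= j)%N -> (W i *m mx_of h :=: W' i)%MS by apply.
have [rW iW sW] := fW; have [rW' iW' sW'] := fW'.
elim=> [_|j IH jl].
  exists 1%g => // i; rewrite leqn0 => /eqP->.
  have /eqP := rW 0%N isT; have /eqP := rW' 0%N isT; rewrite !mxrank_eq0 => /eqP-> /eqP->.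
  by rewrite mul0mx.
have [h hS hW] := IH (ltnW jl); set D := W' j in hW *.
have hG := subsetP SG _ hS.
have DE : (W j *m mx_of h :=: D)%MS by apply: hW.
have sub_new (V V' : 'M[F]_N) : \rank V' = j.+1 -> (V :=: D)%MS -> ~~ (V' <= V)%MS.
  by move=> rV VD; apply/negP=> /mxrankS; rewrite rV VD (rW' j (ltnW jl)) ltnn.
have hU := mx_of_unit h.
have [a aW aD] : exists2 a : 'rV_N, (a <= W j.+1 *m mx_of h)%MS & ~~ (a <= D)%MS.
  have rWh : \rank (W j.+1 *m mx_of h) = j.+1 by rewrite mxrankMfree ?row_free_unit // rW.
  have [a ? ha] := sub_rowPn (sub_new _ _ rWh DE).
  by exists a; rewrite // -DE.
have [a' a'W a'D] : exists2 a : 'rV_N, (a <= W' j.+1)%MS & ~~ (a <= D)%MS.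
  by apply/sub_rowPn/sub_new => //; apply: rW'.
have iWh : isot (W j.+1 *m mx_of h).
  apply/isotP=> u v /submxP[c ->] /submxP[d ->]; rewrite !mulmxA form_isometry ?SO_isometry //.
  by have /isotP := flag_isot fW jl; apply; apply: submxMl.
have iWj' := flag_isot fW' jl.
have DWh : (D <= W j.+1 *m mx_of h)%MS by rewrite -DE submxMr // sW.
have DW' : (D <= W' j.+1)%MS by apply: sW'.
have aa := row_singular iWh aW; have aa' := row_singular iWj' a'W.
have aP : (a <= perp D)%MS := submx_trans aW (isot_sub_perp DWh iWh).
have a'P : (a' <= perp D)%MS := submx_trans a'W (isot_sub_perp DW' iWj').
have iD : isot D := isotS DW' iWj'.
have rD : (\rank D < n)%N by rewrite rW' ?(ltnW jl) // (leq_trans jl).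
have [v [vP vv av a'v]] := common_nonorth iD rD aP a'P aD a'D aa aa'.
pose u := (form a v)^-1 *: a; pose u' := (form a' v)^-1 *: a'.
have uu : form u u = 0 by rewrite !formS aa !mulr0.
have uu' : form u' u' = 0 by rewrite !formS aa' !mulr0.
have uv : form u v = 1 by rewrite formZl mulVf.
have uv' : form u' v = 1 by rewrite formZl mulVf.
have v0 : v != 0 by apply: contraNneq av => ->; rewrite form0r.
(* Since [u] and [u'] pair to [1] with [v], the difference is orthogonal to [v]. As [v], [u] and
   [u'] are orthogonal to [D], the space [D] is fixed pointwise. *)
have [|g gS eg] := eS v v0 vv (u' - u).
  by rewrite formBr !(formC v) uv uv' subrr.
have ug : u *m mx_of g = u' by rewrite eg eichler_move.
have Dg y : (y <= D)%MS -> y *m mx_of g = y.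
  move=> yD; have /perpP hv := vP; have /perpP ha := aP; have /perpP ha' := a'P.
  rewrite eg mul_eichler formBr /u /u' !formZr (formC y v) (formC y a) (formC y a').
  by rewrite (hv y) // (ha y) // (ha' y) // !mulr0 subrr !scale0r !subr0 addr0.
have Dmg (V : 'M[F]_N) : (V <= D)%MS -> V *m mx_of g = V.
  move=> VD; apply/row_matrixP=> i; rewrite row_mul Dg //.
  exact: submx_trans (row_sub i V) VD.
exists (h * g)%g => [|i]; first by rewrite groupM.
rewrite mx_ofM mulmxA leq_eqVlt => /predU1P[->|ij].
  have e1 : (D + a :=: W j.+1 *m mx_of h)%MS.
    apply/eqmxP; have s : (D + a <= W j.+1 *m mx_of h)%MS by rewrite addsmx_sub DWh.
    by rewrite -(mxrank_leqif_eq s) rank_add_row // mxrankMfree ?row_free_unit // rW // rW' // ltnW.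
  have e2 : (D + a' :=: W' j.+1)%MS.
    apply/eqmxP; have s : (D + a' <= W' j.+1)%MS by rewrite addsmx_sub DW'.
    by rewrite -(mxrank_leqif_eq s) rank_add_row // !rW' // ltnW.
  have ag : a *m mx_of g = (form a v / form a' v) *: a'.
    by rewrite -scalerA -/u' -ug /u -scalemxAl scalerA mulfV // scale1r.
  apply: eqmx_trans (eqmxMr _ (eqmx_sym e1)) _; apply: eqmx_trans e2.
  apply: eqmx_trans (addsmxMr _ _ _) _; apply: adds_eqmx; first by rewrite Dmg.
  by rewrite ag; apply: eqmx_scale; rewrite mulf_neq0 // invr_eq0.
apply: eqmx_trans (hW i ij); have : (W i *m mx_of h <= D)%MS.
  by rewrite hW //; apply: flag_sub fW' _; rewrite -ltnS ij ltnW.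
by move/(submx_trans _)=> s; rewrite Dmg // s.
Qed.

(** Frattini argument: [S] contains a stabiliser and is transitive on flags. *)
Lemma SO_of_flag_stab l (W : nat -> 'M[F]_N) : (l <= n)%N -> flag l W ->
  SO F n :&: flag_stab l W \subset S ->
  (forall v, v != 0 -> form v v = 0 -> has_eichler v) -> S :=: SO F n.
Proof.
move=> ln fW BS eS; apply/eqP; rewrite eqEsubset SG /=; apply/subsetP=> g gG.
have fWg : flag l (fun j => W j *m mx_of g).
  have [rW iW sW] := fW; split=> [j jl||j jl].
  - by rewrite mxrankMfree ?row_free_unit ?mx_of_unit ?rW.
  - apply/isotP=> u v /submxP[c ->] /submxP[d ->]; rewrite !mulmxA form_isometry ?SO_isometry //.
    by move/isotP: iW; apply; apply: submxMl.
  - by rewrite submxMr ?sW.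
have [h hS hW] := flag_move ln eS fW fWg.
have hG := subsetP SG _ hS.
rewrite -(mulgKV h g) groupM // (subsetP BS) // inE (groupM gG) ?groupV //=.
apply/flag_stabP=> j jl; rewrite mx_ofM mx_ofV mulmxA -(eqmxMr _ (hW j jl)).
by rewrite -mulmxA mulmxV ?mx_of_unit // mulmx1.
Qed.

Section OneFlag.
Variable W : nat -> 'M[F]_N.
Hypotheses (fW : flag n W) (BS : SO F n :&: flag_stab n W \subset S).

(** Members of the flag up to [W j] are orthogonal to [v] and [w], hence fixed pointwise; vectors of
    the larger ones move by a multiple of [v], which lies in them. *)
Lemma eichler_flag_stab j v w : (j <= n)%N -> (v <= W j)%MS -> (w <= perp (W j))%MS ->
  exists2 g, g \in S & mx_of g = eichler v w.
Proof.
move=> jn vW wW; have iWn := flag_isot fW (leqnn n).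
have le_n i : (i <= n)%N -> (W i <= W n)%MS.
  by move=> i_n; apply: (flag_sub fW); rewrite i_n leqnn.
have vn : (v <= W n)%MS by apply: submx_trans vW (le_n _ _).
have vw : form v w = 0 by rewrite formC; apply: (perpP _ _ wW).
have [g gG eg] := mx_of_SO (eichler_SO F2 (row_singular iWn vn) vw).
exists g => //; apply: (subsetP BS); rewrite inE gG /=; apply/flag_stabP=> i i_n.
apply/row_subP=> r; rewrite row_mul; set y := row r _.
have yW : (y <= W i)%MS by apply: row_sub.
have yv : form y v = 0.
  by move/isotP: iWn; apply=> //; apply: submx_trans yW (le_n _ _).
rewrite eg mul_eichler yv mulr0 !scale0r addr0 subr0.
have [ij|ji] := leqP i j.
  rewrite (formC y) (perpP _ _ wW) ?scale0r ?subr0 //.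
  by apply: submx_trans yW (flag_sub fW _); rewrite ij.
rewrite addmx_sub // -scaleNr scalemx_sub //.
by apply: submx_trans vW (flag_sub fW _); rewrite ltnW.
Qed.

Lemma flag_vector j : (j < n)%N -> exists2 v : 'rV_N, (v <= W j.+1)%MS & ~~ (v <= W j)%MS.
Proof.
move=> jn; apply/sub_rowPn/negP=> /mxrankS; have [rW _ _] := fW.
by rewrite !rW ?(ltnW jn) // ltnn.
Qed.

Lemma flag_addE j v : (j < n)%N -> (v <= W j.+1)%MS -> ~~ (v <= W j)%MS ->
  (W j + v :=: W j.+1)%MS.
Proof.
move=> jn v1 v0; have [rW _ sW] := fW; apply/eqmxP.
have s : (W j + v <= W j.+1)%MS by rewrite addsmx_sub sW.
by rewrite -(mxrank_leqif_eq s) rank_add_row // !rW // ltnW.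
Qed.

Section Invariant.
Variable M : 'M[F]_N.
Hypothesis sM : forall g, g \in S -> stablemx M (mx_of g).

(** This vector is the displacement of [y] under [eichler v w]. *)
Lemma eichler_invariant j v w y : (j <= n)%N -> (v <= W j)%MS ->
  (w <= perp (W j))%MS -> (y <= M)%MS ->
  (form y v *: w - form y w *: v - (2^-1 * form w w * form y v) *: v <= M)%MS.
Proof.
move=> jn vW wW yM; have [g gS eg] := eichler_flag_stab jn vW wW.
have : (y *m mx_of g - y <= M)%MS.
  rewrite addmx_sub //; last by rewrite -scaleN1r scalemx_sub.
  by apply: submx_trans (submxMr _ yM) (sM gS).
have e a b c : y + a - b - c - y = a - b - c by apply/rowP=> i; rewrite !mxE; ring.
by rewrite eg mul_eichler e.
Qed.

Lemma invariant_first : (0 < n)%N -> M != 0 -> (W 1 <= M)%MS.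
Proof.
move=> n0 M0; have [v vW vn] := flag_vector n0.
have [rW _ _] := fW.
have W0 : W 0%N = 0 by apply/eqP; rewrite -mxrank_eq0 rW.
have vE : (v :=: W 1)%MS.
    by have := flag_addE n0 vW vn; rewrite W0; move/(eqmx_trans (eqmx_sym (adds0mx _ v))).
suff vM : (v <= M)%MS by rewrite -vE.
have vv : form v v = 0 by apply: row_singular vW; apply: flag_isot fW _.
have [y yM y0] : exists2 y : 'rV_N, (y <= M)%MS & y != 0 by apply/nonzero_row; rewrite lt0n mxrank_eq0.
have [yv|yv] := eqVneq (form y v) 0.
  have [yW|yW] := boolP (y <= W 1)%MS.
    have /sub_rVP[c yc] : (y <= v)%MS by rewrite vE.
    have c0 : c != 0 by apply: contraNneq y0 => c0; rewrite yc c0 scale0r.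
    by rewrite -(eqmx_scale v c0) -yc.
  have [w wW yw] := nonorth_perp yW.
  have := eichler_invariant n0 vW wW yM; rewrite yv mulr0 !scale0r subr0 add0r.
  by rewrite -scaleNr eqmx_scale // oppr_eq0.
have r1 : (\rank (W 1) <= n)%N by rewrite rW.
have [w wW ww] := nonsingular_perp r1.
have vw : form v w = 0 by rewrite formC; apply: (perpP _ _ wW).
have m1 := eichler_invariant n0 vW wW yM.
(* Taking the displacement a second time leaves [-(y, v)(w, w) v], a nonzero multiple of [v]. *)
have := eichler_invariant n0 vW wW m1; rewrite !formS !vv (formC w v) !vw.
rewrite !mulr0 !subr0 scale0r !mulr0 add0r scale0r subr0 -scaleNr eqmx_scale //.
by rewrite oppr_eq0 mulf_neq0.
Qed.

(** Once [M] contains [W j] and a vector outside it, displacements of that vector produce [W j.+1],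
    unless it pairs nontrivially with [v]. *)
Lemma isot_invariant_flag j : isot M -> (j <= \rank M)%N -> (W j <= M)%MS.
Proof.
move=> iM; have [rW _ _] := fW; have rM := isot_rank_n iM.
elim: j => [_|j IH jM].
  have -> : W 0%N = 0 by apply/eqP; rewrite -mxrank_eq0 rW.
  exact: sub0mx.
have DM := IH (ltnW jM); have jn : (j < n)%N := leq_trans jM rM.
have [v vW vn] := flag_vector jn.
suff vM : (v <= M)%MS by rewrite -(flag_addE jn vW vn) addsmx_sub DM.
have vv : form v v = 0 by apply: row_singular vW; apply: flag_isot fW _.
have [y yM yn] : exists2 y : 'rV_N, (y <= M)%MS & ~~ (y <= W j)%MS.
  by apply/sub_rowPn/negP=> /mxrankS; rewrite rW ?(ltnW jn) // leqNgt jM.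
have [yv|yv] := eqVneq (form y v) 0.
  have [yW|yW] := boolP (y <= W j.+1)%MS.
    by apply: submx_trans vW _; rewrite -(flag_addE jn yW yn) addsmx_sub DM.
  have [w wW yw] := nonorth_perp yW.
  have := eichler_invariant jn vW wW yM; rewrite yv mulr0 !scale0r subr0 add0r.
  by rewrite -scaleNr eqmx_scale // oppr_eq0.
have r1 : (\rank (W j.+1) <= n)%N by rewrite rW.
have [w wW ww] := nonsingular_perp r1.
have vw : form v w = 0 by rewrite formC; apply: (perpP _ _ wW).
have m1 := eichler_invariant jn vW wW yM.
(* The displacement lies in the isotropic space [M], yet its norm is [(y, v)^2 (w, w)]. *)
have := row_singular iM m1; rewrite !formS !vv (formC w v) !vw.
rewrite !(mulr0, subr0, oppr0, addr0) => /eqP.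
by rewrite !mulf_eq0 (negPf yv) (negPf ww).
Qed.

End Invariant.

(** The Siegel group of the first vector of the flag lies in the flag stabiliser. Conjugation
    carries it along the orbit of that vector, and the orbit meets every singular line. *)
Lemma irreducible_has_eichler : (0 < n)%N ->
  (forall M : 'M[F]_N, (forall g, g \in S -> stablemx M (mx_of g)) -> M != 0 -> row_full M) ->
  forall u, u != 0 -> form u u = 0 -> has_eichler u.
Proof.
move=> n0 irr; have [v vW vn] := flag_vector n0.
have iW1 := flag_isot fW n0.
have [rW _ _] := fW.
have vv : form v v = 0 := row_singular iW1 vW.
have W0 : W 0%N = 0 by apply/eqP; rewrite -mxrank_eq0 rW.
have vE : (v :=: W 1)%MS.
    by have := flag_addE n0 vW vn; rewrite W0; move/(eqmx_trans (eqmx_sym (adds0mx _ v))).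
have eZ a u : a != 0 -> has_eichler (a *: u) -> has_eichler u.
  move=> a0 h w uw; have [|g gS eg] := h (a^-1 *: w); first by rewrite !formS uw !mulr0.
  by exists g; rewrite // eg (eichlerZ F2) scalerA mulfV // scale1r.
have eJ g u : g \in S -> has_eichler u -> has_eichler (u *m mx_of g).
  move=> gS h w uw; have gI := SO_isometry (subsetP SG _ gS).
  have gU := mx_of_unit g.
  have [|k kS ek] := h (w *m invmx (mx_of g)).
    by rewrite -(form_isometry _ _ gI) mulmxKV.
  exists (g^-1 * k * g)%g; first by rewrite !groupM ?groupV.
  rewrite !mx_ofM mx_ofV ek -mulmxA eichlerJ // mulmxKV // mulKmx //.
have ev : has_eichler v.
  move=> w vw; apply: (@eichler_flag_stab 1) => //.
  by apply/perpP=> e; rewrite -vE => /sub_rVP[c ->]; rewrite formZr formC vw mulr0.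
pose M := (\sum_(g in S) <<v *m mx_of g>>)%MS.
have fM : row_full M.
  apply: irr => [h hS|].
    rewrite sumsmxMr; apply/sumsmx_subP=> g gS.
    rewrite (eqmxMr _ (genmxE _)) -mulmxA -mx_ofM.
    apply: (sumsmx_sup (g * h)%g); first by rewrite groupM.
    by rewrite genmxE.
  have vM : (v <= M)%MS by apply: (sumsmx_sup 1%g) => //; rewrite genmxE mx_of1 mulmx1.
  apply: contraNneq vn => M0; move: vM; rewrite M0 submx0 => /eqP->; exact: sub0mx.
have orb u : u != 0 -> exists2 g, g \in S & form (v *m mx_of g) u != 0.
  move=> u0; case: (pickP [pred g | (g \in S) && (form (v *m mx_of g) u != 0)]) => [g /andP[]|h].
    by exists g.
  case/negP: u0; apply/eqP/form_nondeg => w; have : (u <= perp M)%MS; last first.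
    by move/perpP; apply; apply: submx_full.
  rewrite perpC; apply/sumsmx_subP=> g gS; rewrite genmxE.
  rewrite sub_perp form_mx; have := h g; rewrite /= gS /= => /negbT; rewrite negbK => /eqP->.
  by rewrite raddf0.
have v0 : v != 0 by apply: contraNneq vn => ->; apply: sub0mx.
(* The orbit vector [y] pairs nontrivially with [u] and with another orbit vector [y']; after
   rescaling, the Siegel group of [y] takes [y'] to [u]. *)
move=> u u0 uu; have [s sS su] := orb u u0; have [s' s'S vs'] := orb v v0.
pose y := v *m mx_of s; pose y' := v *m mx_of (s' * s)%g.
have yI : form y y' != 0.
  by rewrite /y /y' mx_ofM mulmxA form_isometry ?SO_isometry ?(subsetP SG) // formC.
have ey : has_eichler y by apply: eJ.
have ey' : has_eichler y' by apply: eJ; rewrite ?groupM.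
have yy' : form y' y' = 0 by rewrite form_isometry ?SO_isometry ?(subsetP SG) ?groupM.
have uy : form u y != 0 by rewrite formC.
pose u1 := (form u y)^-1 *: u; pose y1 := (form y' y)^-1 *: y'.
have u1y : form u1 y = 1 by rewrite formZl mulVf.
have y1y : form y1 y = 1 by rewrite formZl mulVf // formC.
have [|g gS eg] := ey (u1 - y1); first by rewrite formBr !(formC y) u1y y1y subrr.
have y1g : y1 *m mx_of g = u1.
  by rewrite eg eichler_move // !formS ?uu ?yy' !mulr0.
have yi : (form y' y)^-1 != 0 by rewrite invr_eq0 formC.
apply: (eZ (form u y)^-1); first by rewrite invr_eq0.
rewrite -/u1 -y1g; apply: eJ => //.
have y'y : form y' y != 0 by rewrite formC.
by apply: (eZ (form y' y)); rewrite // scalerA mulfV // scale1r.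
Qed.

End OneFlag.
End Overgroup.
End Transitivity.

Lemma sole_isot_of_overgroup (F : finFieldType) (n : nat) (x : {'GL_(n.*2.+1)[F]})
    (S : {group {'GL_(n.*2.+1)[F]}}) k :
  2%:R != 0 :> F -> (0 < n)%N -> S \subset SO F n -> x \in SO F n ->
  (mx_of x - 1%:M) ^+ k = 0 ->
  (forall W, flag n W -> stable_flag n W (mx_of x) -> SO F n :&: flag_stab n W \subset S) ->
  S :<>: SO F n ->
  exists2 E : 'M[F]_(n.*2.+1), sole_isot x E & (0 < \rank E <= n)%N.
Proof.
move=> F2 n0 SG xG xk BS neq.
have thr := flag_through F2 (SO_isometry xG) xk.
have [W [fW sW _]] : exists W, [/\ flag n W, stable_flag n W (mx_of x)
    & (W (\rank (0 : 'M[F]_(n.*2.+1))) :=: (0 : 'M[F]_(n.*2.+1)))%MS].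
  by apply: thr; rewrite ?/isot ?sub0mx // mul0mx sub0mx.
have [M sM [M0 Mf]] : exists2 M : 'M[F]_(n.*2.+1), (forall g, g \in S -> stablemx M (mx_of g))
    & M != 0 /\ ~~ row_full M.
  case: (pickP [pred M : 'M[F]_(n.*2.+1) | [forall g in S, stablemx M (mx_of g)]
    && (M != 0) && ~~ row_full M]) => [M /andP[/andP[/forall_inP h1 h2] h3]|h].
    by exists M.
  case: neq; apply: (SO_of_flag_stab F2 SG (leqnn n) fW (BS W fW sW)).
  apply: (irreducible_has_eichler F2 SG fW (BS W fW sW) n0) => M sM M0.
  by have := h M; rewrite /= M0 andbT => /negbT; rewrite negb_and negbK; case/orP=> // /forall_inP[].
pose E := (M :&: perp M)%MS.
have sP g : g \in S -> stablemx (perp M) (mx_of g).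
  by move=> gS; rewrite stablemx_perp ?sM ?SO_isometry ?(subsetP SG).
have sE g : g \in S -> stablemx E (mx_of g).
  move=> gS; apply: submx_trans (capmxMr _ _ _) _; rewrite sub_capmx.
  by rewrite (submx_trans (capmxSl _ _) (sM g gS)) (submx_trans (capmxSr _ _) (sP g gS)).
have iE : isot E.
  by apply: submx_trans (capmxSr _ _) _; apply: perpS; apply: capmxSl.
have P0 : perp M != 0.
  rewrite -mxrank_eq0 rank_perp; rewrite /row_full in Mf.
  by rewrite -lt0n subn_gt0 ltn_neqAle Mf rank_leq_col.
(* Both [M] and [perp M] are nonzero and invariant, so both contain [W 1]. *)
have W1E : (W 1 <= E)%MS.
  by rewrite sub_capmx !(invariant_first F2 fW (BS W fW sW)).
have rE0 : (0 < \rank E)%N.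
  by have := mxrankS W1E; have [-> //] := fW.
have rEn := isot_rank_n iE.
exists E; last by rewrite rE0.
have xS : x \in S.
  by apply: (subsetP (BS W fW sW)); rewrite inE xG /=; apply/flag_stabP/stable_flagP.
split=> //; first exact: sE.
(* The stabiliser of a full flag through [E'] also lies in [S], and the invariant space [E] must
   contain the member of its own rank, which is [E']. *)
move=> E' iE' sE' rE'; have [W' [fW' sW' e]] := thr E' iE' sE'.
apply: eqmx_trans (eqmx_sym e) _; rewrite rE'.
have s := isot_invariant_flag F2 fW' (BS W' fW' sW') sE iE (leqnn _).
by apply/eqmxP; rewrite -(mxrank_leqif_eq s); have [-> //] := fW'.
Qed.

Lemma subspace_between (R : fieldType) N k l (D : 'M[R]_(k, N)) (E : 'M[R]_(l, N)) r :
  (D <= E)%MS -> (\rank D <= r <= \rank E)%N ->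
  exists C : 'M[R]_N, [/\ (D <= C)%MS, (C <= E)%MS & \rank C = r].
Proof.
move=> DE /andP[Dr rE]; elim: r Dr rE => [|r IH] Dr rE.
  exists <<D>>%MS; rewrite !genmxE; split=> //; apply/eqP; by rewrite -leqn0.
move: Dr; rewrite leq_eqVlt => /predU1P[rD|rD].
  by exists <<D>>%MS; rewrite !genmxE.
have [C [DC CE rC]] := IH rD (ltnW rE).
have [|y yE yC] := @sub_rowPn _ _ _ _ E C.
  by apply/negP=> /mxrankS; rewrite rC leqNgt rE.
exists (C + y)%MS; rewrite rank_add_row // rC addsmx_sub CE yE; split=> //.
exact: submx_trans DC (addsmxSl _ _).
Qed.

Lemma rank_nilp_lt (R : fieldType) N k (E : 'M[R]_(k, N)) (X : 'M[R]_N) m :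
  X ^+ m = 0 -> stablemx E X -> E != 0 -> (\rank (E *m X) < \rank E)%N.
Proof.
move=> Xm sE E0; rewrite ltn_neqAle mxrankS // andbT.
apply: contra E0 => /eqP rE; have e : (E *m X :=: E)%MS.
  by apply/eqmxP; rewrite -(mxrank_leqif_eq sE) rE.
have e' j : (E *m X ^+ j :=: E)%MS.
  elim: j => [|j IH]; first by rewrite expr0 mulmx1.
  by rewrite exprSr mulmxA; apply: eqmx_trans (eqmxMr _ IH) e.
by have := e' m; rewrite Xm mulmx0 -!mxrank_eq0 => <-; rewrite mxrank0.
Qed.

Lemma stable_nilp (R : fieldType) N k (E : 'M[R]_(k, N)) (X : 'M[R]_N) m :
  X ^+ m = 0 -> stablemx E X -> E *m X ^+ (\rank E) = 0.
Proof.
move=> Xm sE.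
suff h j : (\rank (E *m X ^+ j) <= \rank E - j)%N.
  by apply/eqP; rewrite -mxrank_eq0 -leqn0 (leq_trans (h _)) // subnn.
have sEj i : stablemx (E *m X ^+ i) X.
  elim: i => [|i IH]; first by rewrite expr0 mulmx1.
  by rewrite exprSr mulmxA submxMr.
elim: j => [|j IH]; first by rewrite expr0 mulmx1 subn0.
rewrite exprSr mulmxA; have [->|nz] := eqVneq (E *m X ^+ j) 0.
  by rewrite mul0mx mxrank0.
have := rank_nilp_lt Xm (sEj j) nz; move: IH.
by move: (\rank _) (\rank _) (\rank _); clear; lia.
Qed.

Lemma nilp_rank1_quotient (R : fieldType) N k l (X : 'M[R]_N) (M : 'M[R]_(k, N)) (D : 'M[R]_(l, N)) m :
  X ^+ m = 0 -> stablemx M X -> stablemx D X -> (D <= M)%MS -> \rank M = (\rank D).+1 ->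
  (M *m X <= D)%MS.
Proof.
move=> Xm sM sD DM rM; have [|z [zM zD zX]] := nilp_fixed_mod Xm sM (_ : ~~ (M <= D)%MS).
  by apply/negP=> /mxrankS; rewrite rM ltnn.
have s : (D + z <= M)%MS by rewrite addsmx_sub DM.
have -> : (M *m X :=: (D + z)%MS *m X)%MS.
  apply: eqmxMr; apply/eqmx_sym/eqmxP.
  by rewrite -(mxrank_leqif_eq s) rank_add_row ?rM.
by rewrite addsmxMr addsmx_sub sD.
Qed.

(** * Unipotent isometries with a single singular fixed line *)

Section UnipotentIsometry.
Variables (R : fieldType) (N : nat) (A : 'M[R]_N).
Hypothesis iA : isometry A.
Local Notation X := (A - 1%:M).

Lemma comm_unip m : A *m X ^+ m = X ^+ m *m A.
Proof.
have c : GRing.comm A X by rewrite /GRing.comm mulrBr mulrBl mulr1 mul1r.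
exact: (commrX m c).
Qed.

Lemma form_unip_pow m (y z : 'rV[R]_N) :
  form (y *m X ^+ m) z = (-1) ^+ m * form (y *m A ^+ m) (z *m X ^+ m).
Proof.
elim: m y z => [|m IH] y z; first by rewrite !expr0 !mulmx1 mul1r.
rewrite {1}exprSr mulmxA form_unip_perp // -mulmxA -comm_unip mulmxA IH.
rewrite [in RHS]exprS -mulrA mulN1r; congr (- (_ * _)).
by rewrite -!mulmxA !mulmxE -!exprS.
Qed.

(** The factor [A^m] of [form_unip_pow] disappears because [z X^m] is fixed by [A]. *)
Lemma form_unip_skew m (y z : 'rV[R]_N) : X ^+ m.+1 = 0 ->
  form (y *m X ^+ m) z = (-1) ^+ m * form y (z *m X ^+ m).
Proof.
move=> Xm; rewrite form_unip_pow; congr (_ * _).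
have fx : z *m X ^+ m *m A = z *m X ^+ m.
  have : z *m X ^+ m *m X = 0 by rewrite -mulmxA -[_ *m X]exprSr Xm mulmx0.
  by rewrite mulmxBr mulmx1 => /eqP; rewrite subr_eq0 => /eqP.
elim: (m in A ^+ m) => [|i IH]; first by rewrite expr0 mulmx1.
by rewrite exprSr mulmxA -[in X in form _ X]fx form_isometry.
Qed.

Lemma perp_pow m : (perp (X ^+ m) :=: kermx (X ^+ m))%MS.
Proof.
apply/eqmx_sym/eqmxP.
have s : (kermx (X ^+ m) <= perp (X ^+ m))%MS.
  apply/row_subP=> i; apply/perpP=> _ /submxP[z ->].
  have /sub_kermxP e := row_sub i (kermx (X ^+ m)).
  by rewrite formC form_unip_pow e form0r mulr0.
by rewrite -(mxrank_leqif_eq s) rank_perp mxrank_ker.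
Qed.

Lemma fixedE (y : 'rV[R]_N) : (y <= kermx X)%MS = (y *m A == y).
Proof.
apply/sub_kermxP/eqP; rewrite mulmxBr mulmx1; first by move/eqP; rewrite subr_eq0 => /eqP.
by move=> ->; rewrite subrr.
Qed.

End UnipotentIsometry.

Definition one_point (R : fieldType) N (A : 'M[R]_N) (r : 'rV[R]_N) : Prop :=
  [/\ r != 0, form r r = 0, r *m A = r &
      forall v, form v v = 0 -> v *m A = v -> (v <= r)%MS].

Section Classification.
Variables (F : finFieldType) (n : nat).
Local Notation N := n.*2.+1.
Local Notation GL := {'GL_N[F]}.
Hypothesis F2 : 2%:R != 0 :> F.
Variables (x : GL) (k : nat).
Hypothesis xG : x \in SO F n.
Local Notation A := (mx_of x).
Local Notation X := (A - 1%:M).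
Hypothesis Xk : X ^+ k = 0.

Let iA : isometry A := SO_isometry xG.

(** A stable flag through [D] has a member of rank [\rank E], which can only be [E]. *)
Lemma sole_isot_le (E D : 'M[F]_N) : sole_isot x E -> isot D -> stablemx D A ->
  (\rank D <= \rank E)%N -> (D <= E)%MS.
Proof.
case=> iE sE uE iD sD rDE; have rE := isot_rank_n iE.
have [W [fW /stable_flagP sW e]] := flag_through F2 iA Xk iD sD.
rewrite -(uE (W (\rank E))).
- by rewrite -e (flag_sub fW) ?rDE.
- exact: flag_isot fW rE.
- exact: sW.
- by have [-> //] := fW.
Qed.

(* Otherwise [E] is not the only stable isotropic space of its rank: it can be
   replaced by a hyperplane of a larger stable isotropic space, or, when it is
   maximal, by a neighbour that meets it in codimension one. *)
Lemma sole_rank_mul (E : 'M[F]_N) : (1 < n)%N -> sole_isot x E ->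
  (\rank (E :&: kermx X)%MS <= 1)%N.
Proof.
move=> n1 soE; have [iE sE uE] := soE; have rE := isot_rank_n iE.
have sEX : stablemx E X by rewrite stablemx_sub1.
move: rE; rewrite leq_eqVlt => /predU1P[rE|rE]; last first.
  have [y [yE iT sT]] := extend_isot F2 iA Xk iE sE rE.
  set T := (E + y)%MS in iT sT.
  have rT : \rank T = (\rank E).+1 by apply: rank_add_row.
  have yX : (T *m X <= E)%MS.
    by apply: nilp_rank1_quotient Xk _ sEX (addsmxSl _ _) rT; rewrite stablemx_sub1.
  (* Otherwise a hyperplane [C] of [E] contains [T X], and [C + y] is a second stable isotropic
     space of the rank of [E]. The inequality makes the kernel of [X] on [T] at most a line. *)
  have h : (\rank E <= \rank (T *m X))%N.
    rewrite leqNgt; apply/negP=> lt.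
    have [|C [TC CE rC]] := @subspace_between _ _ _ _ _ _ (\rank E).-1 yX.
      by move: lt; move: (\rank _) (\rank _); clear; lia.
    have yC : ~~ (y <= C)%MS by apply: contra yE => /submx_trans; apply.
    have CT : (C + y <= T)%MS by rewrite addsmx_sub addsmxSr (submx_trans CE) ?addsmxSl.
    have := uE (C + y)%MS (isotS CT iT).
    case/(_ _ _)/eqmxP/andP.
    - rewrite -stablemx_sub1; apply: submx_trans (submxMr _ CT) _.
      exact: submx_trans TC (addsmxSl _ _).
    - by rewrite rank_add_row // rC; move: lt; move: (\rank _) (\rank _); clear; lia.
    by move=> s _; case/negP: yE; apply: submx_trans s; apply: addsmxSr.
  have := mxrank_mul_ker T X; rewrite rT => e.
  have : (\rank (E :&: kermx X)%MS <= \rank (T :&: kermx X)%MS)%N.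
    by apply/mxrankS/capmxS; rewrite ?addsmxSl.
  by move: h e; move: (\rank _) (\rank _) (\rank _) (\rank _); clear; lia.
(* Otherwise [E X] fits into a space [D] of codimension two in [E], which leaves room for a
   neighbour of [E]. *)
have h : (n.-1 <= \rank (E *m X))%N; last first.
  have := mxrank_mul_ker E X; rewrite rE; move: h n1.
  by move: (\rank _) (\rank _); clear; lia.
rewrite leqNgt; apply/negP=> lt.
have [|D [XD DE rD]] := @subspace_between _ _ _ _ _ _ n.-2 sEX.
  by rewrite rE; move: lt; move: (\rank _); clear; lia.
have sD : stablemx D X by apply: submx_trans XD; apply: submxMr.
have sDA : stablemx (perp D) A by rewrite stablemx_perp // -stablemx_sub1.
have sPA : stablemx (perp E) A by rewrite stablemx_perp // -stablemx_sub1.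
have h1 : (perp D *m X <= perp E)%MS.
  apply/row_subP=> i; rewrite row_mul; apply/perpP=> e eE.
  rewrite form_unip_perp // (perpP _ _ _ _ (submx_trans (submxMr X eE) XD)) ?oppr0 //.
  by apply: submx_trans sDA; apply: submxMr; apply: row_sub.
have rP : \rank (perp E) = n.+1 by rewrite rank_perp rE; clear; lia.
have h2 : (perp E *m X <= E)%MS.
  by apply: nilp_rank1_quotient Xk _ sEX iE _; rewrite ?stablemx_sub1 // rP rE.
(* [Y] is [X] followed by reduction modulo [E]. It maps [perp D] into the line of [perp E] modulo
   [E], so its kernel on [perp D] is too large to lie in [perp E]. *)
pose Y := X *m cokermx E.
have rY : (\rank (perp D *m Y) <= 1)%N.
  have : (\rank (perp D *m Y) <= \rank (perp E *m cokermx E))%N.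
    by rewrite mulmxA; apply/mxrankS/submxMr.
  have := mxrank_mul_ker (perp E) (cokermx E); rewrite rP.
  have : (E <= perp E :&: kermx (cokermx E))%MS.
    by rewrite sub_capmx (iE : (E <= perp E)%MS); apply/sub_kermxP/mulmx_coker.
  by move/mxrankS; rewrite rE; move: (\rank _) (\rank _) (\rank _); clear; lia.
have [w wP wE] : exists2 w : 'rV_N, (w <= perp D :&: kermx Y)%MS & ~~ (w <= perp E)%MS.
  apply/sub_rowPn/negP=> /mxrankS; rewrite rP.
  have := mxrank_mul_ker (perp D) Y; rewrite rank_perp rD; move: rY n1.
  by move: (\rank _) (\rank _); clear; lia.
have wD : (w <= perp D)%MS := submx_trans wP (capmxSl _ _).
have wX : (w *m X <= E)%MS.
  have /sub_kermxP := submx_trans wP (capmxSr _ _).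
  by rewrite mulmxA => /eqP; rewrite -submxE.
(* The neighbour is [E0 + w'], with [w'] the vector [w] made singular by adding a multiple of some
   [w0] in [E]. It is stable because [E X] and [w X] lie in [E0]. *)
pose E0 := (E :&: perp w)%MS.
have DE0 : (D <= E0)%MS by rewrite sub_capmx DE perpC.
have wXw : form (w *m X) w = 0.
  have e : form (w *m X) (w *m X) = 0 := row_singular iE wX.
  have wAE : w *m A = w + w *m X by rewrite mulmxBr mulmx1 addrC subrK.
  have := form_unip_perp w w iA; rewrite wAE formDl e addr0 (formC w) => /eqP.
  by rewrite -addr_eq0 -mulr2n -mulr_natl mulf_eq0 (negPf F2) => /eqP.
have wXE0 : (w *m X <= E0)%MS by rewrite sub_capmx wX sub_perp form_mx wXw raddf0 eqxx.
have [w0 w0E w0w] : exists2 w0 : 'rV_N, (w0 <= E)%MS & form w w0 != 0.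
  have [w0 w0E h] : exists2 w0 : 'rV_N, (w0 <= E)%MS & ~~ (w0 <= perp w)%MS.
    by apply/sub_rowPn; rewrite perpC.
  exists w0; first exact: w0E.
  apply: contraNneq h => e.
  by rewrite sub_perp form_mx formC e raddf0.
pose w' := w - (form w w / (2%:R * form w w0)) *: w0.
have w0w0 : form w0 w0 = 0 := row_singular iE w0E.
have w'w' : form w' w' = 0.
  by rewrite !formS w0w0 (formC w0 w); field; rewrite w0w F2.
have w'E : ~~ (w' <= E)%MS.
  apply: contra wE => w'E; apply: submx_trans iE.
  rewrite -(subrK ((form w w / (2%:R * form w w0)) *: w0) w) addmx_sub //.
  exact: scalemx_sub.
have E0E : (E0 <= E)%MS := capmxSl _ _.
have w'E0 : ~~ (w' <= E0)%MS by apply: contra w'E => /submx_trans; apply.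
have iE' : isot (E0 + w')%MS.
  apply: isotD_row => //; first exact: isotS iE.
  rewrite addmx_sub //; first by rewrite perpC capmxSr.
  rewrite -scaleNr scalemx_sub //; apply: submx_trans w0E _.
  exact: submx_trans iE (perpS E0E).
have sE' : stablemx (E0 + w')%MS A.
  apply: stablemx_add_row.
    rewrite -stablemx_sub1; apply: submx_trans DE0.
    by apply: submx_trans XD; apply: submxMr.
  rewrite mulmxBl addmx_sub // -scalemxAl -scaleNr scalemx_sub //.
  apply: submx_trans DE0; apply: submx_trans XD; exact: submxMr.
have rE0 : (n <= (\rank E0).+1)%N.
  have := rank_cap_perp E w; rewrite rE rank_rV; case: (w == 0) => /=; rewrite -/E0;
    by move: (\rank _); clear; lia.
have rE' : \rank (E0 + w')%MS = \rank E.
  apply/eqP; rewrite rE eqn_leq isot_rank_n //= rank_add_row //.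
have /eqmxP/andP[s _] := uE _ iE' sE' rE'.
by case/negP: w'E; apply: submx_trans s; apply: addsmxSr.
Qed.

(** Any fixed singular line is a stable isotropic space, hence lies in [E], where the fixed vectors
    form at most a line. *)
Lemma sole_isot_one_point (E : 'M[F]_N) : (1 < n)%N -> (0 < \rank E)%N ->
  sole_isot x E -> exists r, one_point A r.
Proof.
move=> n1 rE soE; have [iE sE uE] := soE; have rk := sole_rank_mul n1 soE.
have [||r [rE' r0 rX]] := @nilp_fixed_mod _ _ _ _ X E (0 : 'M_N) _ Xk.
- by rewrite stablemx_sub1.
- by rewrite submx0 -mxrank_eq0 -lt0n.
rewrite submx0 in r0; rewrite submx0 in rX.
have fr : (r <= kermx X)%MS by apply/sub_kermxP/eqP.
exists r; split=> //; first exact: row_singular iE rE'.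
  by apply/eqP; rewrite -fixedE.
move=> v vv vA; have vE : (v <= E)%MS.
  rewrite -(genmxE v); apply: (sole_isot_le soE).
  - by apply: isotS (singular_row_isot vv); rewrite genmxE.
  - by rewrite (stablemx_eqmx _ (genmxE v)) vA.
  - by rewrite genmxE (leq_trans (rank_leq_row v)).
have rC : (r <= E :&: kermx X)%MS by rewrite sub_capmx rE'.
have vC : (v <= E :&: kermx X)%MS by rewrite sub_capmx vE fixedE vA eqxx.
apply: submx_trans vC _; rewrite -(mxrank_leqif_sup rC).
by rewrite eqn_leq mxrankS //= rank_rV r0.
Qed.

Section OnePoint.
Variable r : 'rV[F]_N.
Hypothesis pr : one_point A r.

Lemma anisotropic_rank (D : 'M[F]_N) : (D <= kermx X)%MS -> ~~ (r <= D)%MS ->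
  (\rank D <= 2)%N.
Proof.
move=> DK rD; rewrite leqNgt; apply/negP=> /ternary_isotropic[y yD /andP[y0 /eqP yy]].
have [r0 rr rA ur] := pr; case/negP: rD; have : (y <= kermx X)%MS := submx_trans yD DK.
rewrite fixedE => /eqP yA; have /sub_rVP[c yc] := ur y yy yA.
have c0 : c != 0 by apply: contraNneq y0 => c0; rewrite yc c0 scale0r.
by rewrite -(eqmx_scale r c0) -yc.
Qed.

(** The image of [X] is orthogonal to its kernel, so vectors common to both are singular. *)
Lemma cap_fixed_image : (kermx X :&: X <= r)%MS.
Proof.
have [r0 rr rA ur] := pr; apply/row_subP=> i; set y := row i _.
have yC : (y <= kermx X :&: X)%MS by apply: row_sub.
have yK := submx_trans yC (capmxSl _ _); have yX := submx_trans yC (capmxSr _ _).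
apply: ur; last by apply/eqP; rewrite -fixedE.
have := perp_pow iA 1; rewrite expr1 => e.
by move: yK; rewrite -e => /perpP; apply.
Qed.

Lemma rank_fixed_le : (\rank (kermx X) <= 3)%N.
Proof.
have [r0 rr rA ur] := pr.
have rK : (r <= kermx X)%MS by rewrite fixedE rA.
have := mxrank_cap_compl (kermx X) r; move/capmx_idPr: (rK) => ->.
rewrite rank_rV r0 => <-; rewrite add1n ltnS; apply: anisotropic_rank.
  exact: diffmxSl.
apply/negP=> rD; have : (r <= (kermx X :\: r) :&: r)%MS by rewrite sub_capmx rD submx_refl.
by rewrite capmx_diff submx0 (negPf r0).
Qed.

Lemma rank_pow_step j : (0 < j)%N -> (\rank (X ^+ j) <= (\rank (X ^+ j.+1)).+1)%N.
Proof.
case: j => // j _; have := mxrank_mul_ker (X ^+ j.+1) X; rewrite mulmxE -exprSr => <-.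
rewrite -[leqRHS]addn1 leq_add2l.
apply: leq_trans (rank_leq_row r); apply/mxrankS.
apply: submx_trans cap_fixed_image; rewrite sub_capmx capmxSr.
by apply: submx_trans (capmxSl _ _) _; rewrite exprSr -mulmxE submxMl.
Qed.

Lemma rank_pow_ge j : (\rank X <= \rank (X ^+ j.+1) + j)%N.
Proof.
elim: j => [|j IH]; first by rewrite expr1 addn0.
by have := rank_pow_step (ltn0Sn j); move: IH; move: (\rank _) (\rank _) (\rank _); clear; lia.
Qed.

(** For odd [m = 2n-1] the form [(y X^m, z)] is alternating, and the image of [X^m] lies in the line
    of [r]; an alternating form of rank at most one vanishes. *)
Lemma pow_parity : (0 < n)%N -> X ^+ n.*2 = 0 -> X ^+ (n.*2).-1 = 0.
Proof.
move=> n0 X2n; have [r0 rr rA ur] := pr.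
set m := (n.*2).-1; have mS : m.+1 = n.*2 by rewrite prednK // double_gt0.
have om : odd m by rewrite -[odd m]negbK -oddS mS odd_double.
have X0 : X ^+ m.+1 = 0 by rewrite mS.
have sk y z : form (y *m X ^+ m) z = - form y (z *m X ^+ m).
  by rewrite (form_unip_skew iA) // -signr_odd om expr1 mulN1r.
have yr (y : 'rV_N) : (y *m X ^+ m <= r)%MS.
  have yK : y *m X ^+ m *m A = y *m X ^+ m.
    by apply/eqP; rewrite -fixedE; apply/sub_kermxP; rewrite -mulmxA mulmxE -exprSr X0 mulmx0.
  apply: ur => //; rewrite sk -mulmxA mulmxE -exprD.
  have -> : (m + m = m.+1 + m.-1)%N by rewrite addSnnS (prednK (odd_gt0 om)).
  by rewrite exprD X0 mul0r mulmx0 form0r oppr0.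
have yy (y : 'rV_N) : form (y *m X ^+ m) y = 0.
  have := sk y y; rewrite (formC y) => /eqP.
  by rewrite -addr_eq0 -mulr2n -mulr_natl mulf_eq0 (negPf F2) => /eqP.
apply/eqP; apply: contraT => nz.
have [y1 hy1] : exists y1 : 'rV_N, y1 *m X ^+ m != 0.
  have : (0 < \rank (X ^+ m))%N by rewrite lt0n mxrank_eq0.
  by case/nonzero_row=> y /submxP[y1 ->] h; exists y1.
have [y2 hy2] : exists y2, form r y2 != 0.
  have rn0 : ~~ (r <= (0 : 'M_N))%MS by rewrite submx0.
  have [y2 _ h] := nonorth_perp rn0.
  by exists y2.
(* A space is not the union of two proper subspaces, which [y1] and [y2] make explicit. *)
have dich y : y *m X ^+ m = 0 \/ form r y = 0.
  have /sub_rVP[c e] := yr y; have := yy y; rewrite e formZl => /eqP.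
  by rewrite mulf_eq0 => /orP[/eqP->|/eqP]; [left; rewrite scale0r | right].
have h1 : form r y1 = 0 by have [h|//] := dich y1; rewrite h eqxx in hy1.
have h2 : y2 *m X ^+ m = 0 by have [//|h] := dich y2; rewrite h eqxx in hy2.
have [] := dich (y1 + y2).
  by rewrite mulmxDl h2 addr0 => h; rewrite h eqxx in hy1.
by rewrite formDr h1 add0r => h; rewrite h eqxx in hy2.
Qed.

(* Equivalent to having Jordan form (2n-1,1,1). *)
Definition type3 : Prop :=
  [/\ X ^+ (n.*2).-2 != 0, X ^+ (n.*2).-1 = 0 & \rank X = (n.*2).-2].

(** The kernel of [X] has dimension at most three, and each further power of [X] loses at most one
    dimension; with [X^(2n-1) = 0] both bounds are attained. *)
Lemma one_point_type3 : (0 < n)%N -> X ^+ n.*2 = 0 -> type3.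
Proof.
move=> n0 X2n; have X1 := pow_parity n0 X2n.
have rk := rank_fixed_le; rewrite mxrank_ker in rk.
have rX : \rank X = (n.*2).-2.
  apply/eqP; rewrite eqn_leq; apply/andP; split; last first.
    by move: rk n0; move: (\rank _); clear; lia.
  have := rank_pow_ge (n.*2).-2.
  have -> : (n.*2).-2.+1 = (n.*2).-1 by move: n0; clear; lia.
  by rewrite X1 mxrank0.
split=> //; rewrite -mxrank_eq0 -lt0n.
have [n1|n1] := eqVneq n 1%N.
  by have -> : (n.*2).-2 = 0%N; [rewrite n1 | rewrite expr0 mxrank1].
have := rank_pow_ge (n.*2).-2.-1; rewrite rX.
have -> : (n.*2).-2.-1.+1 = (n.*2).-2 by move: n1 n0; clear; lia.
by move: n1 n0; move: (\rank _); clear; lia.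
Qed.

End OnePoint.

End Classification.

(** * Flag stabilisers inside the subnormaliser *)

Section FlagStabilisers.
Variables (F : finFieldType) (n : nat).
Local Notation N := n.*2.+1.
Local Notation GL := {'GL_N[F]}.
Hypothesis F2 : 2%:R != 0 :> F.
Variables (x : GL).
Hypothesis xG : x \in SO F n.
Local Notation A := (mx_of x).
Local Notation X := (A - 1%:M).

Let iA : isometry A := SO_isometry xG.

(* The chain [0 <= W 1 <= .. <= W l <= perp (W l) <= .. <= perp (W 0)]. *)
Definition full_chain l (W : nat -> 'M[F]_N) j : 'M[F]_N :=
  if (j <= l)%N then W j else perp (W (l.*2.+1 - j)%N).

(** It suffices that [x] acts trivially on the factors of the chain completed by orthogonals; for
    the upper half this follows by duality. *)
Lemma flag_stab_sub_subnormaliser l W : flag l W -> x \in flag_stab l W ->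
  (forall j, (j < l)%N -> (W j.+1 *m X <= W j)%MS) -> (perp (W l) *m X <= W l)%MS ->
  SO F n :&: flag_stab l W \subset subnormaliser (SO F n) x.
Proof.
move=> fW /flag_stabP sx hW hl; apply/subsetP=> g /setIP[gG /flag_stabP sg].
apply: mem_gen; rewrite inE gG /=.
have [rW iW sW] := fW; set C := full_chain l W.
have W0 : W 0%N = 0 by apply/eqP; rewrite -mxrank_eq0 rW.
have CC j : (j <= l)%N -> C (l.*2.+1 - j)%N = perp (W j).
  move=> jl; have h : (l.*2.+1 - j <= l)%N = false by move: jl; clear; lia.
  by rewrite /C /full_chain h subKn //; move: jl; clear; lia.
have CW j : (j <= l)%N -> C j = W j by rewrite /C /full_chain => ->.
have cut j : (j < l.*2.+1)%N -> [\/ (j < l)%N, j = l |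
    exists2 i, (i < l)%N & j = (l.*2.+1 - i.+1)%N].
  move=> jm; case: (ltngtP j l) => [jl|lj|->]; [by constructor 1| |by constructor 2].
  by constructor 3; exists (l.*2.+1 - j.+1)%N; move: jm lj; clear; lia.
have C0 : C 0%N = 0 by rewrite CW.
have Cm : (1%:M <= C l.*2.+1)%MS.
  by have := CC 0%N isT; rewrite subn0 => ->; rewrite sub_perp W0 trmx0 mulmx0.
have CS j : (j < l.*2.+1)%N -> (C j <= C j.+1)%MS.
  case/cut=> [jl|->|[i il ->]].
  - by rewrite !CW ?sW ?(ltnW jl).
  - rewrite [C l]CW //; have -> : l.+1 = (l.*2.+1 - l)%N by clear; lia.
    by rewrite CC.
  - have -> : (l.*2.+1 - i.+1).+1 = (l.*2.+1 - i)%N by move: il; clear; lia.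
    by rewrite !CC ?(ltnW il) //; apply: perpS; apply: sW.
apply: (subnormal_chain C0 Cm CS).
  apply/flag_stabP=> j jm; rewrite /C /full_chain; case: ifP => jl; first exact: sg.
  apply: stablemx_perp; first exact: SO_isometry.
  by apply: sg; move: jl; clear; lia.
apply/chain_kerP=> j /cut[jl|->|[i il ->]].
- by rewrite !CW ?hW ?(ltnW jl).
- rewrite [C l]CW //; have -> : l.+1 = (l.*2.+1 - l)%N by clear; lia.
  by rewrite CC.
- have -> : (l.*2.+1 - i.+1).+1 = (l.*2.+1 - i)%N by move: il; clear; lia.
  rewrite !CC ?(ltnW il) //; apply/row_subP=> r; rewrite row_mul; apply/perpP=> e eW.
  rewrite form_unip_perp //; apply/eqP; rewrite oppr_eq0; apply/eqP.
  have sP : stablemx (perp (W i)) A by rewrite stablemx_perp // sx // ltnW.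
  apply: (perpP _ _ (submx_trans (submxMr A (row_sub r _)) sP)).
  exact: submx_trans (submxMr X eW) (hW i il).
Qed.

Lemma full_flag_sub_subnormaliser k W : X ^+ k = 0 -> flag n W -> x \in flag_stab n W ->
  SO F n :&: flag_stab n W \subset subnormaliser (SO F n) x.
Proof.
move=> Xk fW xW; apply: flag_stab_sub_subnormaliser => //; move/flag_stabP: xW => xW.
  have [rW iW sW] := fW; move=> j jn; apply: (nilp_rank1_quotient Xk);
    by rewrite ?stablemx_sub1 ?xW ?sW ?rW // ltnW.
have [rW iW sW] := fW; apply: (nilp_rank1_quotient Xk); rewrite ?stablemx_sub1 ?stablemx_perp ?xW //.
by rewrite rank_perp rW //; clear; lia.
Qed.

Lemma SO_moves_line (r : 'rV[F]_N) : (1 < n)%N -> r != 0 -> form r r = 0 ->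
  exists2 g, g \in SO F n & ~~ (r *m mx_of g <= r)%MS.
Proof.
move=> n1 r0 rr; have i0 : isometry (1%:M : 'M[F]_N) by apply/isometryP => u v; rewrite !mulmx1.
have X0 : (1%:M - 1%:M : 'M[F]_N) ^+ 1 = 0 by rewrite subrr expr1.
have rk : \rank (<<r>>%MS : 'M[F]_N) = 1%N by rewrite genmxE rank_rV r0.
have [||W [fW _ e]] := flag_through F2 i0 X0 (E := <<r>>%MS); rewrite ?mulmx1 //.
  by apply: isotS (singular_row_isot rr); rewrite genmxE.
rewrite rk in e; have re : (W 1%N :=: r)%MS := eqmx_trans e (genmxE r).
have [v v2 v1] := flag_vector fW n1.
have iW2 := flag_isot fW n1; have vv := row_singular iW2 v2.
have v0 : v != 0 by apply: contraNneq v1 => ->; apply: sub0mx.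
pose W' (u : 'rV[F]_N) (j : nat) : 'M[F]_N := if j == 0%N then 0 else <<u>>%MS.
have fW' u : u != 0 -> form u u = 0 -> flag 1 (W' u).
  move=> u0 uu; split; rewrite /W' /=.
  - by case=> [|[|//]] _ /=; rewrite ?mxrank0 // genmxE rank_rV u0.
  - by apply: isotS (singular_row_isot uu); rewrite genmxE.
  - by case=> // _; apply: sub0mx.
have hE u : u != 0 -> form u u = 0 -> has_eichler (SO F n) u.
  move=> _ uu w uw; exact: mx_of_SO (eichler_SO F2 uu uw).
have [h hG hW] := flag_move F2 (subxx _) (ltnW n1) hE (fW' r r0 rr) (fW' v v0 vv).
exists h => //; apply: contra v1 => rh; rewrite re; apply: submx_trans rh.
have := hW 1%N isT; rewrite /W' /= => e1.
by rewrite -(genmxE v) -e1 (eqmxMr _ (genmxE r)).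
Qed.

Lemma one_point_subnormaliser k r : X ^+ k = 0 -> (1 < n)%N -> one_point A r ->
  subnormaliser (SO F n) x <> SO F n :> {set _}.
Proof.
move=> Xk n1 pr; have [r0 rr rA ur] := pr.
have so : sole_isot x (<<r>>%MS : 'M_N).
  split.
  - by apply: isotS (singular_row_isot rr); rewrite genmxE.
  - by rewrite (stablemx_eqmx _ (genmxE r)) rA.
  move=> E iE sE; rewrite genmxE rank_rV r0 => rE.
  have [||y [yE y0 yX]] := @nilp_fixed_mod _ _ _ _ X E (0 : 'M_N) _ Xk.
  - by rewrite stablemx_sub1.
  - by rewrite submx0 -mxrank_eq0 rE.
  rewrite submx0 in y0; have eE : (y :=: E)%MS.
    by apply/eqmxP; rewrite -(mxrank_leqif_eq yE) rE rank_rV y0.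
  apply: eqmx_trans (eqmx_sym eE) _; apply: eqmx_trans (eqmx_sym (genmxE r)).
  have s : (y <= r)%MS.
    apply: ur; first exact: row_singular iE yE.
    by apply/eqP; rewrite -fixedE; apply/sub_kermxP/eqP; rewrite -submx0.
  by apply/eqmxP; rewrite -(mxrank_leqif_eq s) !rank_rV y0 r0.
move=> eS; have [g gG] := SO_moves_line n1 r0 rr; case/negP.
have := subnormaliser_sole xG so (g := g); rewrite eS => /(_ gG).
by rewrite (stablemx_eqmx _ (genmxE r)).
Qed.

Lemma subnormaliser_one_point k : X ^+ k = 0 -> (1 < n)%N ->
  subnormaliser (SO F n) x <> SO F n :> {set _} -> exists r, one_point A r.
Proof.
move=> Xk n1 neq; have SG := subnormaliser_sub x.
have [||E soE /andP[rE0 rE]] := @sole_isot_of_overgroup F n x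
    (<<subnormaliser_set (SO F n) <[x]> >>)%G k F2 (ltnW n1) SG xG Xk.
- move=> W fW sW; apply: full_flag_sub_subnormaliser Xk fW _.
  by rewrite inE.
- exact: neq.
exact: (sole_isot_one_point F2 xG Xk n1 rE0 soE).
Qed.

End FlagStabilisers.

(** * The subnormaliser for Jordan form (2n-1,1,1) *)

Section Type3.
Variables (F : finFieldType) (n : nat).
Local Notation N := n.*2.+1.
Local Notation GL := {'GL_N[F]}.
Hypothesis F2 : 2%:R != 0 :> F.
Variables (x : GL).
Hypothesis xG : x \in SO F n.
Hypothesis n1 : (1 < n)%N.
Hypothesis t3 : type3 x.
Local Notation A := (mx_of x).
Local Notation X := (A - 1%:M).

Let iA : isometry A := SO_isometry xG.

Lemma type3_pow_eq0 j : ((n.*2).-1 <= j)%N -> X ^+ j = 0.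
Proof. by case: t3 => _ e _ /subnKC<-; rewrite exprD e mul0r. Qed.

Lemma type3_rank_step j : (j < (n.*2).-1)%N -> (\rank (X ^+ j.+1) < \rank (X ^+ j))%N.
Proof.
move=> jn; case: t3 => nz e _; rewrite exprSr -mulmxE; apply: rank_nilp_lt e _ _.
  by rewrite mulmxE -exprSr exprS -mulmxE submxMl.
apply: contraNneq nz => e0; have h : (j <= (n.*2).-2)%N by move: jn; clear; lia.
by rewrite -(subnKC h) exprD e0 mul0r.
Qed.

(** The ranks decrease strictly from [2n-2] at [j = 1] to [0] at [j = 2n-1], which determines
    them. *)
Lemma type3_rank j : (0 < j <= (n.*2).-1)%N -> \rank (X ^+ j) = ((n.*2).-1 - j)%N.
Proof.
case/andP=> j0 jn; have [nz e rX] := t3; apply/eqP; rewrite eqn_leq; apply/andP; split.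
  elim: j j0 jn => // j IH _ jn; have [->|j0] := posnP j; first by rewrite expr1 rX; clear; lia.
  have := IH j0 (ltnW jn); have := type3_rank_step jn.
  by move: (\rank _) (\rank _); clear; lia.
have h i : (i <= (n.*2).-1)%N -> (i <= \rank (X ^+ ((n.*2).-1 - i)))%N.
  elim: i => // i IH i_n; have := IH (ltnW i_n).
  have := @type3_rank_step ((n.*2).-1 - i.+1); rewrite subnSK // => s.
  have {}s := s (leq_subr _ _).
  by move: s; move: (\rank _) (\rank _); clear; lia.
by have := h ((n.*2).-1 - j)%N (leq_subr _ _); rewrite subKn.
Qed.

(** Images of the powers of [X], indexed backwards so that [W j] has rank [j] for [j < 2n-1]. *)
Definition type3_flag j : 'M[F]_N := X ^+ ((n.*2).-1 - j).
Local Notation W := type3_flag.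

Lemma type3_flag_rank j : (j < (n.*2).-1)%N -> \rank (W j) = j.
Proof.
move=> jn; rewrite /W type3_rank; first by rewrite subKn // ltnW.
by rewrite leq_subr subn_gt0 jn.
Qed.

Lemma type3_isot j : (j < n)%N -> isot (W j).
Proof.
move=> jn; apply/isotP=> _ _ /submxP[a ->] /submxP[b ->].
rewrite form_unip_pow // -!mulmxA mulmxE -exprD [X ^+ (_ + _)]type3_pow_eq0 ?mulmx0 ?form0r ?mulr0 //.
by move: jn; clear; lia.
Qed.

Lemma type3_flagP : flag n.-1 W.
Proof.
split=> [j jn||j jn].
- by apply: type3_flag_rank; move: jn n1; clear; lia.
- by apply: type3_isot; move: n1; clear; lia.
- rewrite /W -subnSK; last by move: jn; clear; lia.
  by rewrite exprS -mulmxE submxMl.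
Qed.

Lemma type3_stable j : stablemx (W j) A.
Proof. by rewrite /W -comm_unip submxMl. Qed.

Lemma type3_rank_cap : (\rank (kermx X :&: X)%MS <= 1)%N.
Proof.
have [nz e rX] := t3; have := mxrank_mul_ker X X; rewrite capmxC rX.
have := @type3_rank 2; rewrite expr2 -mulmxE => ->; last by move: n1; clear; lia.
by move: n1; move: (\rank _); clear; lia.
Qed.

(** The sum lies in the kernel, and both sides have dimension [j + 2], since [W j] meets [kermx X]
    in at most a line. *)
Lemma type3_ker j : (0 < j <= n)%N -> (kermx (X ^+ j) :=: W j + kermx X)%MS.
Proof.
case/andP=> j0 jn; apply/eqmx_sym/eqmxP.
have s : (W j + kermx X <= kermx (X ^+ j))%MS.
  rewrite addsmx_sub; apply/andP; split; apply/sub_kermxP.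
    rewrite mulmxE -exprD type3_pow_eq0 //; move: jn; clear; lia.
  by case: j j0 {jn} => // j _; rewrite exprS -mulmxE mulmxA mulmx_ker mul0mx.
rewrite -(mxrank_leqif_eq s) eqn_leq mxrankS //=.
have := mxrank_sum_cap (W j) (kermx X).
rewrite !mxrank_ker type3_rank ?type3_flag_rank; last first.
- by rewrite j0; move: jn; clear; lia.
- by move: jn n1; clear; lia.
have [_ _ ->] := t3.
have : (\rank (W j :&: kermx X)%MS <= 1)%N.
  apply: leq_trans type3_rank_cap; rewrite capmxC; apply/mxrankS/capmxS => //.
  rewrite /W; have -> : ((n.*2).-1 - j = ((n.*2).-2 - j).+1)%N by move: jn n1 j0; clear; lia.
  by rewrite exprSr -mulmxE submxMl.
move: (\rank _) (\rank _) => a b; move: jn n1 j0; clear; lia.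
Qed.

Variable r : 'rV[F]_N.
Hypothesis pr : one_point A r.

(** A stable [E] of rank [j] is killed by [X^j], so each of its vectors is [w + v] with [w] in [W j]
    and [v] fixed. These are orthogonal, so [v] is singular and thus a multiple of [r]. *)
Lemma type3_sole j : (0 < j < n)%N -> sole_isot x (W j).
Proof.
case/andP=> j0 jn; split; [exact: type3_isot | exact: type3_stable|].
move=> E iE sE; have jn' : (j < (n.*2).-1)%N by move: jn n1; clear; lia.
rewrite type3_flag_rank // => rE.
have [r0 rr rA ur] := pr.
have EK : (E <= kermx (X ^+ j))%MS.
  apply/sub_kermxP; rewrite -rE; apply: (stable_nilp (type3_pow_eq0 (leqnn _))).
  by rewrite stablemx_sub1.
have rW : (r <= W j)%MS.
  have r1 : \rank (W 1) = 1%N by apply: type3_flag_rank; move: n1; clear; lia.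
  have s : (W 1 <= r)%MS.
    apply/row_subP=> i; apply: ur.
      apply: row_singular (row_sub i _); apply: type3_isot; exact: n1.
    apply/eqP; rewrite -fixedE; apply/sub_kermxP; rewrite -row_mul /W mulmxE -exprSr type3_pow_eq0.
      by rewrite row0.
    by move: n1; clear; lia.
  have : (r <= W 1)%MS by rewrite -(mxrank_leqif_sup s) r1 rank_rV r0.
  move/submx_trans; apply; apply: (flag_sub type3_flagP); move: jn j0; clear; lia.
have s : (E <= W j)%MS.
  apply/row_subP=> i; set y := row i E; have yE : (y <= E)%MS := row_sub i E.
  have : (y <= W j + kermx X)%MS by rewrite -type3_ker ?j0 ?(ltnW jn) // (submx_trans yE EK).
  case/sub_addsmxP=> -[c d] /= yy; rewrite yy.
  set w := c *m W j; set v := d *m kermx X.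
  have wW : (w <= W j)%MS := submxMl _ _.
  have vK : (v <= kermx X)%MS := submxMl _ _.
  have wv : form w v = 0.
    rewrite formC; have := perp_pow iA 1; rewrite expr1 => eP.
    apply: (perpP X); first by rewrite eP.
    apply: submx_trans wW _; rewrite /W.
    have -> : ((n.*2).-1 - j = ((n.*2).-2 - j).+1)%N by move: jn n1 j0; clear; lia.
    by rewrite exprSr -mulmxE submxMl.
  rewrite addmx_sub //; apply: submx_trans rW; apply: ur; last by apply/eqP; rewrite -fixedE.
  have := row_singular iE yE; rewrite yy -/w -/v !formS (formC v w) wv.
  by rewrite (row_singular (type3_isot jn) wW) !add0r.
by apply/eqmxP; rewrite -(mxrank_leqif_eq s) rE type3_flag_rank.
Qed.

Lemma type3_subnormaliser : subnormaliser (SO F n) x = SO F n :&: flag_stab n.-1 W.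
Proof.
apply/eqP; rewrite eqEsubset; apply/andP; split.
  rewrite subsetI subnormaliser_sub //=; apply/subsetP=> g gS; apply/flag_stabP=> -[|j] jn.
    by have -> : W 0 = 0; [rewrite /W subn0 type3_pow_eq0 | rewrite mul0mx sub0mx].
  apply: (subnormaliser_sole xG) gS; apply: type3_sole; move: jn; clear; lia.
apply: flag_stab_sub_subnormaliser => //; first exact: type3_flagP.
- by apply/flag_stabP=> j _; apply: type3_stable.
- move=> j jn; rewrite /W mulmxE -exprSr.
  by have -> : ((n.*2).-1 - j.+1).+1 = ((n.*2).-1 - j)%N by move: jn; clear; lia.
(* The orthogonal of [W n.-1] is the kernel of [X^n], which is [W n + kermx X]; applying [X] gives
   [W n.-1]. *)
rewrite {1}/W; have -> : ((n.*2).-1 - n.-1)%N = n by move: n1; clear; lia.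
rewrite (eqmxMr _ (perp_pow iA n)) (eqmxMr _ (type3_ker _)); last by rewrite leqnn (ltnW n1).
rewrite addsmxMr mulmx_ker; rewrite addsmx_sub sub0mx andbT /W mulmxE -exprSr.
by have -> : ((n.*2).-1 - n).+1 = ((n.*2).-1 - n.-1)%N by move: n1; clear; lia.
Qed.

End Type3.

(** * Stabilisers of standard flags *)

Section Parabolic.
Variables (F : finFieldType) (n : nat).
Local Notation N := n.*2.+1.
Local Notation GL := {'GL_N[F]}.
Hypothesis F2 : 2%:R != 0 :> F.
Hypothesis n0 : (0 < n)%N.
Implicit Types (g h : GL) (y : 'rV[F]_N).

(** The span of the last [j] coordinate vectors: these are the spaces stable under upper triangular
    matrices acting on rows. *)
Definition std_flag j : 'M[F]_N := pid_mx j *m antidiag F N.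

Lemma rev_ordE (i : 'I_N) : rev_ord i = (n.*2 - i)%N :> nat.
Proof. by rewrite /= subSS. Qed.

Lemma sub_std_flagP j y :
  reflect (forall i : 'I_N, (i + j <= n.*2)%N -> y 0 i = 0) (y <= std_flag j)%MS.
Proof.
have pidE (z : 'rV[F]_N) i : (z *m pid_mx j) 0 i = z 0 i * (i < j)%:R.
  rewrite mxE (bigD1 i) //= mxE eqxx big1 ?addr0 // => k ki.
  by rewrite mxE (inj_eq val_inj) (negPf ki) mulr0.
have pp : (pid_mx j : 'M[F]_N) *m (pid_mx j : 'M[F]_N) = pid_mx j.
  apply: mulmx_rowP => z; apply/rowP=> i; rewrite mulmxA !pidE.
  by case: (i < j)%N; rewrite ?mulr1 ?mulr0.
have eqv : (y <= std_flag j)%MS = (y *m antidiag F N *m pid_mx j == y *m antidiag F N).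
  apply/idP/eqP=> [/submxP[d ->]|e].
    by rewrite -!mulmxA (mulmxA (antidiag _ _)) antidiag_sq mul1mx mulmx1 pp.
  by rewrite -[y]mulmx1 -antidiag_sq mulmxA -e -mulmxA submxMl.
rewrite eqv; apply: (iffP eqP) => [e i ij|h].
  have := congr1 (fun z : 'rV_N => z 0 (rev_ord i)) e.
  rewrite /= pidE !mul_antidiagE rev_ordK rev_ordE.
  have -> : (n.*2 - i < j)%N = false by apply/negbTE; rewrite -leqNgt leq_subRL // -ltnS.
  by rewrite mulr0 => <-.
apply/rowP=> i; rewrite pidE !mul_antidiagE; have [ij|ji] := ltnP i j; first by rewrite mulr1.
rewrite mulr0 h // rev_ordE; move: ji (ltn_ord i); move: (nat_of_ord i); clear; lia.
Qed.

Lemma rank_std_flag j : (j <= N)%N -> \rank (std_flag j) = j.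
Proof.
move=> jN; rewrite mxrankMfree ?row_free_unit ?antidiag_unit // rank_pid_mx //.
Qed.

Lemma perp_std_flag j : (j <= N)%N -> (perp (std_flag j) :=: std_flag (N - j))%MS.
Proof.
move=> jN; apply/eqmx_sym/eqmxP.
have s : (std_flag (N - j) <= perp (std_flag j))%MS.
  apply/row_subP=> i; set y := row i _; apply/perpP=> e /sub_std_flagP he.
  have /sub_std_flagP hy : (y <= std_flag (N - j))%MS := row_sub _ _.
  rewrite formE big1 // => k _; have [kj|jk] := leqP (k + j) n.*2.
    by rewrite he ?mulr0.
  rewrite hy ?mul0r // rev_ordE; move: jk jN (ltn_ord k); move: (nat_of_ord k); clear; lia.
by rewrite -(mxrank_leqif_eq s) rank_perp !rank_std_flag // leq_subr.
Qed.

Lemma std_flag_sub i j : (i <= j)%N -> (std_flag i <= std_flag j)%MS.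
Proof.
move=> ij; apply/row_subP=> k; apply/sub_std_flagP=> l lj.
have /sub_std_flagP := row_sub k (std_flag i); apply.
by apply: leq_trans lj; rewrite leq_add2l.
Qed.

Lemma std_flagP l : (l <= n)%N -> flag l std_flag.
Proof.
move=> ln; have lN : (l <= N)%N by move: ln; clear; lia.
split=> [j jl||j jl].
- by apply: rank_std_flag; apply: leq_trans lN.
- rewrite /isot perp_std_flag //; apply: std_flag_sub; move: ln; clear; lia.
- exact: std_flag_sub.
Qed.

Lemma stable_std_flagP (g : 'M[F]_N) j :
  reflect (forall i k : 'I_N, (n.*2 < i + j)%N -> (k + j <= n.*2)%N -> g i k = 0)
    (stablemx (std_flag j) g).
Proof.
apply: (iffP idP) => [sg i k ij kj|h].
  have /sub_std_flagP : (row i g <= std_flag j)%MS; last by move/(_ k kj); rewrite mxE.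
  rewrite rowE; apply: submx_trans sg; apply: submxMr; apply/sub_std_flagP=> l lj.
  rewrite mxE eqxx /=; case: eqP => // e; move: ij lj; rewrite e; clear; lia.
apply/row_subP=> r; rewrite row_mul; set y := row r _.
have /sub_std_flagP hy : (y <= std_flag j)%MS := row_sub _ _.
apply/sub_std_flagP=> k kj; rewrite mxE big1 // => i _.
have [ij|ji] := leqP (i + j) n.*2; first by rewrite hy // mul0r.
by rewrite h // mulr0.
Qed.

(** Members of rank above [n] are orthogonals of smaller ones, so stability of the lower half yields
    a full flag. *)
Lemma stable_std_upper (g : 'M[F]_N) : isometry g ->
  (forall j, (j <= n)%N -> stablemx (std_flag j) g) ->
  forall i k : 'I_N, (k < i)%N -> g i k = 0.
Proof.
move=> ig sg; have sg' j : (j <= N)%N -> stablemx (std_flag j) g.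
  move=> jN; have [jn|nj] := leqP j n; first exact: sg.
  have e : (std_flag j :=: perp (std_flag (N - j)))%MS.
    by apply/eqmx_sym; rewrite -{2}(subKn jN); apply: perp_std_flag; apply: leq_subr.
  rewrite (stablemx_eqmx _ e) stablemx_perp // sg //; move: nj; clear; lia.
move=> i k ki; have /stable_std_flagP := sg' (N - i)%N (leq_subr _ _); apply.
  by move: (ltn_ord i); move: (nat_of_ord i); clear; lia.
by move: (ltn_ord i) ki; move: (nat_of_ord i) (nat_of_ord k); clear; lia.
Qed.

Let stab := SO F n :&: flag_stab n.-1 std_flag.

Lemma parabolic_sub : parabolic_n F n \subset stab.
Proof.
(* The flag stops at rank [n-1], so only the rows below the middle block have to be triangular. *)
have upper g : g \in SO F n -> (forall i k : 'I_N, (n.+1 < i)%N -> (k < i)%N -> mx_of g i k = 0) ->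
    g \in stab.
  move=> gG h; rewrite inE gG /=; apply/flag_stabP=> j jn; apply/stable_std_flagP=> i k ij kj.
  apply: h; first by move: ij jn n0; move: (nat_of_ord i); clear; lia.
  by move: ij kj; move: (nat_of_ord i) (nat_of_ord k); clear; lia.
have ne (i k : 'I_N) : (k < i)%N -> (i == k) = false.
  by move=> ki; apply/negbTE/eqP=> e; rewrite e ltnn in ki.
have nm (i : 'I_N) : (n.+1 < i)%N -> middle i = false.
  by move=> ni; rewrite /middle [(i <= _)%N]leqNgt ni andbF.
rewrite gen_subG subUset; apply/andP; split.
  apply/subsetP=> g; rewrite inE => /andP[gG /forallP h]; apply: upper => // i k _ ki.
  by have /forallP/(_ k) := h i; rewrite ki => /eqP.
rewrite gen_subG !subUset -!andbA; apply/and3P; split; apply/subsetP=> g; rewrite inE => /andP[gG].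
- move/is_diag_mxP=> h; apply: upper => // i k _ ki; apply: h.
  by rewrite neq_ltn ki orbT.
- move/forallP=> h; apply: upper => // i k ni ki; have /forallP/(_ k) := h i.
  by rewrite nm //= ne // => /eqP.
- move/forallP=> h; apply: upper => // i k ni ki; have /forallP/(_ k) := h i.
  by rewrite nm //= ne // => /eqP.
Qed.

Definition unit_vec (i : nat) : 'rV[F]_N := delta_mx 0 (inord i).

Lemma unit_vecE i (k : 'I_N) : (i <= n.*2)%N -> unit_vec i 0 k = (k == i :> nat)%:R.
Proof. by move=> iN; rewrite mxE eqxx -(inj_eq val_inj) /= inordK. Qed.

Lemma form_unit_vec y i : (i <= n.*2)%N -> form y (unit_vec i) = y 0 (inord (n.*2 - i)).
Proof.
move=> iN; rewrite formE (bigD1 (inord i)) //= mxE !eqxx mulr1 big1 ?addr0.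
  by congr (y 0 _); apply: val_inj; rewrite /= !inordK ?subSS // ltnS leq_subr.
by move=> k ki; rewrite mxE eqxx (negPf ki) mulr0.
Qed.

Let sub_n : (n.*2 - n = n)%N. Proof. by clear; lia. Qed.
Let sub_n1 : (n.*2 - n.+1 = n.-1)%N. Proof. by clear; lia. Qed.
Let sub_p1 : (n.*2 - n.-1 = n.+1)%N. Proof. by move: n0; clear; lia. Qed.
Let le_n : (n <= n.*2)%N. Proof. by clear; lia. Qed.
Let le_n1 : (n.+1 <= n.*2)%N. Proof. by move: n0; clear; lia. Qed.
Let le_p1 : (n.-1 <= n.*2)%N. Proof. by clear; lia. Qed.

(** The root elements of the middle [SO_3] are Siegel transformations of the two singular middle
    coordinate vectors, with a multiple of the central one as parameter. *)
Lemma root_elements (t : F) :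
  (exists2 u, u \in root_subgroup_n F n &
     mx_of u = eichler (unit_vec n.+1) (t *: unit_vec n)) /\
  (exists2 u, u \in root_subgroup_opp_n F n &
     mx_of u = eichler (unit_vec n.-1) (t *: unit_vec n)).
Proof.
have e2 i m : (i <= n.*2)%N -> (m <= n.*2)%N ->
    form (unit_vec i) (unit_vec m) = (m + i == n.*2)%N%:R.
  move=> iN mN; rewrite form_unit_vec // unit_vecE // inordK ?ltnS ?leq_subr //.
  have -> // : (n.*2 - m == i)%N = (m + i == n.*2)%N.
  by apply/eqP/eqP; move: iN mN; clear; lia.
have entry i (a b : 'I_N) : (i <= n.*2)%N ->
    eichler (unit_vec i) (t *: unit_vec n) a b =
    (a == b)%:R + (a + i == n.*2)%N%:R * (t * (b == n :> nat)%:R)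
     - (t * (a == n :> nat)%:R) * (b == i :> nat)%:R
     - 2^-1 * (t * (t * 1)) * (a + i == n.*2)%N%:R * (b == i :> nat)%:R.
  move=> iN; have -> : eichler (unit_vec i) (t *: unit_vec n) a b =
      ((delta_mx 0 a : 'rV[F]_N) *m eichler (unit_vec i) (t *: unit_vec n)) 0 b by rewrite -rowE [RHS]mxE.
  have -> : delta_mx 0 a = unit_vec a :> 'rV[F]_N by rewrite /unit_vec inord_val.
  have aN : (a <= n.*2)%N by rewrite -ltnS.
  rewrite mul_eichler !formS !e2 // !mxE -/(unit_vec _ 0 _) !eqxx /=.
  have -> : (b == inord a) = (a == b) by rewrite inord_val eq_sym.
  have -> : (n + n == n.*2)%N by rewrite addnn.
  have -> : (n + a == n.*2)%N = (a == n :> nat).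
    by apply/eqP/eqP; move: (nat_of_ord a); clear; lia.
  have bi m : (m <= n.*2)%N -> (b == inord m) = (b == m :> nat).
    by move=> mN; rewrite -(inj_eq val_inj) /= inordK.
  by rewrite !bi // (addnC i).
have so i : (i <= n.*2)%N -> (i != n)%N -> exists2 u, u \in SO F n &
    mx_of u = eichler (unit_vec i) (t *: unit_vec n).
  move=> iN ni; apply: mx_of_SO; apply: eichler_SO => //.
    rewrite e2 //; case: eqP => // h; case/eqP: ni; move: h; clear; lia.
  rewrite formZr e2 // [(n + i)%N == _]negbTE ?mulr0 //.
  by apply: contra ni => /eqP h; apply/eqP; move: h; clear; lia.
split.
  have [|u uG eu] := so _ le_n1; first by move: (n); clear; lia.
  exists u => //; rewrite inE uG /=; apply/forallP=> a; apply/forallP=> b.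
  apply/orP; have [h|h] := boolP [&& middle a, middle b & (a < b)%N]; [by left|right].
  rewrite eu entry //; apply/eqP; move: h; rewrite /middle.
  have -> : (a + n.+1 == n.*2)%N = (a == n.-1 :> nat).
    by apply/eqP/eqP; move: n0; move: (nat_of_ord a); clear; lia.
  have abs : [&& n.-1 <= n <= n.+1, n.-1 <= n.+1 <= n.+1, n < n.+1, n.-1 <= n.-1 <= n.+1,
      n.-1 < n & n.-1 < n.+1]%N by move: n0; clear; lia.
  case/and5P: abs => b1 b2 b3 b4 /andP[b5 b6].
  case: (eqVneq (a : nat) n.-1) => [->|an1]; last first.
    rewrite !mul0r mulr0 mul0r subr0 addr0.
    case: (eqVneq (a : nat) n) => [->|_]; last by rewrite mulr0 mul0r subr0.
    case: (eqVneq (b : nat) n.+1) => [->|_]; last by rewrite mulr0 subr0.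
    by rewrite b1 b2 b3.
  have -> : (n.-1 == n) = false by apply/eqP; move: n0; clear; lia.
  case: (eqVneq (b : nat) n) => [->|_]; first by rewrite b1 b4 b5.
  case: (eqVneq (b : nat) n.+1) => [->|_]; first by rewrite b2 b4 b6.
  by rewrite !(mulr0, mul0r) subr0 addr0 subr0.
have [||u uG eu] := so n.-1; [by []|by apply/eqP; move: n0; clear; lia|].
exists u => //; rewrite inE uG /=; apply/forallP=> a; apply/forallP=> b.
apply/orP; have [h|h] := boolP [&& middle a, middle b & (b < a)%N]; [by left|right].
rewrite eu entry //; apply/eqP; move: h; rewrite /middle.
have -> : (a + n.-1 == n.*2)%N = (a == n.+1 :> nat).
  by apply/eqP/eqP; move: n0; move: (nat_of_ord a); clear; lia.
have abs : [&& n.-1 <= n <= n.+1, n.-1 <= n.+1 <= n.+1, n < n.+1, n.-1 <= n.-1 <= n.+1,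
    n.-1 < n & n.-1 < n.+1]%N by move: n0; clear; lia.
case/and5P: abs => b1 b2 b3 b4 /andP[b5 b6].
case: (eqVneq (a : nat) n.+1) => [->|an1]; last first.
  rewrite !mul0r mulr0 mul0r subr0 addr0.
  case: (eqVneq (a : nat) n) => [->|_]; last by rewrite mulr0 mul0r subr0.
  case: (eqVneq (b : nat) n.-1) => [->|_]; last by rewrite mulr0 subr0.
  by rewrite b1 b4 b5.
have -> : (n.+1 == n) = false by apply/eqP; clear; lia.
case: (eqVneq (b : nat) n) => [->|_]; first by rewrite b1 b2 b3.
case: (eqVneq (b : nat) n.-1) => [->|_]; first by rewrite b2 b4 b6.
by rewrite !(mulr0, mul0r) subr0 addr0 subr0.
Qed.

(** Bruhat decomposition in rank one: right multiplication by elements of the two root groups brings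
    [g] into the Borel subgroup. Only the row of index [n.+1] needs work. *)
Lemma stab_sub_parabolic : stab \subset parabolic_n F n.
Proof.
have rootP u : u \in root_subgroup_n F n -> u \in parabolic_n F n.
  by move=> h; apply/mem_gen/setUP; right; apply/mem_gen/setUP; left; apply/setUP; right.
have oppP u : u \in root_subgroup_opp_n F n -> u \in parabolic_n F n.
  by move=> h; apply/mem_gen/setUP; right; apply/mem_gen/setUP; right.
pose im : 'I_N := inord n.+1.
have imE : im = n.+1 :> nat by rewrite inordK // ltnS.
pose c g := mx_of g im im.
have zero g (k : 'I_N) : g \in stab -> (k < n.-1)%N -> mx_of g im k = 0.
  case/setIP=> gG /flag_stabP sg kn.
  have ig := SO_isometry gG.
  have := stablemx_perp ig (sg k.+1 kn).
  rewrite (stablemx_eqmx _ (perp_std_flag _)) ?ltn_ord //.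
  move/stable_std_flagP; apply; rewrite ?imE; move: kn (ltn_ord k); move: (nat_of_ord k); clear; lia.
have sing g : g \in SO F n -> form (row im (mx_of g)) (row im (mx_of g)) = 0.
  move=> gG; rewrite !rowE form_isometry ?SO_isometry //.
  have -> : delta_mx 0 im = unit_vec n.+1 :> 'rV[F]_N by [].
  rewrite form_unit_vec // unit_vecE // inordK ?ltnS ?leq_subr // sub_n1.
  by case: eqP => //; clear; lia.
(* That row is singular, and its entries to the left of the middle block vanish. *)
have singE g : g \in stab -> mx_of g im (inord n) ^+ 2 + 2%:R * (mx_of g im (inord n.-1) * c g) = 0.
  move=> gS; have gG : g \in SO F n by case/setIP: gS.
  have := sing g gG; rewrite formE.
  have ns : (inord n : 'I_N) != im.
    by rewrite -(inj_eq val_inj) /= imE inordK ?ltnS //; apply/eqP; clear; lia.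
  have ns1 : (inord n.-1 : 'I_N) != im.
    by rewrite -(inj_eq val_inj) /= imE inordK ?ltnS //; apply/eqP; clear; lia.
  have ns2 : (inord n.-1 : 'I_N) != inord n.
    by rewrite -(inj_eq val_inj) /= !inordK ?ltnS //; apply/eqP; move: n0; clear; lia.
  rewrite (bigD1 im) //= (bigD1 (inord n)) //= (bigD1 (inord n.-1)) /=; last by rewrite ns1 ns2.
  rewrite big1 ?addr0 => [|k /andP[/andP[k1 k2] k3]].
    rewrite !mxE; have -> : rev_ord im = inord n.-1.
      by apply: val_inj; rewrite /= imE inordK ?ltnS // subSS sub_n1.
    have -> : rev_ord (inord n.-1) = im :> 'I_N.
      by apply: val_inj; rewrite /= imE inordK ?ltnS // subSS sub_p1.
    have -> : rev_ord (inord n) = inord n :> 'I_N.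
      by apply: val_inj; rewrite /= inordK ?ltnS // subSS sub_n.
    by rewrite /c => <-; ring.
  rewrite !mxE; have kn (m : nat) : (m <= n.*2)%N -> k != inord m -> (k != m :> nat).
    by move=> mN; rewrite -(inj_eq val_inj) /= inordK.
  have h1 := kn _ le_n1 k1; have h2 := kn _ le_n k2; have h3 := kn _ le_p1 k3.
  have [kl|kg] := ltnP k n.-1; first by rewrite [X in _ * X]zero ?mulr0.
  rewrite zero ?mul0r // rev_ordE; move: h1 h2 h3 kg n0 (ltn_ord k); move: (nat_of_ord k).
  by clear; lia.
have stabM g u : g \in stab -> u \in parabolic_n F n -> (g * u)%g \in stab.
  have sS : group_set stab.
    by have := groupP (SO F n :&: flag_stab_group n.-1 std_flag)%G.
  move=> gS uP; rewrite (_ : stab = Group sS) // groupM //.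
  exact: (subsetP parabolic_sub).
have borel g : g \in stab -> c g != 0 -> g \in parabolic_n F n.
  (* The parameter is chosen to clear the entry in column [n]; [singE] then clears the one in column
     [n.-1]. *)
  move=> gS c0; have [_ [u uR eu]] := root_elements (- mx_of g im (inord n) / c g).
  have uP := oppP u uR; have gu := stabM g u gS uP.
  suff h : (g * u)%g \in parabolic_n F n by rewrite -(mulgK u g) groupM ?groupV.
  rewrite mem_gen // inE; apply/orP; left.
  have guG : (g * u)%g \in SO F n by case/setIP: gu.
  rewrite inE guG; apply/forallP=> i; apply/forallP=> k; apply/implyP=> ki; apply/eqP.
  apply: stable_std_upper ki; first exact: SO_isometry.
  move=> j; rewrite leq_eqVlt => /predU1P[->|jn]; last first.
    by case/setIP: gu => _ /flag_stabP; apply; rewrite -ltnS prednK.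
  have ent b : b != inord n.-1 -> mx_of (g * u)%g im b =
      mx_of g im b + c g * ((- mx_of g im (inord n) / c g) * (b == inord n)%:R).
    move=> bn; rewrite mx_ofM.
    have -> : (mx_of g *m mx_of u) im b = (row im (mx_of g) *m mx_of u) 0 b.
      by rewrite -row_mul [RHS]mxE.
    rewrite eu mul_eichler form_unit_vec // sub_p1 -/im !mxE eqxx /= (negPf bn).
    by rewrite !mulr0 !subr0.
  have cE : c (g * u)%g = c g.
    have im1 : im != inord n.-1.
      by rewrite -(inj_eq val_inj) /= imE inordK ?ltnS //; apply/eqP; clear; lia.
    have im2 : im != inord n.
      by rewrite -(inj_eq val_inj) /= imE inordK ?ltnS //; apply/eqP; clear; lia.
    by rewrite /c ent // (negPf im2) !mulr0 addr0.
  have bE : mx_of (g * u)%g im (inord n) = 0.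
    rewrite ent ?eqxx; last first.
      by rewrite -(inj_eq val_inj) /= !inordK ?ltnS //; apply/eqP; move: n0; clear; lia.
    by rewrite /=; field.
  have aE : mx_of (g * u)%g im (inord n.-1) = 0.
    have /eqP := singE _ gu; rewrite bE cE expr0n add0r !mulf_eq0 (negPf F2) (negPf c0) orbF /=.
    by move/eqP.
  apply/stable_std_flagP=> a b an bn.
  have [a1|a1] := leqP a n.+1; last first.
    have sn : stablemx (std_flag (N - a)) (mx_of (g * u)%g).
      case/setIP: gu => _ /flag_stabP; apply; move: a1; move: (nat_of_ord a); clear; lia.
    move/stable_std_flagP: sn; apply; move: a1 bn an (ltn_ord a).
      by move: (nat_of_ord a); clear; lia.
    by move: (nat_of_ord a) (nat_of_ord b); clear; lia.
  have -> : a = im.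
    by apply: val_inj; rewrite /= imE; apply/eqP; move: a1 an; move: (nat_of_ord a); clear; lia.
  have [b1|b1] := ltnP b n.-1; first exact: zero.
  have [b2|b2] := eqVneq (b : nat) n.
    by rewrite -bE; congr (mx_of _ im _); apply: val_inj; rewrite /= inordK ?b2 // ltnS.
  rewrite -aE; congr (mx_of _ im _); apply: val_inj; rewrite /= inordK ?ltnS //.
  by move: bn b1 b2; move: (nat_of_ord b); clear; lia.
apply/subsetP=> g gS; have [c0|] := eqVneq (c g) 0; last exact: borel.
have b0 : mx_of g im (inord n) = 0.
  by have /eqP := singE g gS; rewrite c0 !mulr0 addr0 sqrf_eq0 => /eqP.
have a0 : mx_of g im (inord n.-1) != 0.
  apply/negP=> /eqP a0; case/setIP: (gS) => gG /flag_stabP sg.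
  have s : (row im (mx_of g) <= std_flag n.-1)%MS.
    apply/sub_std_flagP=> k kn; rewrite mxE.
    have [b1|b1] := ltnP k n.-1; first exact: zero.
    have [b2|b2] := eqVneq (k : nat) n.
      by rewrite -b0; congr (mx_of _ im _); apply: val_inj; rewrite /= inordK ?b2 // ltnS.
    have [b3|b3] := eqVneq (k : nat) n.-1.
      by rewrite -a0; congr (mx_of _ im _); apply: val_inj; rewrite /= inordK ?b3 // ltnS.
    rewrite -c0 /c; congr (mx_of _ im _); apply: val_inj; rewrite /= imE.
    by move: kn b1 b2 b3 n0; move: (nat_of_ord k); clear; lia.
  have := stablemx_inv (mx_of_unit g) (sg _ (leqnn _)); move/(submx_trans (submxMr _ s)).
  rewrite rowE mulmxK ?mx_of_unit // => /sub_std_flagP/(_ im) h.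
  have h1 : (im + n.-1 <= n.*2)%N by rewrite imE; move: n0; clear; lia.
  by have /eqP := h h1; rewrite mxE !eqxx oner_eq0.
(* Here [c g = 0], and the entry [a] in column [n.-1] is nonzero; after the root element with
   parameter [1] the corner entry becomes [-a / 2]. *)
have [[u uR eu] _] := root_elements 1; have uP := rootP u uR.
suff h : (g * u)%g \in parabolic_n F n by rewrite -(mulgK u g) groupM ?groupV.
apply: borel; first exact: stabM.
rewrite /c; have -> : mx_of (g * u)%g im im = (row im (mx_of g) *m mx_of u) 0 im.
  by rewrite -row_mul [RHS]mxE.
rewrite eu mul_eichler !formS !form_unit_vec // sub_n sub_n1 unit_vecE // inordK ?ltnS // eqxx.
rewrite !mxE b0 -/(c g) c0 !eqxx /=.
have -> : (im == inord n) = false.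
  by apply/negbTE; rewrite -(inj_eq val_inj) /= imE inordK ?ltnS //; apply/eqP; clear; lia.
rewrite !(mulr0, mul0r, mul1r, mulr1, addr0, add0r, subr0, oppr0) oppr_eq0 mulf_neq0 //.
by rewrite invr_eq0.
Qed.

Lemma parabolic_nE : parabolic_n F n = SO F n :&: flag_stab n.-1 std_flag.
Proof. by apply/eqP; rewrite eqEsubset parabolic_sub stab_sub_parabolic. Qed.

Lemma flag_stab_conj_parabolic (W : nat -> 'M[F]_N) : flag n.-1 W ->
  exists2 g, g \in SO F n & SO F n :&: flag_stab n.-1 W = (parabolic_n F n :^ g)%g.
Proof.
move=> fW; have ln : (n.-1 <= n)%N := leq_pred n.
have hE u : u != 0 -> form u u = 0 -> has_eichler (SO F n) u.
  move=> _ uu w uw; exact: mx_of_SO (eichler_SO F2 uu uw).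
have [h hG hW] := flag_move F2 (subxx _) ln hE (std_flagP ln) fW.
exists h => //; rewrite parabolic_nE; apply/setP=> g; rewrite mem_conjg !inE.
rewrite -!mem_SO groupJr ?groupV //; congr (_ && _).
have e j : (j <= n.-1)%N -> stablemx (W j) (mx_of g) = stablemx (std_flag j) (mx_of (g ^ h^-1)%g).
  move=> jn; rewrite -(stablemx_eqmx _ (hW j jn)) conjgE invgK !mx_ofM mx_ofV.
  apply/idP/idP=> s.
    rewrite !mulmxA; apply: submx_trans (submxMr _ s) _.
    by rewrite mulmxK ?mx_of_unit.
  have := submxMr (mx_of h) s; rewrite -!mulmxA mulVmx ?mx_of_unit // mulmx1.
  by rewrite mulmxA.
by apply/stable_flagP/stable_flagP=> s j jn; [rewrite -e // s | rewrite e // s].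
Qed.

End Parabolic.

(** * Jordan form *)

Section JordanForm.
Variables (R : fieldType).

(** Entries described by natural number indices, which avoids the dependent index types of block
    diagonal matrices. *)
Definition entries m n (M : 'M[R]_(m, n)) (f : nat -> nat -> R) : Prop :=
  forall i j, M i j = f i j.

Lemma entries_block m1 m2 (B : 'M[R]_m1) (C : 'M[R]_m2) f g :
  entries B f -> entries C g ->
  entries (block_mx B 0 0 C) (fun i j => if (i < m1)%N then (if (j < m1)%N then f i j else 0)
    else if (j < m1)%N then 0 else g (i - m1)%N (j - m1)%N).
Proof.
move=> Bf Cg i j; rewrite /block_mx mxE; case: splitP => a ea; rewrite mxE; case: splitP => b eb.
- by rewrite /= ea eb Bf.
- by rewrite mxE.
- by rewrite mxE.
- by rewrite /= ea eb !addKn Cg.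
Qed.

Lemma entries_mxdiag m (p_ : 'I_m.+1 -> nat) (B_ : forall i, 'M[R]_(p_ i)) f g :
  entries (B_ ord0) f -> entries (\mxdiag_i B_ (lift ord0 i)) g ->
  entries (\mxdiag_i B_ i) (fun i j => if (i < p_ ord0)%N then (if (j < p_ ord0)%N then f i j else 0)
    else if (j < p_ ord0)%N then 0 else g (i - p_ ord0)%N (j - p_ ord0)%N).
Proof.
by move=> Bf Cg i j; rewrite mxdiag_recl castmxE (entries_block Bf Cg) /=.
Qed.

Lemma jordan_blockE k : entries (unipotent_jordan_block R k)
  (fun i j => ((i == j) || (i.+1 == j))%:R).
Proof. by move=> i j; rewrite mxE. Qed.

Lemma jordan_diagE k (s := [:: k; 1%N; 1%N])
    (i j : 'I_(\sum_(l < size s) nth 0%N s l)) :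
  (\mxdiag_(l < size s) unipotent_jordan_block R (nth 0%N s l)) i j =
  ((i == j :> nat) || (i.+1 == j :> nat) && (j < k)%N)%:R.
Proof.
have ek : (\sum_(l < size s) nth 0%N s l = k.+2)%N.
  by rewrite /= !big_ord_recl big_ord0 /= addn0 !addn1 addn2.
rewrite (entries_mxdiag (@jordan_blockE _) (entries_mxdiag (@jordan_blockE _)
  (entries_mxdiag (@jordan_blockE _) (g := fun _ _ => 0) _))) /=; last first.
  by move=> [a ha]; exfalso; move: ha; rewrite big_ord0.
have : (i < k.+2)%N by rewrite -ek.
have : (j < k.+2)%N by rewrite -ek.
move: (nat_of_ord i) (nat_of_ord j) => {i j} a b bk ak.
case: (ltnP a k) => ha; case: (ltnP b k) => hb; rewrite ?andbT ?andbF ?orbF //.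
- have -> // : (a == b) = false by apply/eqP; move: ha hb; clear; lia.
- have -> // : (a == b) = false by apply/eqP; move: ha hb; clear; lia.
  have -> // : (a.+1 == b) = false by apply/eqP; move: ha hb; clear; lia.
have -> : (a == b) = ((a - k)%N == (b - k)%N) by apply/eqP/eqP; move: ha hb; clear; lia.
have : (a - k < 2)%N by move: ak; clear; lia.
have : (b - k < 2)%N by move: bk; clear; lia.
by move: (a - k)%N (b - k)%N => [|[|//]] [|[|//]].
Qed.

Variable n : nat.
Local Notation N := n.*2.+1.
Implicit Type A : 'M[R]_N.

Definition shift3 : 'M[R]_N := \matrix_(i, j) ((i.+1 == j :> nat) && (j < (n.*2).-1)%N)%:R.

Lemma jordan_form3E A :
  unipotent_jordan_form A [:: (n.*2).-1; 1%N; 1%N] <->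
  (0 < n)%N /\ exists2 P : 'M[R]_N, P \in unitmx & P *m (A - 1%:M) *m invmx P = shift3.
Proof.
have D1 : (\matrix_(i, j) ((i == j :> nat) || (i.+1 == j :> nat) && (j < (n.*2).-1)%N)%:R
    : 'M[R]_N) = 1%:M + shift3.
  apply/matrixP=> i j; rewrite !mxE -val_eqE /=; case: eqP => [->|_] /=; last by rewrite add0r.
  by have -> : (j.+1 == j :> nat) = false; [apply/eqP; clear; lia | rewrite addr0].
have conj P : P \in unitmx -> P *m (A - 1%:M) *m invmx P = P *m A *m invmx P - 1%:M.
  by move=> PU; rewrite mulmxBr mulmxBl mulmx1 mulmxV.
split=> [[e [P [PU eP]]]|[n0 [P PU eP]]].
  split; first by case: (n) (e) => //; rewrite /= !big_ord_recl big_ord0.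
  exists P => //; rewrite conj // eP.
  apply: (addrI 1%:M); rewrite addrC subrK -D1.
  by apply/matrixP=> i j; rewrite castmxE jordan_diagE mxE.
have e : (\sum_(i < size [:: (n.*2).-1; 1; 1]) nth 0 [:: (n.*2).-1; 1; 1] i)%N = N.
  by rewrite /= !big_ord_recl big_ord0 /=; move: n0; clear; lia.
exists e, P; split=> //; have := eP; rewrite conj // => /(canRL (subrK _)) ->.
rewrite addrC -D1; apply/matrixP=> i j; rewrite castmxE.
by rewrite (@jordan_diagE (n.*2).-1) mxE.
Qed.

Lemma shift3_pow m : (0 < m)%N -> shift3 ^+ m =
  \matrix_(i, j) (((i + m)%N == j :> nat) && (j < (n.*2).-1)%N)%:R.
Proof.
case: m => // m _; elim: m => [|m IH].
  by rewrite expr1; apply/matrixP=> i j; rewrite !mxE addn1.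
rewrite exprSr IH; apply/matrixP=> i j; rewrite !mxE; under eq_bigr do rewrite !mxE.
have [ij|ij] := boolP (((i + m.+2)%N == j :> nat) && (j < (n.*2).-1)%N); last first.
  rewrite big1 // => k _; case: eqP => [ek|_]; last by rewrite mul0r.
  have [ekj|_] := eqVneq k.+1 (j : nat); last by rewrite mulr0.
  have jE : (i + m.+2)%N = j by rewrite addnS ek ekj.
  by move: ij; rewrite jE eqxx /= => /negbTE->; rewrite mulr0.
case/andP: ij => /eqP ij jn.
have hk : (i + m.+1 < N)%N by move: ij (ltn_ord j); move: (nat_of_ord i) (nat_of_ord j); clear; lia.
rewrite (bigD1 (Ordinal hk)) //= big1 ?addr0 => [|k kh].
  rewrite eqxx jn -addnS ij eqxx andbT /=.
  by rewrite (ltnW jn) mulr1.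
by case: eqP => [e|_]; [case/eqP: kh; apply: val_inj | rewrite mul0r].
Qed.

End JordanForm.

Lemma jordan_form_type3 (F : finFieldType) (n : nat) (x : {'GL_(n.*2.+1)[F]}) :
  (1 < n)%N -> unipotent_jordan_form (mx_of x) [:: (n.*2).-1; 1%N; 1%N] -> type3 x.
Proof.
move=> n1 /jordan_form3E[_ [P PU eP]]; set X := mx_of x - 1%:M in eP *.
have XE m : X ^+ m = invmx P *m shift3 F n ^+ m *m P.
  elim: m => [|m IH]; first by rewrite !expr0 mulmx1 mulVmx.
  by rewrite !exprSr IH -eP -!mulmxE !mulmxA !mulmxKV.
have n0 := ltnW n1.
have nz : X ^+ (n.*2).-2 != 0.
  apply/eqP=> e; have := XE (n.*2).-2; rewrite e.
  move/(congr1 (fun M => P *m M *m invmx P)); rewrite mulmx0 mul0mx -!mulmxA mulmxV // mulmx1 mulKVmx //.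
  move/matrixP/(_ ord0 (inord (n.*2).-2))/eqP; rewrite shift3_pow; last by move: n1; clear; lia.
  rewrite !mxE inordK; last by clear; lia.
  have hlt : ((n.*2).-2 < (n.*2).-1)%N by move: n1; clear; lia.
  by rewrite add0n eqxx hlt /= eq_sym oner_eq0.
have z : X ^+ (n.*2).-1 = 0.
  rewrite XE (_ : shift3 F n ^+ _ = 0) ?mulmx0 ?mul0mx // shift3_pow; last by move: n1; clear; lia.
  apply/matrixP=> i j; rewrite !mxE; case: eqP => //= ej.
  have -> // : (j < (n.*2).-1)%N = false.
  by apply/negbTE; move: ej; move: (nat_of_ord i) (nat_of_ord j); clear; lia.
rewrite /type3 -/X; split=> //; apply/eqP; rewrite eqn_leq; apply/andP; split.
  have := XE 1%N; rewrite !expr1 => ->.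
  apply: leq_trans (mxrankM_maxl _ _) _; apply: leq_trans (mxrankM_maxr _ _) _.
  (* Factoring through a space of dimension [2n-2] bounds the rank from above. *)
  have -> : shift3 F n = (\matrix_(i < n.*2.+1, k < (n.*2).-2) (i == k :> nat)%:R) *m
      (\matrix_(k < (n.*2).-2, j < n.*2.+1) (k.+1 == j :> nat)%:R).
    apply/matrixP=> i j; rewrite !mxE; under eq_bigr do rewrite !mxE.
    have [hi|hi] := ltnP i (n.*2).-2.
      rewrite (bigD1 (Ordinal hi)) //= eqxx mul1r big1 ?addr0 => [|k ki].
        case: eqP => //= <-; rewrite (_ : (i.+1 < _)%N) //.
        by move: hi; move: (nat_of_ord i); clear; lia.
      by case: eqP => [e|_]; [case/eqP: ki; apply: val_inj | rewrite mul0r].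
    rewrite big1 => [|k _]; last first.
      by case: eqP => [e|_]; [move: hi; rewrite e leqNgt ltn_ord | rewrite mul0r].
    case: eqP => //= ej; rewrite (_ : (j < _)%N = false) //; apply/negbTE.
    by move: hi ej; move: (nat_of_ord i) (nat_of_ord j); clear; lia.
  exact: mulmx_max_rank.
have h j : (j <= (n.*2).-2)%N -> (j < \rank (X ^+ ((n.*2).-2 - j)))%N.
  elim: j => [|j IH] jn; first by rewrite subn0 lt0n mxrank_eq0.
  have nz' : X ^+ ((n.*2).-2 - j.+1) != 0.
    by apply: contraNneq nz => e; rewrite -(subnK jn) exprD e mul0r.
  apply: leq_ltn_trans (IH (ltnW jn)) _; rewrite -subnSK // exprSr -mulmxE.
  apply: (rank_nilp_lt z) nz'.
  by rewrite mulmxE -exprSr exprS -mulmxE submxMl.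
have := h (n.*2).-2.-1; rewrite (_ : ((n.*2).-2 - (n.*2).-2.-1)%N = 1%N) ?expr1; last first.
  by move: n1; clear; lia.
by move/(_ (leq_pred _)); move: (\rank X) => rk; move: n1; clear; lia.
Qed.

(** The Jordan basis is the chain [u], [u X], up to [d = u X^(2n-2)], together with [v1] and [v2],
    which complete [d] to a basis of the kernel of [X]. *)
Lemma type3_jordan_form (F : finFieldType) (n : nat) (x : {'GL_(n.*2.+1)[F]}) :
  (1 < n)%N -> type3 x -> unipotent_jordan_form (mx_of x) [:: (n.*2).-1; 1%N; 1%N].
Proof.
move=> n1 [nz z rX]; set X := mx_of x - 1%:M in nz z rX *.
apply/jordan_form3E; split; first exact: ltnW.
have [u hu] : exists u : 'rV_(n.*2.+1), u *m X ^+ (n.*2).-2 != 0.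
  have : (0 < \rank (X ^+ (n.*2).-2))%N by rewrite lt0n mxrank_eq0.
  by case/nonzero_row=> y /submxP[u ->] h; exists u.
pose d := u *m X ^+ (n.*2).-2.
have rK : \rank (kermx X) = 3%N by rewrite mxrank_ker rX; move: n1; clear; lia.
have rd : \rank d = 1%N by rewrite rank_rV hu.
have [v1 v1K v1d] : exists2 v : 'rV_(n.*2.+1), (v <= kermx X)%MS & ~~ (v <= d)%MS.
  by apply/sub_rowPn/negP=> /mxrankS; rewrite rK rd.
have [v2 v2K v2d] : exists2 v : 'rV_(n.*2.+1), (v <= kermx X)%MS & ~~ (v <= d + v1)%MS.
  by apply/sub_rowPn/negP=> /mxrankS; rewrite rK rank_add_row // rd.
pose row_of (i : nat) := if (i < (n.*2).-1)%N then u *m X ^+ i else if i == (n.*2).-1 then v1 else v2.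
pose P : 'M[F]_(n.*2.+1) := \matrix_i row_of i.
have v1X : v1 *m X = 0 by apply/sub_kermxP.
have v2X : v2 *m X = 0 by apply/sub_kermxP.
have PX : P *m X = shift3 F n *m P.
  apply/row_matrixP=> i; rewrite !row_mul rowK.
  have -> : row i (shift3 F n) *m P = if (i.+1 < (n.*2).-1)%N then u *m X ^+ i.+1 else 0.
    rewrite mulmx_sum_row; case: ifP => hi.
      have iN : (i.+1 < n.*2.+1)%N by move: hi; move: (nat_of_ord i); clear; lia.
      rewrite (bigD1 (Ordinal iN)) //= !mxE /= eqxx hi scale1r rowK /row_of /= hi.
      rewrite big1 ?addr0 // => k ki; rewrite !mxE; case: eqP => [e|_]; last by rewrite scale0r.
      by case/eqP: ki; apply: val_inj.
    rewrite big1 // => k _; rewrite !mxE; case: eqP => [e|_]; last by rewrite scale0r.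
    by rewrite -e hi scale0r.
  rewrite /row_of; case: ifP => hi.
    rewrite -mulmxA mulmxE -exprSr; case: ifP => hi' //.
    have -> : i.+1 = (n.*2).-1 by move: hi hi'; move: (nat_of_ord i); clear; lia.
    by rewrite z mulmx0.
  have -> : (i.+1 < (n.*2).-1)%N = false by move: hi; move: (nat_of_ord i); clear; lia.
  by case: ifP.
have PU : P \in unitmx.
  rewrite -row_free_unit -kermx_eq0; apply/rowV0P=> y /sub_kermxP.
  have last1 : ((n.*2).-1 < n.*2.+1)%N by clear; lia.
  have last2 : (n.*2 < n.*2.+1)%N by [].
  pose i1 := Ordinal last1; pose i2 := Ordinal last2.
  have n21 : (n.*2 == (n.*2).-1) = false by apply/eqP; move: n1; clear; lia.
  have i12 : i2 != i1 by rewrite -val_eqE /= n21.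
  have yP : y *m P = (\sum_(i < n.*2.+1 | (i < (n.*2).-1)%N) y 0 i *: (u *m X ^+ i))
      + y 0 i1 *: v1 + y 0 i2 *: v2.
    rewrite mulmx_sum_row (bigID (fun i : 'I_(n.*2.+1) => (i < (n.*2).-1)%N)) /= -addrA.
    congr (_ + _); first by under eq_bigr => i hi do rewrite rowK /row_of hi.
    rewrite (bigD1 i1) /= ?ltnn // (bigD1 i2) /=; last first.
      by rewrite i12 andbT -leqNgt leq_pred.
    rewrite big1 => [|i /andP[/andP[h1 h2] h3]]; last first.
      exfalso; move: h1 h2 h3; rewrite -!val_eqE /=; move: (ltn_ord i); move: (nat_of_ord i).
      by clear; lia.
    rewrite addr0 !rowK /row_of /= ltnn eqxx n21.
    by have -> : (n.*2 < (n.*2).-1)%N = false by apply/negbTE; clear; lia.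
  rewrite yP => y0.
  have lift_sum m : (0 < m)%N ->
      \sum_(i < n.*2.+1 | (i < (n.*2).-1)%N) y 0 i *: (u *m X ^+ (i + m)) = 0.
    case: m => // m _; have vX (v : 'rV_(n.*2.+1)) : v *m X = 0 -> v *m X ^+ m.+1 = 0.
      by move=> vX; rewrite exprS -mulmxE mulmxA vX mul0mx.
    have := congr1 (mulmx^~ (X ^+ m.+1)) y0.
    rewrite /= mul0mx !mulmxDl -!scalemxAl (vX v1) // (vX v2) // !scaler0 !addr0 mulmx_suml => e.
    rewrite -[RHS]e; apply: eq_bigr => i _.
    by rewrite -scalemxAl -mulmxA mulmxE -exprD.
  (* Once the earlier coefficients vanish, multiplying the relation by [X^(2n-2-i)] leaves only the
     [i]-th coefficient times [d]. *)
  have low : forall k, forall i : 'I_(n.*2.+1), (i < k)%N -> (i < (n.*2).-2)%N -> y 0 i = 0.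
    elim=> // k IH i; rewrite ltnS leq_eqVlt => /predU1P[ik|ik] hi; last exact: IH.
    have := lift_sum ((n.*2).-2 - i)%N; rewrite subn_gt0 hi => /(_ isT).
    have hi' : (i < (n.*2).-1)%N by move: hi; move: (nat_of_ord i); clear; lia.
    rewrite (bigD1 i) //= subnKC ?(ltnW hi) // big1 ?addr0.
      by move/eqP; rewrite scaler_eq0 (negPf hu) orbF => /eqP.
    move=> j /andP[jn ji]; have [jk|kj] := ltnP j k.
      by rewrite IH ?scale0r //; move: ik jk hi; move: (nat_of_ord i) (nat_of_ord j); clear; lia.
    have h : ((n.*2).-1 <= j + ((n.*2).-2 - i))%N.
      move: ji; rewrite -val_eqE /=; move: kj ik hi.
      by move: (nat_of_ord i) (nat_of_ord j); clear; lia.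
    by rewrite -(subnKC h) exprD z mul0r mulmx0 scaler0.
  have last0 : ((n.*2).-2 < n.*2.+1)%N by clear; lia.
  pose i0 := Ordinal last0.
  have sumE : \sum_(i < n.*2.+1 | (i < (n.*2).-1)%N) y 0 i *: (u *m X ^+ i) = y 0 i0 *: d.
    rewrite (bigD1 i0) /=; last by move: n1; clear; lia.
    rewrite big1 ?addr0 // => j /andP[jn ji]; rewrite (low (n.*2)) ?scale0r //.
      by move: jn; move: (nat_of_ord j); clear; lia.
    by move: ji jn; rewrite -val_eqE /=; move: (nat_of_ord j); clear; lia.
  rewrite sumE in y0.
  have y2 : y 0 i2 = 0.
    apply/eqP; apply: contraNT v2d => c; rewrite -(eqmx_scale v2 c).
    have -> : y 0 i2 *: v2 = - (y 0 i0 *: d + y 0 i1 *: v1) by apply/eqP; rewrite -addr_eq0 addrC y0.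
    rewrite -scaleN1r scalemx_sub // addmx_sub_adds // scalemx_sub //.
  have y1 : y 0 i1 = 0.
    apply/eqP; apply: contraNT v1d => c; rewrite -(eqmx_scale v1 c).
    have -> : y 0 i1 *: v1 = - (y 0 i0 *: d).
      by apply/eqP; rewrite -addr_eq0 addrC; move: y0; rewrite y2 scale0r addr0 => ->.
    by rewrite -scaleN1r !scalemx_sub.
  have y00 : y 0 i0 = 0.
    move/eqP: y0; rewrite y1 y2 !scale0r !addr0 scaler_eq0 (negPf hu) orbF.
    by move/eqP.
  apply/rowP=> i; rewrite [RHS]mxE.
  have [hi|hi] := ltnP i (n.*2).-2; first by apply: (low (n.*2)) => //;
    move: hi; move: (nat_of_ord i); clear; lia.
  have : [\/ i = i0, i = i1 | i = i2].
    have : [|| i == (n.*2).-2 :> nat, i == (n.*2).-1 :> nat | i == n.*2 :> nat].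
      by move: hi (ltn_ord i); move: (nat_of_ord i); clear; lia.
    case/or3P=> /eqP e; [constructor 1|constructor 2|constructor 3]; exact: val_inj.
  by case=> ->.
exists P => //; by rewrite PX mulmxK.
Qed.

(** * Cayley transforms *)

Section Krylov.
Variables (R : fieldType) (N : nat).
Implicit Types (Y H : 'M[R]_N) (u : 'rV[R]_N).

Definition krylov m u Y : 'M[R]_(m, N) := \matrix_(i < m) (u *m Y ^+ i).

Lemma mul_krylov m u Y (c : 'rV[R]_m) :
  c *m krylov m u Y = \sum_(i < m) c 0 i *: (u *m Y ^+ i).
Proof. by rewrite mulmx_sum_row; apply: eq_bigr => i _; rewrite rowK. Qed.

Variables (m : nat) (u : 'rV[R]_N) (Y : 'M[R]_N).
Hypotheses (Ym : Y ^+ m.+1 = 0) (uY : u *m Y ^+ m != 0).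

Lemma krylov_inj (p : nat -> R) k : (k <= m.+1)%N ->
  \sum_(i < k) p i *: (u *m Y ^+ i) = 0 -> forall i, (i < k)%N -> p i = 0.
Proof.
move=> km s0 i; elim: (i.+1) {-2}i (leqnn i.+1) => // j IH {}i ij ik.
have low l : (l < i)%N -> p l = 0.
  by move=> li; apply: IH; [exact: leq_trans li ij | exact: ltn_trans li ik].
have := congr1 (mulmx^~ (Y ^+ (m - i))) s0.
have im : (i <= m)%N by rewrite -ltnS (leq_trans ik).
rewrite mul0mx mulmx_suml (bigD1 (Ordinal ik)) //= big1 ?addr0 => [|l li].
  rewrite -scalemxAl -mulmxA mulmxE -exprD subnKC // => /eqP.
  by rewrite scaler_eq0 (negPf uY) orbF => /eqP.
have [lti|ltl] := ltnP l i; first by rewrite low // scale0r mul0mx.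
rewrite -scalemxAl -mulmxA mulmxE -exprD.
have h : (m.+1 <= l + (m - i))%N.
  have : i != l by apply: contraNneq li => e; apply/eqP/val_inj.
  by move: ltl im; move: (nat_of_ord l); clear; lia.
by rewrite -(subnKC h) exprD Ym mul0r mulmx0 scaler0.
Qed.

(** A vector of the cyclic space killed by [Y] is a multiple of [u Y^m], which is not in [Z]; so the
    two spaces meet trivially, and their dimensions add up to [N]. *)
Lemma krylov_full k (Z : 'M[R]_(k, N)) :
  Z *m Y = 0 -> ~~ (u *m Y ^+ m <= Z)%MS -> (m.+1 + \rank Z = N)%N ->
  forall y : 'rV[R]_N, exists (p : nat -> R) (z : 'rV[R]_N),
    (z <= Z)%MS /\ y = \sum_(i < m.+1) p i *: (u *m Y ^+ i) + z.
Proof.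
move=> ZY uZ rZ y.
pose toN (c : 'rV[R]_m.+1) (i : nat) : R := c 0 (inord i).
have toNE c : c *m krylov m.+1 u Y = \sum_(i < m.+1) toN c i *: (u *m Y ^+ i).
  by rewrite mul_krylov; apply: eq_bigr => i _; rewrite /toN inord_val.
have fr : row_free (krylov m.+1 u Y).
  rewrite -kermx_eq0; apply/rowV0P=> c /sub_kermxP; rewrite toNE => s0.
  by apply/rowP=> i; rewrite [RHS]mxE -(krylov_inj (leqnn _) s0 (ltn_ord i)) /toN inord_val.
have cap0 : (krylov m.+1 u Y :&: Z)%MS = 0.
  apply/eqP/rowV0P=> v; rewrite sub_capmx => /andP[/submxP[c vE] vZ].
  have vY : v *m Y = 0 by case/submxP: vZ => D ->; rewrite -mulmxA ZY mulmx0.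
  pose q i := if i is j.+1 then toN c j else 0.
  have s0 : \sum_(i < m.+1) q i *: (u *m Y ^+ i) = 0.
    rewrite -[RHS]vY vE toNE mulmx_suml big_ord_recl [in RHS]big_ord_recr /= scale0r add0r.
    rewrite -scalemxAl -mulmxA mulmxE -exprSr Ym mulmx0 scaler0 addr0.
    by apply: eq_bigr => i _; rewrite -scalemxAl -mulmxA mulmxE -exprSr.
  have c0 i : (i < m)%N -> toN c i = 0.
    by move=> im; apply: (krylov_inj (leqnn _) s0 (i := i.+1)).
  move: vZ; rewrite vE toNE big_ord_recr /= big1 ?add0r => [|i _]; last by rewrite c0 ?scale0r.
  have [->|cm] := eqVneq (toN c m) 0; first by rewrite scale0r.
  by rewrite (eqmx_scale _ cm) (negPf uZ).
have : (y <= krylov m.+1 u Y + Z)%MS.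
  apply: submx_full; rewrite -col_leq_rank -{1}rZ.
  have := mxrank_sum_cap (krylov m.+1 u Y) Z; rewrite cap0 mxrank0 addn0 => ->.
  by rewrite (eqP fr).
case/sub_addsmxP=> -[c d] /= ->; exists (toN c), (d *m Z); split; first exact: submxMl.
by rewrite toNE.
Qed.

End Krylov.

Section Cayley.
Variables (R : fieldType) (N : nat).
Hypothesis R2 : 2%:R != 0 :> R.
Implicit Types (A H Y M : 'M[R]_N) (u v y z : 'rV[R]_N).
Local Notation J := (antidiag R N).

Definition skew H : Prop := forall y z, form (y *m H) z = - form y (z *m H).

Lemma skew_mx H : skew H -> H *m J = - (J *m H^T).
Proof.
move=> sH; apply/matrixP=> i j.
have e (B : 'M[R]_N) : ((delta_mx 0 i : 'rV[R]_N) *m B *m (delta_mx 0 j : 'rV[R]_N)^T) 0 0 = B i j.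
  by rewrite trmx_delta -rowE -colE !mxE.
have := sH (delta_mx 0 i) (delta_mx 0 j); rewrite /form.
set di := delta_mx 0 i; set dj := delta_mx 0 j.
have -> : di *m H *m J *m dj^T = di *m (H *m J) *m dj^T by rewrite !mulmxA.
have -> : di *m J *m (dj *m H)^T = di *m (J *m H^T) *m dj^T by rewrite trmx_mul !mulmxA.
by rewrite !e => ->; rewrite [RHS]mxE.
Qed.

Lemma unitmx_add_nilp (a : R) H k : a != 0 -> H ^+ k = 0 -> a%:M + H \in unitmx.
Proof.
move=> a0 Hk; rewrite -row_free_unit -kermx_eq0; apply/rowV0P=> y /sub_kermxP.
rewrite mulmxDr mul_mx_scalar => /eqP; rewrite addr_eq0 => /eqP yH.
have h j : y *m H ^+ j = (- a) ^+ j *: y.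
  elim: j => [|j IH]; first by rewrite !expr0 mulmx1 scale1r.
  rewrite exprSr -mulmxE mulmxA IH -scalemxAl -[y *m H]opprK -yH exprSr -scalerA.
  by rewrite scaleNr.
have := h k; rewrite Hk mulmx0 => /esym/eqP; rewrite scaler_eq0 expf_eq0 oppr_eq0 (negPf a0) andbF.
by move/eqP.
Qed.

Definition cay H : 'M[R]_N := (1%:M + H) *m invmx (1%:M - H).

Lemma cay_isometry H : skew H -> 1%:M - H \in unitmx -> isometry (cay H).
Proof.
move=> sH U; apply: isometryP => y z.
have cm : (1%:M - H) *m (1%:M + H) = (1%:M + H) *m (1%:M - H).
  rewrite mulmxDr mulmx1 [RHS]mulmxDl mul1mx; congr (_ + _).
  by rewrite mulmxBl mulmxBr mul1mx mulmx1.
have e v : v *m invmx (1%:M - H) *m (1%:M + H) = v *m cay H.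
  rewrite /cay -mulmxA; congr (_ *m _).
  by apply: (can_inj (mulKmx U)); rewrite mulKVmx // mulmxA cm mulmxK.
rewrite -!e -[in RHS](mulmxKV U y) -[in RHS](mulmxKV U z).
move: (y *m invmx _) (z *m invmx _) => {}y {}z.
by rewrite !(mulmxDr, mulmxN, mulmx1) !formS !sH; ring.
Qed.

(** Skewness reads [(1 + H) J = J (1 - H)^T], so [1 + H] and [1 - H] have equal determinants. *)
Lemma cay_det H : skew H -> 1%:M - H \in unitmx -> \det (cay H) = 1.
Proof.
move=> sH U; have h : (1%:M + H) *m J = J *m (1%:M - H)^T.
  by rewrite mulmxDl mul1mx skew_mx // linearB /= trmx1 mulmxBr mulmx1.
have := congr1 determinant h; rewrite !det_mulmx det_tr mulrC.
have dJ : \det J != 0 by rewrite -unitfE -unitmxE antidiag_unit.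
move/(mulfI dJ) => e; rewrite e det_inv divff //.
by rewrite -unitfE -unitmxE.
Qed.

Lemma icay M : M + 1%:M \in unitmx ->
  let H := (M - 1%:M) *m invmx (M + 1%:M) in
  1%:M - H \in unitmx /\ cay H = M.
Proof.
move=> U H; have hm : (1%:M - H) *m (M + 1%:M) = 2%:R *: 1%:M.
  by rewrite mulmxBl mul1mx mulmxKV // opprB addrC addrA subrK scaler_nat mulr2n.
have hp : (1%:M + H) *m (M + 1%:M) = 2%:R *: M.
  by rewrite mulmxDl mul1mx mulmxKV // addrA (addrAC M) addrK scaler_nat mulr2n.
have hi : (1%:M - H) *m (2%:R^-1 *: (M + 1%:M)) = 1%:M.
  by rewrite -scalemxAr hm scalerA mulVf // scale1r.
have HU : 1%:M - H \in unitmx by have [] := mulmx1_unit hi.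
split=> //; have iE : invmx (1%:M - H) = 2%:R^-1 *: (M + 1%:M).
  by apply: (can_inj (mulKmx HU)); rewrite mulmxV // hi.
by rewrite /cay iE -scalemxAr hp scalerA mulVf // scale1r.
Qed.

Lemma icay_skew M : isometry M -> M + 1%:M \in unitmx ->
  skew ((M - 1%:M) *m invmx (M + 1%:M)).
Proof.
move=> iM U y z; have cm : (M + 1%:M) *m (M - 1%:M) = (M - 1%:M) *m (M + 1%:M).
  rewrite mulmxBr mulmx1 [RHS]mulmxBl mul1mx; congr (_ - _).
  by rewrite mulmxDl mulmxDr mul1mx mulmx1.
have e v : v *m ((M - 1%:M) *m invmx (M + 1%:M)) = v *m invmx (M + 1%:M) *m (M - 1%:M).
  rewrite -[RHS]mulmxA; congr (_ *m _).
  by apply: (can_inj (mulKmx U)); rewrite mulKVmx // mulmxA cm mulmxK.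
rewrite !e -{2}(mulmxKV U y) -{1}(mulmxKV U z).
move: (y *m invmx _) (z *m invmx _) => {}y {}z.
by rewrite !(mulmxDr, mulmxBr, mulmxN, mulmx1) !formS !form_isometry //; ring.
Qed.

Lemma form_skew_pow Y j y z : skew Y -> form (y *m Y ^+ j) z = (-1) ^+ j * form y (z *m Y ^+ j).
Proof.
move=> sY; elim: j y z => [|j IH] y z; first by rewrite !expr0 !mulmx1 mul1r.
rewrite {1}exprSr -mulmxE mulmxA sY IH exprS -mulrA mulN1r.
by rewrite -mulmxA mulmxE -exprS.
Qed.

Section KrylovDecomposition.
Variables (Y : 'M[R]_N) (u : 'rV[R]_N) (m k : nat) (Z : 'M[R]_(k, N)).
Hypotheses (sY : skew Y) (Ym : Y ^+ m.+1 = 0) (ZY : Z *m Y = 0).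
Hypothesis full : forall y, exists (p : nat -> R) (z : 'rV[R]_N),
  (z <= Z)%MS /\ y = \sum_(i < m.+1) p i *: (u *m Y ^+ i) + z.

Let kill z (S : 'M[R]_N) : (z <= Z)%MS -> Z *m S = 0 -> z *m S = 0.
Proof. by move=> /submxP[D ->] ZS; rewrite -mulmxA ZS mulmx0. Qed.

(** A matrix that commutes with [Y] and kills [Z] is determined by the image of [u]. *)
Lemma krylov_poly H (p : nat -> R) : Y *m H = H *m Y -> Z *m H = 0 ->
  p 0%N = 0 -> u *m H = \sum_(i < m.+1) p i *: (u *m Y ^+ i) ->
  H = \sum_(i < m.+1) p i *: Y ^+ i.
Proof.
move=> cYH ZH p0 uH.
have cY j : Y ^+ j *m H = H *m Y ^+ j.
  by have := commrX j (_ : GRing.comm H Y); rewrite /GRing.comm -!mulmxE => ->.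
apply: mulmx_rowP => y; have [c [z [zZ ->]]] := full y.
rewrite !mulmxDl (kill (z := z) (S := H)) // (kill (z := z) (S := \sum_i _)) //; last first.
  rewrite mulmx_sumr big1 // => i _; rewrite -scalemxAr.
  have [i0|i0] := posnP i; first by rewrite i0 p0 scale0r.
  by rewrite -(prednK i0) exprS -mulmxE mulmxA ZY mul0mx scaler0.
congr (_ + _); rewrite !mulmx_suml; apply: eq_bigr => i _.
rewrite -!scalemxAl -mulmxA cY mulmxA uH mulmx_suml mulmx_sumr; congr (_ *: _).
by apply: eq_bigr => j _; rewrite -scalemxAl -scalemxAr -!mulmxA !mulmxE -!exprD addnC.
Qed.

(** The adjoint of [Y^i] is [(-1)^i Y^i], so skewness removes the even powers. *)
Lemma odd_span H (p : nat -> R) : skew H -> Y *m H = H *m Y -> Z *m H = 0 ->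
  p 0%N = 0 -> u *m H = \sum_(i < m.+1) p i *: (u *m Y ^+ i) ->
  H = \sum_(i < m.+1 | odd i) p i *: Y ^+ i.
Proof.
move=> sH cYH ZH p0 uH; have HE := krylov_poly cYH ZH p0 uH.
have H2 : H = - \sum_(i < m.+1) (-1) ^+ i *: (p i *: Y ^+ i).
  apply: mulmx_rowP => y; apply/eqP; rewrite -subr_eq0; apply/eqP/form_nondeg => z.
  rewrite mulmxN formBl formNl opprK sH; rewrite {1}HE !mulmx_sumr.
  have fs (f : 'I_m.+1 -> 'rV[R]_N) w : form w (\sum_i f i) = \sum_i form w (f i).
    by apply: (big_morph (form w)); [exact: formDr | exact: form0r].
  rewrite fs (formC _ z) fs -sumrN -big_split big1 //= => i _.
  rewrite -!scalemxAr !formZr (formC z) form_skew_pow //.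
  have ee : (-1) ^+ i * (-1) ^+ i = 1 :> R by rewrite -expr2 sqrr_sign.
  by rewrite mulrCA (mulrA ((-1) ^+ i)) ee mul1r addNr.
have : 2%:R *: H = 2%:R *: \sum_(i < m.+1 | odd i) p i *: Y ^+ i.
  rewrite [2%:R *: H]scaler_nat mulr2n {1}HE {1}H2 -sumrB scaler_sumr [RHS]big_mkcond /=.
  apply: eq_bigr => i _; rewrite -signr_odd; case: (odd i) => /=.
    by rewrite expr1 scaleN1r opprK -mulr2n scaler_nat.
  by rewrite expr0 scale1r subrr.
by move/(congr1 ( *:%R (2%:R^-1))); rewrite !scalerA mulVf // !scale1r.
Qed.

Hypothesis uZ : forall z, (z <= Z)%MS -> form u z = 0.
Hypothesis Znd : forall z, (z <= Z)%MS -> (forall z', (z' <= Z)%MS -> form z z' = 0) -> z = 0.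
Hypothesis ue : form u (u *m Y ^+ m) != 0.

(** Pairing with [u Y^m] reads off the constant coefficient. *)
Lemma form_krylov (p : nat -> R) :
  form (\sum_(i < m.+1) p i *: (u *m Y ^+ i)) (u *m Y ^+ m) = p 0%N * form u (u *m Y ^+ m).
Proof.
rewrite big_ord_recl /= expr0 mulmx1 formDl formZl.
have -> : form (\sum_(i < m) p (bump 0 i) *: (u *m Y ^+ bump 0 i)) (u *m Y ^+ m) = 0.
  rewrite (big_morph (fun y => form y (u *m Y ^+ m)) (fun y z => formDl y z _) (form0l _)).
  rewrite big1 // => i _; rewrite formZl form_skew_pow // -mulmxA mulmxE -exprD.
  have -> : Y ^+ (m + bump 0 i) = 0 by rewrite /bump addnA addn1 exprD Ym mul0r.
  by rewrite mulmx0 form0r !mulr0.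
by rewrite addr0.
Qed.

(** The cyclic space is orthogonal to [Z], and the form is nondegenerate on [Z]; so a vector
    orthogonal to [Z] has no component there. *)
Lemma krylov_orth S : (forall z, (z <= Z)%MS -> form (u *m S) z = 0) ->
  exists p : nat -> R, u *m S = \sum_(i < m.+1) p i *: (u *m Y ^+ i).
Proof.
move=> orth; have [p [z [zZ e]]] := full (u *m S); exists p.
rewrite e [z]Znd ?addr0 // => z' z'Z; have := orth z' z'Z; rewrite e formDl.
rewrite (big_morph (fun y => form y z') (fun y z => formDl y z _) (form0l _)) big1 ?add0r // => i _.
rewrite formZl form_skew_pow //; have [->|i0] := posnP i.
  by rewrite !expr0 mulmx1 uZ // !mulr0.
have z'Y : z' *m Y = 0 by apply: kill.
have -> : z' *m Y ^+ i = 0 by rewrite -(prednK i0) exprS -mulmxE mulmxA z'Y mul0mx.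
by rewrite form0r !mulr0.
Qed.

Lemma form_image S : form (u *m (S *m Y)) (u *m Y ^+ m) = 0.
Proof. by rewrite mulmxA sY -mulmxA mulmxE -exprSr Ym mulmx0 form0r oppr0. Qed.

(** If [p0] is the constant coefficient of [u M], then [u Y^m M = p0 u Y^m], and invariance of the
    form gives [p0^2 = 1]. *)
Lemma krylov_sign M : isometry M -> Y *m M = M *m Y -> Z *m M = Z ->
  form (u *m M) (u *m Y ^+ m) = form u (u *m Y ^+ m) \/
  form (u *m M) (u *m Y ^+ m) = - form u (u *m Y ^+ m).
Proof.
move=> iM cM ZM.
have [p pE] : exists p : nat -> R, u *m M = \sum_(i < m.+1) p i *: (u *m Y ^+ i).
  apply: krylov_orth => z zZ; have zM : z *m M = z by case/submxP: zZ => D ->; rewrite -mulmxA ZM.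
  by rewrite -zM form_isometry // uZ.
have fp := form_krylov p; rewrite -pE in fp.
have cY : Y ^+ m *m M = M *m Y ^+ m.
  have c : GRing.comm M Y by rewrite /GRing.comm -!mulmxE.
  exact/esym/(commrX m c).
have uMY : u *m M *m Y ^+ m = p 0%N *: (u *m Y ^+ m).
  rewrite pE mulmx_suml big_ord_recl /= expr0 mulmx1 -scalemxAl big1 ?addr0 // => i _.
  rewrite -scalemxAl -mulmxA mulmxE -exprD.
  have -> : (bump 0 i + m = m.+1 + i)%N by rewrite /bump add1n !addSn addnC.
  by rewrite exprD Ym mul0r mulmx0 scaler0.
have : p 0%N ^+ 2 == 1.
  rewrite -(inj_eq (mulIf ue)) mul1r expr2 -mulrA -fp -formZr -uMY.
  by rewrite -mulmxA -cY mulmxA form_isometry.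
rewrite sqrf_eq1 fp => /orP[] /eqP ->; first by left; rewrite mul1r.
by right; rewrite mulN1r.
Qed.

(** The hypothesis on the pairing makes the constant coefficient [1], so [M - 1] is divisible by [Y]
    and nilpotent. Then [M + 1] is invertible, and the inverse Cayley transform of [M] is skew,
    hence an odd polynomial in [Y]. *)
Lemma cayley_param M : isometry M -> Y *m M = M *m Y -> Z *m M = Z ->
  form (u *m M) (u *m Y ^+ m) = form u (u *m Y ^+ m) ->
  exists p : nat -> R, let H := \sum_(i < m.+1 | odd i) p i *: Y ^+ i in
    1%:M - H \in unitmx /\ M = cay H.
Proof.
move=> iM cM ZM eM.
have zM z : (z <= Z)%MS -> z *m M = z.
  by case/submxP=> D ->; rewrite -mulmxA ZM.
have [p pE] : exists p : nat -> R, u *m M = \sum_(i < m.+1) p i *: (u *m Y ^+ i).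
  by apply: krylov_orth => z zZ; rewrite -(zM z zZ) form_isometry // uZ.
have p0 : p 0%N = 1.
  by move: eM; rewrite pE form_krylov -[RHS]mul1r => /(mulIf ue).
pose S := \sum_(i < m) p i.+1 *: Y ^+ i.
have cY T : (forall i, Y ^+ i *m T = T *m Y ^+ i) -> T *m S = S *m T.
  move=> cT; rewrite mulmx_sumr mulmx_suml; apply: eq_bigr => i _.
  by rewrite -scalemxAr -scalemxAl cT.
have cSY : Y *m S = S *m Y by apply: cY => i; rewrite !mulmxE -exprSr -exprS.
have M1 : M - 1%:M = S *m Y.
  pose p' i := if i is j.+1 then p j.+1 else 0.
  have -> : M - 1%:M = \sum_(i < m.+1) p' i *: Y ^+ i.
    apply: krylov_poly => //.
    - by rewrite mulmxBl mulmxBr cM mul1mx mulmx1.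
    - by rewrite mulmxBr ZM mulmx1 subrr.
    - rewrite mulmxBr mulmx1 pE !big_ord_recl /= p0 scale0r add0r expr0 mulmx1 scale1r.
      by rewrite addrAC subrr add0r.
  rewrite big_ord_recl /= scale0r add0r mulmx_suml; apply: eq_bigr => i _.
  by rewrite -scalemxAl mulmxE -exprSr.
have M1n : (M - 1%:M) ^+ m.+1 = 0.
  by rewrite M1 mulmxE exprMn_comm ?Ym ?mulr0 // /GRing.comm -!mulmxE cSY.
have MU : M + 1%:M \in unitmx.
  rewrite (_ : M + 1%:M = 2%:R%:M + (M - 1%:M)); first exact: unitmx_add_nilp R2 M1n.
  by rewrite addrCA; congr (_ + _); rewrite raddfMn /= mulr2n addrK.
have [HU cH] := icay MU; have sH := icay_skew iM MU.
set H := (M - 1%:M) *m invmx (M + 1%:M) in HU cH sH.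
have cYi : Y *m invmx (M + 1%:M) = invmx (M + 1%:M) *m Y.
  apply: (can_inj (mulKmx MU)); rewrite mulKVmx // mulmxA.
  have -> : (M + 1%:M) *m Y = Y *m (M + 1%:M) by rewrite mulmxDl mulmxDr cM mul1mx mulmx1.
  by rewrite mulmxK.
have cYH : Y *m H = H *m Y.
  rewrite /H mulmxA -[RHS]mulmxA -cYi [RHS]mulmxA; congr (_ *m _).
  by rewrite mulmxBr mulmxBl cM mul1mx mulmx1.
have ZH : Z *m H = 0 by rewrite /H mulmxA mulmxBr ZM mulmx1 subrr mul0mx.
have [q qE] : exists p : nat -> R, u *m H = \sum_(i < m.+1) p i *: (u *m Y ^+ i).
  by apply: krylov_orth => z zZ; rewrite sH kill ?form0r ?oppr0.
have q0 : q 0%N = 0.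
  have := form_krylov q; rewrite -qE {1}/H M1 -mulmxA cYi (mulmxA S) form_image => /esym/eqP.
  by rewrite mulf_eq0 (negPf ue) orbF => /eqP.
by exists q; rewrite -(odd_span sH cYH ZH q0 qE).
Qed.

End KrylovDecomposition.

Section Skewed.
Variables (A : 'M[R]_N) (k : nat).
Hypotheses (iA : isometry A) (Ak : (A - 1%:M) ^+ k = 0).
Local Notation X := (A - 1%:M).

Definition unip_skew : 'M[R]_N := A - invmx A.
Local Notation Y := unip_skew.

Let AU : A \in unitmx := isometry_unit iA.

Lemma unip_skewP : skew Y.
Proof.
move=> y z; rewrite /Y !mulmxBr formBl formBr.
have h v w : form (v *m A) w = form v (w *m invmx A).
  by rewrite -{1}(mulmxKV AU w) form_isometry.
by rewrite h (formC (y *m _)) -h (formC z) opprB (formC y) ; congr (_ - _); rewrite formC.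
Qed.

Lemma unip_skew_commA M : A *m M = M *m A -> Y *m M = M *m Y.
Proof.
move=> c; rewrite mulmxBl mulmxBr c; congr (_ - _).
by apply: (can_inj (mulKmx AU)); rewrite mulKVmx // mulmxA c mulmxK.
Qed.

(** [A - A^-1 = X A^-1 (2 + X)], and [2 + X] is invertible because [X] is nilpotent. So [Y] may
    replace [X], with the advantage of being skew. *)
Lemma unip_skew_powE j : exists2 U, U \in unitmx & Y ^+ j = X ^+ j *m U.
Proof.
pose U := invmx A *m (2%:R%:M + X).
have UU : U \in unitmx by rewrite unitmx_mul unitmx_inv AU (unitmx_add_nilp R2 Ak).
have eA : 2%:R%:M + X = A + 1%:M by rewrite addrCA; congr (_ + _); rewrite raddfMn /= mulr2n addrK.
have YE : Y = X *m U.
  rewrite /U eA mulmxA mulmxBl mulmxV // mul1mx.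
  by rewrite mulmxBl mul1mx mulmxDr mulmx1 mulVmx // opprD addrA addrK.
have cUA : A *m U = U *m A.
  rewrite /U eA mulKVmx // -mulmxA.
  have -> : (A + 1%:M) *m A = A *m (A + 1%:M) by rewrite mulmxDl mulmxDr mul1mx mulmx1.
  by rewrite mulKmx.
have cUX : GRing.comm U X.
  by rewrite /GRing.comm mulrBr mulrBl mulr1 mul1r -!mulmxE cUA.
exists (U ^+ j).
  by elim: j => [|j IH]; rewrite ?expr0 ?unitmx1 // exprS -mulmxE unitmx_mul UU.
by rewrite YE mulmxE exprMn_comm.
Qed.

Lemma unip_skew_nilp : Y ^+ k = 0.
Proof. by have [U _ ->] := unip_skew_powE k; rewrite Ak mul0mx. Qed.

End Skewed.
End Cayley.

(** * Order of the centraliser *)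

Section Conic.
Variable F : finFieldType.
Hypothesis F2 : 2%:R != 0 :> F.
Variable c : F.
Hypothesis c0 : c != 0.

Definition conic : {set F * F} := [set p | p.1 ^+ 2 + c * p.2 ^+ 2 == 1].

(* Stereographic projection from [(-1, 0)]. *)
Lemma card_conic_param : #|conic| = #|[set t : F | 1 + c * t ^+ 2 != 0]|.+1.
Proof.
pose f (t : F) := ((1 - c * t ^+ 2) / (1 + c * t ^+ 2), 2%:R * t / (1 + c * t ^+ 2)).
have n1 : (-1, 0) \in conic by rewrite inE /= sqrrN expr1n expr0n mulr0 addr0.
rewrite (cardsD1 (-1, 0)) n1 add1n; congr _.+1.
have -> : conic :\ (-1, 0) = f @: [set t : F | 1 + c * t ^+ 2 != 0].
  apply/setP=> -[x y]; apply/idP/imsetP.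
    rewrite !inE /= xpair_eqE => /andP[ne /eqP e].
    have x1 : x + 1 != 0.
      apply: contra ne => /eqP x1; have ex : x = -1 by apply/eqP; rewrite -addr_eq0 x1.
      rewrite ex eqxx /=; move/eqP: e; rewrite ex sqrrN expr1n -subr_eq0 addrAC subrr add0r.
      by rewrite mulf_eq0 (negPf c0) expf_eq0.
    have e1 : (x + 1) ^+ 2 * (1 + c * (y / (x + 1)) ^+ 2) = 2%:R * (x + 1).
      have -> : (x + 1) ^+ 2 * (1 + c * (y / (x + 1)) ^+ 2) = (x ^+ 2 + c * y ^+ 2) + 2%:R * x + 1.
        by field.
      by rewrite e; ring.
    have t0 : 1 + c * (y / (x + 1)) ^+ 2 != 0.
      by apply: contraTneq F2 => h; move/eqP: e1; rewrite h mulr0 eq_sym mulf_eq0 (negPf x1) orbF negbK.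
    exists (y / (x + 1)); first by rewrite inE.
    have e2 : 1 + c * (y / (x + 1)) ^+ 2 = 2%:R / (x + 1).
      apply: (mulfI (_ : (x + 1) ^+ 2 != 0)); first by rewrite expf_neq0.
      by rewrite e1; field.
    have e3 : 1 - c * (y / (x + 1)) ^+ 2 = 2%:R - (1 + c * (y / (x + 1)) ^+ 2) by ring.
    by rewrite /f e3 e2; congr (_, _); field; rewrite x1 F2.
  case=> t; rewrite inE => t0 [-> ->]; rewrite !inE /= xpair_eqE negb_and; apply/andP; split.
    have [t00|t00] := eqVneq t 0.
      rewrite t00 expr0n /= mulr0 subr0 addr0 divr1; apply/orP; left.
      by rewrite -subr_eq0 opprK.
    by apply/orP; right; rewrite !mulf_neq0 // invr_eq0.
  by apply/eqP; field.
rewrite card_in_imset // => t t'; rewrite !inE => t0 t0' [e1 e2].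
have h (s : F) : 1 + c * s ^+ 2 != 0 ->
    (1 - c * s ^+ 2) / (1 + c * s ^+ 2) + 1 = 2%:R / (1 + c * s ^+ 2).
  by move=> s0; field.
have e3 : 2%:R / (1 + c * t ^+ 2) = 2%:R / (1 + c * t' ^+ 2) by rewrite -!h // e1.
have n3 : 2%:R / (1 + c * t ^+ 2) != 0 by rewrite mulf_neq0 // invr_eq0.
apply: (mulfI n3); rewrite {2}e3.
by rewrite -[LHS]mulrAC -[RHS]mulrAC.
Qed.

(** The excluded parameters are the roots of [1 + c t^2]: two of them if [-c] is a square, none
    otherwise. *)
Lemma card_conic :
  #|conic| = if [exists t : F, t ^+ 2 == - c] then #|F|.-1 else #|F|.+1.
Proof.
rewrite card_conic_param; case: ifP => [/existsP[s /eqP es]|ns].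
  have s0 : s != 0 by apply: contraNneq c0 => s0; rewrite -oppr_eq0 -es s0 expr0n.
  have cE : c = - s ^+ 2 by rewrite es opprK.
  have -> : [set t : F | 1 + c * t ^+ 2 != 0] = ~: [set s^-1; - s^-1].
    apply/setP=> t; rewrite !inE cE.
    have -> : 1 + - s ^+ 2 * t ^+ 2 = (1 - s * t) * (1 + s * t) by ring.
    rewrite mulf_eq0 !negb_or subr_eq0 addr_eq0 -(inj_eq (mulfI s0) t) -(inj_eq (mulfI s0) t (- _)).
    by rewrite mulrN mulfV // [1 == s * t]eq_sym -[s * t == - 1]eqr_oppLR [- _ == 1]eq_sym.
  have := cardsC [set s^-1; - s^-1]; rewrite cards2.
  have -> /= : s^-1 != - s^-1.
    rewrite -addr_eq0 -mulr2n -mulr_natl mulf_neq0 // invr_eq0 //.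
  by move=> <-; rewrite addSn addSn add0n.
have -> : [set t : F | 1 + c * t ^+ 2 != 0] = setT.
  apply/setP=> t; rewrite !inE; apply/negP=> /eqP e; suff: [exists t : F, t ^+ 2 == - c] by rewrite ns.
  apply/existsP.
  exists (t^-1); have t0 : t != 0.
    by apply/eqP=> t0; move/eqP: e; rewrite t0 expr0n mulr0 addr0 oner_eq0.
  have -> : c = - t ^- 2.
    by apply: (mulIf (_ : t ^+ 2 != 0)); rewrite ?expf_neq0 // mulNr mulVf ?expf_neq0 //; apply/eqP; rewrite -addr_eq0 addrC e.
  by rewrite opprK exprVn.
by rewrite cardsT.
Qed.

End Conic.

Lemma sum_odd_ord (V : zmodType) (f : nat -> V) l :
  \sum_(i < l.*2.+1 | odd i) f i = \sum_(i < l) f i.*2.+1.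
Proof.
elim: l => [|l IH]; first by rewrite big_mkcond big_ord_recl !big_ord0 /= addr0.
rewrite doubleS big_mkcond 2!big_ord_recr -big_mkcond /= IH big_ord_recr /=.
by rewrite odd_double /= addr0.
Qed.

Lemma det_opp_odd (R : comNzRingType) n (M : 'M[R]_(n.*2.+1)) : \det (- M) = - \det M.
Proof. by rewrite -scaleN1r detZ -signr_odd /= odd_double expr1 mulN1r. Qed.

Section IsometryGroup.
Variables (F : fieldType) (N : nat).
Implicit Types M : 'M[F]_N.

Lemma isometryN M : isometry (- M) = isometry M.
Proof. by rewrite /isometry linearN /= mulmxN !mulNmx opprK. Qed.

Lemma isometryM M M' : isometry M -> isometry M' -> isometry (M *m M').
Proof. by move=> iM iM'; apply: isometryP => y z; rewrite !mulmxA !form_isometry. Qed.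

Lemma isometryV M : isometry M -> isometry (invmx M).
Proof.
move=> iM; apply: isometryP => y z.
by rewrite -(form_isometry _ _ iM) !mulmxKV ?isometry_unit.
Qed.

End IsometryGroup.

Section CentraliserOrder.
Variables (F : finFieldType) (n : nat).
Local Notation N := n.*2.+1.
Local Notation GL := {'GL_N[F]}.
Hypothesis F2 : 2%:R != 0 :> F.
Variables (x : GL).
Hypothesis xG : x \in SO F n.
Hypothesis n1 : (1 < n)%N.
Local Notation A := (mx_of x).
Local Notation X := (A - 1%:M).
Local Notation m := (n.*2).-2.

Let iA : isometry A := SO_isometry xG.

Implicit Types (y z v : 'rV[F]_N) (M S : 'M[F]_N).

(* The elements of ['C_G[x]] and their opposites. *)
Definition isom_cent : {set 'M[F]_N} := [set M | isometry M && (M *m A == A *m M)].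

Lemma isom_centP M : reflect (isometry M /\ M *m A = A *m M) (M \in isom_cent).
Proof. by rewrite inE; apply: (iffP andP) => -[h /eqP e]. Qed.

Lemma isom_centM M M' : M \in isom_cent -> M' \in isom_cent -> M *m M' \in isom_cent.
Proof.
move=> /isom_centP[iM cM] /isom_centP[iM' cM']; apply/isom_centP; split; first exact: isometryM.
by rewrite -mulmxA cM' mulmxA cM mulmxA.
Qed.

Lemma isom_centV M : M \in isom_cent -> invmx M \in isom_cent.
Proof.
move=> /isom_centP[iM cM]; apply/isom_centP; split; first exact: isometryV.
have MU := isometry_unit iM.
by apply: (can_inj (mulKmx MU)); rewrite mulKVmx // mulmxA cM mulmxK.
Qed.

Lemma card_isom_cent : #|isom_cent| = (2 * #|'C_(SO F n)[x]|)%N.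
Proof.
pose S1 := [set mx_of g | g in 'C_(SO F n)[x]].
have S1P M : (M \in S1) = (M \in isom_cent) && (\det M == 1).
  apply/imsetP/andP.
    case=> g /setIP[gG /cent1P cg] ->; split; last by move: gG; rewrite mem_SO is_SOE => /andP[].
    apply/isom_centP; split; first exact: SO_isometry.
    by rewrite -!mx_ofM cg.
  case=> /isom_centP[iM cM] dM; have [|g gG eg] := @mx_of_SO F n M.
    by rewrite is_SOE iM.
  exists g => //; apply/setIP; split=> //; apply/cent1P; apply: mx_of_inj.
  by rewrite !mx_ofM eg.
have -> : isom_cent = S1 :|: [set - M | M in S1].
  apply/setP=> M; rewrite in_setU S1P; apply/idP/orP.
    move=> cM; case/isom_centP: (cM) => iM e.
    case/orP: (isometry_det iM) => d; first by left; rewrite cM.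
    right; apply/imsetP; exists (- M); last by rewrite opprK.
    rewrite S1P det_opp_odd (eqP d) opprK eqxx andbT; apply/isom_centP.
    by rewrite isometryN mulNmx mulmxN e.
  case=> [/andP[]//|/imsetP[M']]; rewrite S1P => /andP[/isom_centP[iM e] _] ->.
  by apply/isom_centP; rewrite isometryN mulNmx mulmxN e.
rewrite cardsU (_ : S1 :&: _ = set0); last first.
  apply/setP=> M; rewrite in_setI in_set0 S1P; apply/negP=> /andP[/andP[_ d]].
  case/imsetP=> M'; rewrite S1P => /andP[_ d'] e; move: d; rewrite e det_opp_odd (eqP d').
  by rewrite eqr_oppLR -subr_eq0 opprK -[1 + 1]/(2%:R) (negPf F2).
rewrite cards0 subn0 (card_imset _ (@oppr_inj _)) (card_imset _ (@mx_of_inj F n)).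
by rewrite addnn mul2n.
Qed.

(** * Counting by the action on frames of the fixed space *)

Section Frame.
Variables (r v1 v2 u : 'rV[F]_N) (a b : F).
Hypotheses (rX : r *m X = 0) (v1X : v1 *m X = 0) (v2X : v2 *m X = 0).
Hypotheses (rr : form r r = 0) (rv1 : form r v1 = 0) (rv2 : form r v2 = 0)
  (v11 : form v1 v1 = a) (v22 : form v2 v2 = b) (v12 : form v1 v2 = 0).
Hypotheses (r0 : r != 0) (a0 : a != 0) (b0 : b != 0).
Hypothesis ker_dec : forall y, y *m X = 0 ->
  exists p q s, y = p *: r + q *: v1 + s *: v2.
Hypotheses (u1 : form u v1 = 0) (u2 : form u v2 = 0) (ur : u *m X ^+ m = r).
Hypothesis Xm : X ^+ m.+1 = 0.
Local Notation Z := (v1 + v2)%MS.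
Local Notation Y := (unip_skew A).

Let v21 : form v2 v1 = 0. Proof. by rewrite formC. Qed.
Let v1r : form v1 r = 0. Proof. by rewrite formC. Qed.
Let v2r : form v2 r = 0. Proof. by rewrite formC. Qed.

Let fixX y : y *m X = 0 -> y *m A = y.
Proof. by move/eqP; rewrite mulmxBr mulmx1 subr_eq0 => /eqP. Qed.

Lemma frame_inj p q s : p *: r + q *: v1 + s *: v2 = 0 -> [/\ p = 0, q = 0 & s = 0].
Proof.
move=> e; have q0 : q = 0.
  have := congr1 (fun w => form w v1) e; rewrite /= !formS rv1 v21 v11 !mulr0 add0r addr0 => /eqP.
  by rewrite mulf_eq0 (negPf a0) orbF => /eqP.
have s0 : s = 0.
  have := congr1 (fun w => form w v2) e; rewrite /= !formS rv2 v12 v22 !mulr0 !add0r => /eqP.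
  by rewrite mulf_eq0 (negPf b0) orbF => /eqP.
move: e; rewrite q0 s0 !scale0r !addr0 => /eqP; rewrite scaler_eq0 (negPf r0) orbF.
by move/eqP.
Qed.

Lemma ZP z : (z <= Z)%MS -> exists q s, z = q *: v1 + s *: v2.
Proof.
case/sub_addsmxP=> -[c d] /= ->; exists (c 0 0), (d 0 0).
by rewrite {1}[c]mx11_scalar {1}[d]mx11_scalar !mul_scalar_mx.
Qed.

Let v1Z : (v1 <= Z)%MS := addsmxSl _ _.
Let v2Z : (v2 <= Z)%MS := addsmxSr _ _.

Let Ym : Y ^+ m.+1 = 0 := unip_skew_nilp F2 iA Xm.
Let sY : skew Y := unip_skewP iA.

Let XY y : y *m X = 0 -> y *m Y = 0.
Proof.
have [U _ e] := unip_skew_powE F2 iA Xm 1; rewrite !expr1 in e.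
by move=> yX; rewrite e mulmxA yX mul0mx.
Qed.

Let XYpow j y : (0 < j)%N -> y *m X = 0 -> y *m Y ^+ j = 0.
Proof. by case: j => // j _ yX; rewrite exprS -mulmxE mulmxA XY // mul0mx. Qed.

Let m0 : (0 < m)%N. Proof. by move: n1; clear; lia. Qed.

Let ZY : Z *m Y = 0.
Proof.
apply/eqP; rewrite -submx0 addsmxMr addsmx_sub !submx0.
by rewrite (XY v1X) (XY v2X) !eqxx.
Qed.

(** The vector [u Y^m] is fixed, nonzero and, by skewness of [Y], orthogonal to [v1] and [v2]. *)
Let uYm : exists2 al, al != 0 & u *m Y ^+ m = al *: r.
Proof.
have [U UU e] := unip_skew_powE F2 iA Xm m; have eY : u *m Y ^+ m = r *m U by rewrite e mulmxA ur.
have : u *m Y ^+ m *m X = 0.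
  have [U' UU' e'] := unip_skew_powE F2 iA Xm 1; rewrite !expr1 in e'.
  have : u *m Y ^+ m *m Y = 0 by rewrite -mulmxA -[_ *m Y]exprSr Ym mulmx0.
  rewrite e' mulmxA => /(congr1 (mulmx^~ (invmx U'))).
  by rewrite mul0mx mulmxK.
case/ker_dec=> p [q [s e1]].
have orth v : v *m X = 0 -> form u v = 0 -> form (u *m Y ^+ m) v = 0.
  by move=> vX uv; rewrite form_skew_pow // (XYpow m0 vX) form0r mulr0.
have q0 : q = 0.
  have := orth v1 v1X u1; rewrite e1 !formS rv1 v21 v11 !mulr0 add0r addr0 => /eqP.
  by rewrite mulf_eq0 (negPf a0) orbF => /eqP.
have s0 : s = 0.
  have := orth v2 v2X u2; rewrite e1 !formS rv2 v12 v22 !mulr0 !add0r => /eqP.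
  by rewrite mulf_eq0 (negPf b0) orbF => /eqP.
exists p; last by rewrite e1 q0 s0 !scale0r !addr0.
apply: contraNneq r0 => p0; move: e1; rewrite p0 q0 s0 !scale0r !addr0 eY.
by move/(congr1 (mulmx^~ (invmx U))); rewrite mulmxK // mul0mx => ->.
Qed.

Let full : forall y, exists (p : nat -> F) (z : 'rV[F]_N),
  (z <= Z)%MS /\ y = \sum_(i < m.+1) p i *: (u *m Y ^+ i) + z.
Proof.
have [al al0 e] := uYm; apply: krylov_full => //.
- by rewrite e scaler_eq0 negb_or al0.
- rewrite e (eqmx_scale _ al0); apply/negP=> /ZP[q [s es]].
  have := @frame_inj (-1) q s; rewrite -addrA -es scaleN1r addNr => /(_ erefl)[/eqP].
  by rewrite oppr_eq0 oner_eq0.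
- have v1n : v1 != 0 by apply: contraNneq a0 => h; rewrite -v11 h form0l.
  rewrite rank_add_row; first by rewrite rank_rV v1n; move: n1; clear; lia.
  apply/negP=> /sub_rVP[q e2]; case/eqP: b0; rewrite -v22 {1}e2 formZl v12 mulr0 //.
Qed.

Let uZ z : (z <= Z)%MS -> form u z = 0.
Proof. by case/ZP=> q [s ->]; rewrite !formS u1 u2 !mulr0 addr0. Qed.

Let Znd z : (z <= Z)%MS -> (forall z', (z' <= Z)%MS -> form z z' = 0) -> z = 0.
Proof.
case/ZP=> q [s ->] h; have := h v1 v1Z; have := h v2 v2Z; rewrite !formS v11 v22 v12 v21.
rewrite !mulr0 add0r addr0 => /eqP; rewrite mulf_eq0 (negPf b0) orbF => /eqP ->.
by move/eqP; rewrite mulf_eq0 (negPf a0) orbF => /eqP ->; rewrite !scale0r addr0.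
Qed.

(** Otherwise [r] would be orthogonal to the cyclic space of [u] and to [Z], hence to everything. *)
Let ue : form u (u *m Y ^+ m) != 0.
Proof.
have [al al0 e] := uYm; apply/eqP=> h; case/eqP: r0.
have h1 : form u r = 0.
  by move/eqP: h; rewrite e formZr mulf_eq0 (negPf al0) => /eqP.
apply: form_nondeg => w; have [p [z [zZ ->]]] := full w; rewrite formDr.
have -> : form r z = 0 by have [q [s ->]] := ZP zZ; rewrite !formS rv1 rv2 !mulr0 addr0.
rewrite (big_morph (form r) (formDr r) (form0r r)) big1 ?addr0 // => i _.
rewrite formZr; have [->|i0] := posnP i; first by rewrite expr0 mulmx1 formC h1 mulr0.
by rewrite formC form_skew_pow // XYpow // form0r !mulr0.
Qed.

Definition frame_stab : {set 'M[F]_N} := [set M in isom_cent | (v1 *m M == v1) && (v2 *m M == v2)].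

Let frame_stabP M : reflect [/\ M \in isom_cent, v1 *m M = v1 & v2 *m M = v2] (M \in frame_stab).
Proof.
apply: (iffP setIdP) => [[h /andP[/eqP e1 /eqP e2]]|[h e1 e2]] //.
by rewrite e1 e2 !eqxx.
Qed.

Definition frame_orbit : {set 'rV[F]_N * 'rV[F]_N} :=
  [set w | [&& w.1 *m X == 0, w.2 *m X == 0, form w.1 w.1 == a, form w.2 w.2 == b & form w.1 w.2 == 0]].

(** Each target is a multiple of [r] plus a vector [m1] or [m2] of the plane of [v1] and [v2]. A
    plane isometry reaches [m1] and [m2], and a Siegel transformation of [r] adds the multiples of
    [r]. *)
Lemma frame_transitive w : w \in frame_orbit ->
  exists2 M, M \in isom_cent & v1 *m M = w.1 /\ v2 *m M = w.2.
Proof.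
case: w => y1 y2; rewrite inE /= => /and5P[/eqP y1X /eqP y2X /eqP y11 /eqP y22 /eqP y12].
have dec y : y *m X = 0 -> exists p q s mm, [/\ y = p *: r + mm, mm = q *: v1 + s *: v2,
    form r mm = 0 & mm *m X = 0].
  move=> /ker_dec[p [q [s ->]]]; exists p, q, s, (q *: v1 + s *: v2); rewrite addrA; split=> //.
    by rewrite !formS rv1 rv2 !mulr0 addr0.
  by rewrite mulmxDl -!scalemxAl v1X v2X !scaler0 addr0.
have [p1 [q1 [s1 [m1 [em1 d1 rm1 m1X]]]]] := dec _ y1X.
have [p2 [q2 [s2 [m2 [em2 d2 rm2 m2X]]]]] := dec _ y2X.
have m11 : form m1 m1 = a.
  by rewrite -y11 em1 formDl !formDr !formZl !formZr (formC m1 r) rr rm1 !mulr0 !add0r.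
have m22 : form m2 m2 = b.
  by rewrite -y22 em2 formDl !formDr !formZl !formZr (formC m2 r) rr rm2 !mulr0 !add0r.
have m12 : form m1 m2 = 0.
  by rewrite -y12 em1 em2 formDl !formDr !formZl !formZr (formC m1 r) rr rm1 rm2 !mulr0 !add0r.
pose rank1 c v w' : 'M[F]_N := c *: (antidiag F N *m v^T *m (w' : 'rV[F]_N)).
(* [g] sends [v1] to [m1] and [v2] to [m2], and is the identity on their orthogonal. *)
pose g := 1%:M + rank1 a^-1 v1 (m1 - v1) + rank1 b^-1 v2 (m2 - v2).
have rank1E c v w' y : y *m rank1 c v w' = (form y v * c) *: w'.
  by rewrite -scalemxAr !mulmxA form_mx mul_scalar_mx scalerA mulrC.
have gE y : y *m g = y + (form y v1 / a) *: (m1 - v1) + (form y v2 / b) *: (m2 - v2).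
  by rewrite /g 2!mulmxDr mulmx1 !rank1E.
have perp_g y : form y v1 = 0 -> form y v2 = 0 -> y *m g = y.
  by move=> h1 h2; rewrite gE h1 h2 !mul0r !scale0r !addr0.
have v1g : v1 *m g = m1.
  by rewrite gE v11 v12 mul0r scale0r addr0 mulfV // scale1r addrCA subrr addr0.
have v2g : v2 *m g = m2.
  by rewrite gE v22 v21 mul0r scale0r addr0 mulfV // scale1r addrCA subrr addr0.
have pr y : exists y' c d, [/\ y = y' + c *: v1 + d *: v2, form y' v1 = 0 & form y' v2 = 0].
  exists (y - (form y v1 / a) *: v1 - (form y v2 / b) *: v2), (form y v1 / a), (form y v2 / b); split.
  - by apply/rowP=> i; rewrite !mxE; ring.
  - by rewrite !formS v11 v21 mulr0 subr0 mulfVK // subrr.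
  - by rewrite !formS v22 v12 mulr0 subr0 mulfVK // subrr.
have ig : isometry g.
  apply: isometryP => y z; have [y' [al [be [-> y1' y2']]]] := pr y.
  have [z' [ga [de [-> z1' z2']]]] := pr z.
  rewrite !mulmxDl -!scalemxAl v1g v2g (perp_g y') // (perp_g z') //.
  have h v c d : form v v1 = 0 -> form v v2 = 0 -> form v (c *: v1 + d *: v2) = 0.
    by move=> w1 w2; rewrite !formS w1 w2 !mulr0 addr0.
  rewrite !(formDl, formDr, formZl, formZr) !(formC m1 z') !(formC m2 z').
  rewrite !(formC v1 z') !(formC v2 z') (formC m2 m1) m11 m22 m12.
  by rewrite y1' y2' z1' z2' v11 v22 v12 v21 d1 d2 !h //; ring.
have cg : g *m A = A *m g.
  apply: mulmx_rowP => y; rewrite !mulmxA !gE !mulmxDl -!scalemxAl !mulmxBl.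
  rewrite (fixX m1X) (fixX m2X) (fixX v1X) (fixX v2X).
  have fA v : v *m X = 0 -> form (y *m A) v = form y v.
    by move=> vX; rewrite -{1}(fixX vX) form_isometry.
  by rewrite !fA.
(* Chosen so that [eichler r w] adds [p1 r] to [m1] and [p2 r] to [m2]; it commutes with [A] because
   [r] and [w] are fixed. *)
pose w := - ((p1 / a) *: m1 + (p2 / b) *: m2).
have rw : form r w = 0 by rewrite formNr !formS rm1 rm2 !mulr0 addr0 oppr0.
have wA : w *m A = w.
  by rewrite mulNmx mulmxDl -!scalemxAl (fixX m1X) (fixX m2X).
have E : eichler r w \in isom_cent.
  apply/isom_centP; split; first exact: eichler_isometry.
  by rewrite eichlerJ // wA (fixX rX).
exists (g *m eichler r w); first by apply: isom_centM => //; apply/isom_centP.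
rewrite !mulmxA v1g v2g !mul_eichler !(formC _ r) rm1 rm2 !(mulr0, scale0r, addr0, subr0) /w.
rewrite !formNr !formDr !formZr m11 m12 m22 (formC m2 m1) m12 !mulr0 addr0 add0r !divfK // em1 em2.
by rewrite !scaleNr !opprK !(addrC (_ *: r)).
Qed.

(** Orbit counting: each fibre is a coset of [frame_stab]. *)
Lemma card_frame_fibers : #|isom_cent| = (#|frame_orbit| * #|frame_stab|)%N.
Proof.
rewrite -sum1_card (partition_big (fun M => (v1 *m M, v2 *m M)) (mem frame_orbit)) /=; last first.
  move=> M /isom_centP[iM cM]; rewrite inE /= !form_isometry // v11 v22 v12 !eqxx /= andbT.
  have h v : v *m X = 0 -> v *m M *m X == 0.
    move=> vX; rewrite -mulmxA mulmxBr cM mulmx1 mulmxBr mulmxA (fixX vX) subrr //.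
  by rewrite !h.
rewrite -sum_nat_const; apply: eq_bigr => w /frame_transitive[M0 M0c [e1 e2]].
rewrite sum1_card -[RHS](card_imset _ (can_inj (mulmxK (isometry_unit (proj1 (isom_centP _ M0c)))))).
apply: eq_card => M; apply/andP/imsetP.
  case=> Mc /eqP ew; have [h1 h2] : v1 *m M = w.1 /\ v2 *m M = w.2 by rewrite -ew.
  have MU : M0 \in unitmx by apply: isometry_unit; case/isom_centP: M0c.
  exists (M *m invmx M0); last by rewrite mulmxKV.
  apply/frame_stabP; split; first by rewrite isom_centM ?isom_centV.
    by rewrite mulmxA h1 -e1 mulmxK.
  by rewrite mulmxA h2 -e2 mulmxK.
case=> S /frame_stabP[Sc S1 S2] ->; split; first exact: isom_centM.
by rewrite !mulmxA S1 S2 e1 e2; case: (w).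
Qed.

Definition frame_unip : {set 'M[F]_N} :=
  [set M in frame_stab | form (u *m M) (u *m Y ^+ m) == form u (u *m Y ^+ m)].

Let frame_stab_fix M z : M \in frame_stab -> (z <= Z)%MS -> z *m M = z.
Proof.
by case/frame_stabP=> _ e1 e2 /ZP[q [s ->]]; rewrite mulmxDl -!scalemxAl e1 e2.
Qed.

Let frame_stab_sign M : M \in frame_stab ->
  form (u *m M) (u *m Y ^+ m) = form u (u *m Y ^+ m) \/
  form (u *m M) (u *m Y ^+ m) = - form u (u *m Y ^+ m).
Proof.
move=> MS; have [/isom_centP[iM cM] _ _] := frame_stabP _ MS.
apply: (krylov_sign sY Ym ZY full uZ Znd ue) => //; first exact: unip_skew_commA.
apply/row_matrixP=> i; rewrite row_mul; apply: frame_stab_fix => //; exact: row_sub.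
Qed.

(* The involution that is the identity on [<v1, v2>] and [-1] on its
   orthogonal exchanges the two signs. *)
Lemma card_frame_stab : #|frame_stab| = (2 * #|frame_unip|)%N.
Proof.
pose s : 'M[F]_N := - 1%:M + (2%:R / a) *: (antidiag F N *m v1^T *m v1)
  + (2%:R / b) *: (antidiag F N *m v2^T *m v2).
have sE y : y *m s = - y + (2%:R / a * form y v1) *: v1 + (2%:R / b * form y v2) *: v2.
  by rewrite /s 2!mulmxDr mulmxN mulmx1 -!scalemxAr !mulmxA !form_mx !mul_scalar_mx !scalerA.
have v1s : v1 *m s = v1.
  rewrite sE v11 v12 mulr0 scale0r addr0 divfK // mulr2n scalerDl scale1r addKr //.
have v2s : v2 *m s = v2.
  rewrite sE v22 v21 mulr0 scale0r addr0 divfK // mulr2n scalerDl scale1r addKr //.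
have us : u *m s = - u by rewrite sE u1 u2 !mulr0 !scale0r !addr0.
have ss y : y *m s *m s = y.
  rewrite [y *m s]sE !mulmxDl mulNmx -!scalemxAl v1s v2s sE.
  by apply/rowP=> i; rewrite !mxE; ring.
have ssM : s *m s = 1%:M by apply: mulmx_rowP => y; rewrite mulmxA ss mulmx1.
have sc : s \in isom_cent.
  apply/isom_centP; split.
    apply: isometryP => y z; rewrite !sE !formS v11 v22 v12 v21 (formC v1 z) (formC v2 z).
    by field; rewrite a0 b0.
  apply: mulmx_rowP => y; rewrite !mulmxA !sE !mulmxDl mulNmx -!scalemxAl (fixX v1X) (fixX v2X).
  have fA v : v *m X = 0 -> form (y *m A) v = form y v.
    by move=> vX; rewrite -{1}(fixX vX) form_isometry.
  by rewrite !fA.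
have sS M : M \in frame_stab -> s *m M \in frame_stab.
  case/frame_stabP=> Mc e1 e2; apply/frame_stabP; split; first exact: isom_centM.
    by rewrite mulmxA v1s.
  by rewrite mulmxA v2s.
have usM M : form (u *m (s *m M)) (u *m Y ^+ m) = - form (u *m M) (u *m Y ^+ m).
  by rewrite mulmxA us mulNmx formNl.
have enz : form u (u *m Y ^+ m) != - form u (u *m Y ^+ m).
  by rewrite -addr_eq0 -mulr2n -mulr_natl mulf_neq0.
have -> : frame_stab = frame_unip :|: [set s *m M | M in frame_unip].
  apply/setP=> M; rewrite in_setU; apply/idP/orP.
    move=> MS; case: (frame_stab_sign MS) => e; first by left; apply/setIdP; rewrite e.
    right; apply/imsetP; exists (s *m M); last by rewrite mulmxA ssM mul1mx.
    by apply/setIdP; rewrite usM e opprK; split=> //; apply: sS.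
  case=> [/setIdP[]//|/imsetP[M' /setIdP[M'S _] ->]]; exact: sS.
have sI : injective (mulmx s : 'M[F]_N -> 'M[F]_N).
  by move=> M M' /(congr1 (mulmx s)); rewrite !mulmxA ssM !mul1mx.
rewrite cardsU (card_imset _ sI) (_ : _ :&: _ = set0) ?cards0 ?subn0 ?addnn ?mul2n //.
apply/setP=> M; rewrite in_setI in_set0; apply/negP=> /andP[/setIdP[_ /eqP e1]].
case/imsetP=> M' /setIdP[_ /eqP e2] e; case/eqP: enz; rewrite -{1}e1 e usM e2 //.
Qed.

Definition odd_poly_mx (c : {ffun 'I_n.-1 -> F}) : 'M[F]_N :=
  \sum_(l < n.-1) c l *: Y ^+ l.*2.+1.

Let mE : m.+1 = (n.-1).*2.+1. Proof. by move: n1; clear; lia. Qed.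

Let odd_poly_comm c M : Y *m M = M *m Y -> odd_poly_mx c *m M = M *m odd_poly_mx c.
Proof.
move=> cM; rewrite mulmx_suml mulmx_sumr; apply: eq_bigr => l _.
rewrite -scalemxAl -scalemxAr; congr (_ *: _); apply/esym.
by apply: (commrX _ (_ : GRing.comm M Y)); rewrite /GRing.comm -!mulmxE.
Qed.

Let odd_poly_factor c : exists2 S, odd_poly_mx c = S *m Y & Y *m S = S *m Y.
Proof.
exists (\sum_(l < n.-1) c l *: Y ^+ l.*2).
  by rewrite mulmx_suml; apply: eq_bigr => l _; rewrite -scalemxAl mulmxE -exprSr.
rewrite mulmx_suml mulmx_sumr; apply: eq_bigr => l _.
by rewrite -scalemxAl -scalemxAr !mulmxE -exprSr -exprS.
Qed.

Let odd_poly_nilp c : odd_poly_mx c ^+ m.+1 = 0.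
Proof.
have [S -> cS] := odd_poly_factor c.
by rewrite mulmxE exprMn_comm ?Ym ?mulr0 // /GRing.comm -!mulmxE cS.
Qed.

Let odd_poly_unit c : 1%:M - odd_poly_mx c \in unitmx.
Proof.
apply: (unitmx_add_nilp (oner_neq0 _) (k := m.+1)).
by rewrite exprNn odd_poly_nilp mulr0.
Qed.

Let odd_poly_skew c : skew (odd_poly_mx c).
Proof.
move=> y z; rewrite !mulmx_sumr.
rewrite (big_morph (fun y => form y z) (fun y z' => formDl y z' z) (form0l z)).
rewrite (big_morph (form y) (formDr y) (form0r y)) -sumrN; apply: eq_bigr => l _.
rewrite -!scalemxAr formZl formZr form_skew_pow // -signr_odd /= odd_double expr1 mulN1r.
by rewrite mulrN.
Qed.

Let odd_poly_kill c v : v *m X = 0 -> v *m odd_poly_mx c = 0.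
Proof.
move=> vX; have [S -> cS] := odd_poly_factor c.
by rewrite -cS mulmxA XY // mul0mx.
Qed.

(** The Cayley transform fixes the kernel of [X] pointwise and is [1] plus a multiple of [Y], so the
    pairing with [u Y^m] does not change. *)
Lemma cay_odd_poly_unip c : cay (odd_poly_mx c) \in frame_unip.
Proof.
set H := odd_poly_mx c; have HU : 1%:M - H \in unitmx := odd_poly_unit c.
have fixc v : v *m X = 0 -> v *m cay H = v.
  move=> vX; have vH : v *m H = 0 := odd_poly_kill c vX.
  have e1 : v *m (1%:M - H) = v by rewrite mulmxBr mulmx1 vH subr0.
  have e2 : v *m (1%:M + H) = v by rewrite mulmxDr mulmx1 vH addr0.
  by rewrite /cay mulmxA e2 -{1}e1 mulmxK.
have ic : isometry (cay H) := cay_isometry (odd_poly_skew c) HU.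
have cA : H *m A = A *m H.
  by apply: odd_poly_comm; apply: unip_skew_commA.
have cI : (1%:M - H) *m A = A *m (1%:M - H) by rewrite mulmxBl mulmxBr mul1mx mulmx1 cA.
have cc : cay H *m A = A *m cay H.
  rewrite /cay -mulmxA.
  have -> : invmx (1%:M - H) *m A = A *m invmx (1%:M - H).
    by apply: (can_inj (mulKmx HU)); rewrite mulKVmx // mulmxA cI mulmxK.
  by rewrite !mulmxA mulmxDl mulmxDr mul1mx mulmx1 cA.
apply/setIdP; split.
  by apply/frame_stabP; rewrite !fixc //; split=> //; apply/isom_centP.
have [S HS cS] := odd_poly_factor c.
have e : cay H = 1%:M + (cay H *m S + S) *m Y.
  have : cay H *m (1%:M - H) = 1%:M + H by rewrite /cay mulmxKV.
  rewrite mulmxBr mulmx1 => /eqP; rewrite subr_eq => /eqP {1}->.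
  by rewrite -addrA; congr (_ + _); rewrite mulmxDl -mulmxA -HS addrC.
rewrite e mulmxDr mulmx1 formDl form_image // addr0 //.
Qed.

(** The Cayley transform is a bijection from the span of the odd powers [Y], [Y^3], up to
    [Y^(2n-3)]: surjective by [cayley_param], injective because [(M + 1) H = M - 1] recovers [H]. *)
Lemma card_frame_unip : #|frame_unip| = (#|F| ^ n.-1)%N.
Proof.
have -> : frame_unip = [set cay (odd_poly_mx c) | c : {ffun 'I_n.-1 -> F}].
  apply/setP=> M; apply/idP/imsetP; last by case=> c _ ->; apply: cay_odd_poly_unip.
  case/setIdP=> MS /eqP eM; have [/isom_centP[iM cM] e1 e2] := frame_stabP _ MS.
  have [||p [_ pE]] := cayley_param F2 sY Ym ZY full uZ Znd ue iM _ _ eM.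
  - by apply: unip_skew_commA.
  - apply/row_matrixP=> i; rewrite row_mul; apply: frame_stab_fix => //; exact: row_sub.
  exists [ffun l : 'I_n.-1 => p l.*2.+1] => //; rewrite pE; congr cay.
  rewrite (_ : \sum_(i < m.+1 | odd i) _ = \sum_(l < n.-1) p l.*2.+1 *: Y ^+ l.*2.+1).
    by apply: eq_bigr => l _; rewrite ffunE.
  by rewrite mE (sum_odd_ord (fun i => p i *: Y ^+ i)).
rewrite card_imset ?card_ffun ?card_ord // => c c' e.
have h : odd_poly_mx c = odd_poly_mx c'.
  have key d : cay (odd_poly_mx d) *m (1%:M - odd_poly_mx d) = 1%:M + odd_poly_mx d.
    by rewrite /cay mulmxKV.
  set M := cay (odd_poly_mx c) in e; have k1 := key c; have k2 := key c'.
  rewrite -/M in k1; rewrite -e in k2.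
  have MU : M + 1%:M \in unitmx.
    have h2 : (M + 1%:M) *m (2%:R^-1 *: (1%:M - odd_poly_mx c)) = 1%:M.
      rewrite -scalemxAr mulmxDl mul1mx k1 addrACA subrr addr0 -mulr2n -scaler_nat scalerA.
      by rewrite mulVf // scale1r.
    by have [] := mulmx1_unit h2.
  apply/eqP; rewrite -subr_eq0; apply/eqP; apply: (can_inj (mulKmx MU)).
  rewrite mulmx0 mulmxDl mul1mx mulmxBr.
  have MH d : M *m (1%:M - odd_poly_mx d) = 1%:M + odd_poly_mx d ->
      M *m odd_poly_mx d = M - (1%:M + odd_poly_mx d).
    by move=> <-; rewrite mulmxBr mulmx1 opprB addrC subrK.
  rewrite (MH c k1) (MH c' k2); move: (M) (odd_poly_mx c) (odd_poly_mx c') => M' H H'.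
  by apply/matrixP=> i j; rewrite !mxE; ring.
have [al al0 eal] := uYm.
(* The differences of coefficients, spread over the odd indices, form a vanishing relation among the
   [u Y^i]. *)
pose p i := if odd i then (if insub i./2 is Some l then c l - c' l else 0) else 0.
have pE (l : 'I_n.-1) : p l.*2.+1 = c l - c' l.
  by rewrite /p /= odd_double /= uphalf_double valK.
have s0 : \sum_(i < m.+1) p i *: (u *m Y ^+ i) = 0.
  have -> : \sum_(i < m.+1) p i *: (u *m Y ^+ i) = \sum_(i < m.+1 | odd i) p i *: (u *m Y ^+ i).
    by rewrite [RHS]big_mkcond; apply: eq_bigr => i _; rewrite /p; case: odd => //; rewrite scale0r.
  rewrite mE (sum_odd_ord (fun i => p i *: (u *m Y ^+ i))).
  transitivity (u *m (odd_poly_mx c - odd_poly_mx c')); last by rewrite h subrr mulmx0.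
  rewrite -sumrB mulmx_sumr; apply: eq_bigr => l _.
  by rewrite pE -scalerBl -scalemxAr.
have uYm0 : u *m Y ^+ m != 0 by rewrite eal scaler_eq0 negb_or al0.
apply/ffunP=> l; apply/eqP; rewrite -subr_eq0 -pE; apply/eqP.
apply: (krylov_inj Ym uYm0 (leqnn _) s0).
by move: (ltn_ord l); move: (nat_of_ord l) n1; clear; lia.
Qed.

(** The components along [r] are free. In the plane the first vector is a point of the conic, and
    the second is then determined up to sign. *)
Lemma card_frame_orbit : #|frame_orbit| = (#|F| ^ 2 * (2 * #|conic (b / a)|))%N.
Proof.
pose c := b / a; have ca : b = a * c by rewrite /c mulrC divfK.
have c0 : c != 0 by rewrite mulf_neq0 ?invr_eq0.
pose D := setX [set: F * F] (setX (conic c) [set: bool]).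
pose f (t : (F * F) * ((F * F) * bool)) : 'rV[F]_N * 'rV[F]_N :=
  let: ((p1, p2), ((xx, zz), e)) := t in
  (p1 *: r + xx *: v1 + zz *: v2,
   p2 *: r + (- ((-1) ^+ e * (c * zz))) *: v1 + ((-1) ^+ e * xx) *: v2).
have gram p q s p' q' s' : form (p *: r + q *: v1 + s *: v2) (p' *: r + q' *: v1 + s' *: v2)
    = a * (q * q' + c * (s * s')).
  rewrite !formS rr rv1 rv2 v1r v2r v11 v12 v21 v22 ca; ring.
have -> : frame_orbit = f @: D.
  apply/setP=> -[y1 y2]; apply/idP/imsetP; last first.
    case=> -[[p1 p2] [[xx zz] e]]; rewrite !inE /= => /andP[/eqP cn _] [-> ->].
    have ee : (-1) ^+ e * (-1) ^+ e = 1 :> F by rewrite -expr2 sqrr_sign.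
    rewrite /= !mulmxDl -!scalemxAl rX v1X v2X !scaler0 !addr0 eqxx /= !gram.
    have -> : xx * xx + c * (zz * zz) = 1 by rewrite -cn; ring.
    have -> : - ((-1) ^+ e * (c * zz)) * - ((-1) ^+ e * (c * zz)) +
        c * ((-1) ^+ e * xx * ((-1) ^+ e * xx)) =
        ((-1) ^+ e * (-1) ^+ e) * c * (xx ^+ 2 + c * zz ^+ 2) by ring.
    have -> : xx * - ((-1) ^+ e * (c * zz)) + c * (zz * ((-1) ^+ e * xx)) = 0 by ring.
    by rewrite ee cn !mulr1 mul1r -ca mulr0 !eqxx.
  rewrite inE /= => /and5P[/eqP y1X /eqP y2X /eqP y11 /eqP y22 /eqP y12].
  have [p1 [xx [zz e1]]] := ker_dec y1X; have [p2 [x2 [z2 e2]]] := ker_dec y2X.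
  have g11 : xx ^+ 2 + c * zz ^+ 2 = 1.
    apply: (mulfI a0); rewrite mulr1 -[RHS]y11 e1 gram; ring.
  have g22 : x2 ^+ 2 + c * z2 ^+ 2 = c.
    apply: (mulfI a0); rewrite -ca -[RHS]y22 e2 gram; ring.
  have g12 : xx * x2 + c * (zz * z2) = 0.
    by apply: (mulfI a0); rewrite mulr0 -[RHS]y12 e1 e2 gram.
  (* The determinant of the plane isometry; its sign is the boolean parameter of [f]. *)
  pose de := xx * z2 - zz * x2.
  have dx : de * xx = z2.
    have -> : de * xx = z2 * (xx ^+ 2 + c * zz ^+ 2) - zz * (xx * x2 + c * (zz * z2)).
      by rewrite /de; ring.
    by rewrite g11 g12; ring.
  have dz : - (de * (c * zz)) = x2.
    have -> : - (de * (c * zz)) = x2 * (xx ^+ 2 + c * zz ^+ 2) - xx * (xx * x2 + c * (zz * z2)).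
      by rewrite /de; ring.
    by rewrite g11 g12; ring.
  have : de ^+ 2 == 1.
    rewrite -(inj_eq (mulIf c0)) mul1r -[X in _ == X]g22 -{1}dx -{1}dz.
    have -> : (- (de * (c * zz))) ^+ 2 + c * (de * xx) ^+ 2 = de ^+ 2 * c * (xx ^+ 2 + c * zz ^+ 2).
      by ring.
    by rewrite g11 mulr1.
  rewrite sqrf_eq1 => /orP ed.
  have [e eE] : exists e : bool, de = (-1) ^+ e.
    by case: ed => /eqP ->; [exists false; rewrite expr0 | exists true; rewrite expr1].
  exists ((p1, p2), ((xx, zz), e)); first by rewrite !inE /= g11 eqxx.
  by rewrite /f -eE dz dx -e1 -e2.
rewrite card_in_imset; first by rewrite !cardsX !cardsT card_prod card_bool mulnn (mulnC _ 2).
move=> [[p1 p2] [[xx zz] e]] [[p1' p2'] [[xx' zz'] e']]; rewrite !inE /= => /andP[/eqP cn _] _ [h1 h2].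
have dif p q s p' q' s' : p *: r + q *: v1 + s *: v2 = p' *: r + q' *: v1 + s' *: v2 ->
    [/\ p = p', q = q' & s = s'].
  move/eqP; rewrite -subr_eq0 => /eqP h.
  have [|d1 d2 d3] := @frame_inj (p - p') (q - q') (s - s').
    by rewrite -[RHS]h; apply/rowP=> i; rewrite !mxE; ring.
  by split; apply/eqP; rewrite -subr_eq0 ?d1 ?d2 ?d3.
have [-> ex ez] := dif _ _ _ _ _ _ h1; have [-> eq1 eq2] := dif _ _ _ _ _ _ h2.
rewrite ex ez in cn eq1 eq2 *; congr (_, (_, _)).
have s2 (t t' : bool) : (-1) ^+ t = (-1) ^+ t' :> F -> t = t'.
  case: t t' => [] [] //= /eqP; rewrite expr0 expr1.
    by rewrite eq_sym -addr_eq0 -[1 + 1]/(2%:R) (negPf F2).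
  by rewrite -addr_eq0 -[1 + 1]/(2%:R) (negPf F2).
apply: s2; have [x0|x0] := eqVneq xx' 0; last exact: (mulIf x0).
have z0 : c * zz' != 0.
  rewrite mulf_neq0 //; apply: contra_eq_neq cn => ->.
  by rewrite x0 !expr0n mulr0 addr0 eq_sym oner_eq0.
by apply: (mulIf z0); apply: oppr_inj.
Qed.

Lemma card_frame_cent : #|'C_(SO F n)[x]| = (2 * #|F| ^ n.+1 * #|conic (b / a)|)%N.
Proof.
have e := card_isom_cent; rewrite card_frame_fibers card_frame_orbit card_frame_stab card_frame_unip in e.
apply/eqP; rewrite -(eqn_pmul2l (isT : (0 < 2)%N)) -e; apply/eqP.
have -> : n.+1 = (2 + n.-1)%N by move: n1; clear; lia.
rewrite expnD; move: (#|F| ^ 2)%N (#|F| ^ n.-1)%N #|conic _|; clear; lia.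
Qed.

Lemma frame_one_point : ~~ [exists t : F, t ^+ 2 == - (b / a)] -> one_point A r.
Proof.
move=> ns; split=> //; first exact: fixX.
move=> v vv vA; have vX : v *m X = 0 by rewrite mulmxBr mulmx1 vA subrr.
have [p [q [s e]]] := ker_dec vX; have : a * q ^+ 2 + b * s ^+ 2 = 0.
  by rewrite -vv e !formS rr rv1 rv2 v1r v2r v11 v12 v21 v22; ring.
have [s0|s0] := eqVneq s 0.
  rewrite s0 expr0n mulr0 addr0 => /eqP; rewrite mulf_eq0 (negPf a0) sqrf_eq0 /= => /eqP q0.
  by rewrite e q0 s0 !scale0r !addr0 scalemx_sub.
move=> e0; case/negP: ns; apply/existsP; exists (q / s); apply/eqP.
apply: (mulfI a0); apply: (mulIf (_ : s ^+ 2 != 0)); first by rewrite expf_neq0.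
have -> : a * (q / s) ^+ 2 * s ^+ 2 = a * q ^+ 2 by field.
have -> : a * - (b / a) * s ^+ 2 = - (b * s ^+ 2) by field.
by apply/eqP; rewrite -addr_eq0 e0.
Qed.

(** Besides [r], the vector [t v1 + v2] is fixed and singular. *)
Lemma frame_not_one_point t r' : t ^+ 2 = - (b / a) -> ~ one_point A r'.
Proof.
move=> et [_ _ _ ur'].
have /sub_rVP[c1 e1] : (r <= r')%MS by apply: ur' => //; apply: fixX.
pose y := t *: v1 + v2.
have /sub_rVP[c2 e2] : (y <= r')%MS.
  apply: ur'; last by apply: fixX; rewrite mulmxDl -scalemxAl v1X v2X scaler0 addr0.
  rewrite /y !formS v11 v12 v21 v22 !mulr0 addr0 add0r mulrA -expr2 et.
  by field.
have [] := @frame_inj (- c2) (c1 * t) c1.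
  rewrite -addrA -scalerA -scalerDr -/y e2 e1 !scalerA mulNr scaleNr mulrC addNr //.
by move=> _ _ c10; case/eqP: r0; rewrite e1 c10 scale0r.
Qed.

End Frame.

Lemma type3_frame : type3 x -> exists r v1 v2 u a b,
  [/\ [/\ r *m X = 0, v1 *m X = 0 & v2 *m X = 0],
      [/\ form r r = 0, form r v1 = 0, form r v2 = 0 & form v1 v2 = 0],
      [/\ form v1 v1 = a, form v2 v2 = b, r != 0, a != 0 & b != 0],
      forall y, y *m X = 0 -> exists p q s, y = p *: r + q *: v1 + s *: v2 &
      [/\ form u v1 = 0, form u v2 = 0 & u *m X ^+ m = r]].
Proof.
move=> t3; have [nz Xm rX] := t3.
have mE : m.+1 = (n.*2).-1 by move: n1; clear; lia.
have [u hu] : exists u : 'rV_N, u *m X ^+ m != 0.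
  have : (0 < \rank (X ^+ m))%N by rewrite lt0n mxrank_eq0.
  by case/nonzero_row=> y /submxP[u ->] h; exists u.
set r := u *m X ^+ m in hu.
have rX0 : r *m X = 0 by rewrite -mulmxA mulmxE -exprSr mE Xm mulmx0.
have m0 : (0 < m)%N by move: n1; clear; lia.
have rim : (r <= X)%MS by rewrite /r -(prednK m0) exprSr -mulmxE mulmxA submxMl.
have perpX := perp_pow iA 1; rewrite expr1 in perpX.
have rK (y : 'rV_N) : y *m X = 0 -> form r y = 0.
  move=> yX; rewrite formC; apply: (perpP _ _ _ _ rim).
  by rewrite perpX; apply/sub_kermxP.
have rkK : \rank (kermx X) = 3%N by rewrite mxrank_ker rX; move: n1; clear; lia.
have rKm : (r <= kermx X)%MS by apply/sub_kermxP.
pose V := (kermx X :\: r)%MS.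
have VK : (V <= kermx X)%MS := diffmxSl _ _.
have Vr : (V :&: r)%MS = 0 := capmx_diff _ _.
have rkV : \rank V = 2%N.
  by have := mxrank_cap_compl (kermx X) r; rewrite (capmx_idPr rKm) rank_rV hu rkK add1n => -[].
have eVr : (V + r :=: kermx X)%MS.
  apply/eqmxP; have s : (V + r <= kermx X)%MS by rewrite addsmx_sub VK.
  rewrite -(mxrank_leqif_eq s).
  have := mxrank_sum_cap V r; rewrite Vr mxrank0 addn0 => ->.
  by rewrite rkV rank_rV hu rkK.
(* A vector of [V] orthogonal to [V] is orthogonal to the whole kernel of [X], hence lies in the
   image of [X]; kernel and image meet in the line of [r], which avoids [V]. *)
have Vnd (z : 'rV_N) : (z <= V)%MS -> (forall z', (z' <= V)%MS -> form z z' = 0) -> z = 0.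
  move=> zV zp; have zX : (z <= X)%MS.
    rewrite -(perpK X); apply/perpP=> y; rewrite perpX => yK.
    have : (y <= V + r)%MS by rewrite eVr.
    case/sub_addsmxP=> -[c d] /= ->; rewrite formDr zp ?submxMl // add0r.
    rewrite formC; have /sub_rVP[l ->] : (d *m r <= r)%MS := submxMl _ _.
    rewrite formZl rK ?mulr0 //; apply/sub_kermxP; exact: submx_trans zV VK.
  have capr : (kermx X :&: X :=: r)%MS.
    apply/eqmx_sym/eqmxP; have s : (r <= kermx X :&: X)%MS by rewrite sub_capmx rKm.
    rewrite -(mxrank_leqif_eq s) eqn_leq mxrankS //= rank_rV hu.
    exact: type3_rank_cap n1 t3.
  have : (z <= V :&: r)%MS by rewrite sub_capmx zV -capr sub_capmx zX (submx_trans zV VK).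
  by rewrite Vr submx0 => /eqP.
have [v1 v1V a0] : exists2 v1 : 'rV_N, (v1 <= V)%MS & form v1 v1 != 0.
  case: (pickP [pred w : 'rV[F]_N | (w <= V)%MS && (form w w != 0)]) => [w /andP[]|h].
    by exists w.
  have iV : isot V.
    apply: singular_isot => // w wV; apply/eqP; have := h w; rewrite /= wV /=.
    by move/negbT; rewrite negbK.
  have [|y yV] := @nonzero_row _ _ _ V; first by rewrite rkV.
  by case/eqP; apply: (Vnd y yV) => z zV; move/isotP: iV; apply.
have [|v2 v2V v20] := @nonzero_row _ _ _ (V :&: perp v1)%MS.
  have := rank_cap_perp V v1; rewrite rkV; have := rank_leq_row v1.
  by move: (\rank _) (\rank _); clear; lia.
have v2V' := submx_trans v2V (capmxSl _ _).
have v21 : form v2 v1 = 0 := perpP _ _ (submx_trans v2V (capmxSr _ _)) _ (submx_refl _).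
have v1X : v1 *m X = 0 by apply/sub_kermxP; apply: submx_trans v1V VK.
have v2X : v2 *m X = 0 by apply/sub_kermxP; apply: submx_trans v2V' VK.
have v2n : ~~ (v2 <= v1)%MS.
  apply/negP=> /sub_rVP[c e]; move/eqP: v21; rewrite e formZl mulf_eq0 (negPf a0) orbF => /eqP c0.
  by move: v20; rewrite e c0 scale0r eqxx.
have v1nz : v1 != 0 by apply: contraNneq a0 => ->; rewrite form0l.
have eV : (v1 + v2 :=: V)%MS.
  apply/eqmxP; have s : (v1 + v2 <= V)%MS by rewrite addsmx_sub v1V.
  by rewrite -(mxrank_leqif_eq s) rank_add_row // rank_rV v1nz rkV.
have VP z : (z <= V)%MS -> exists q s, z = q *: v1 + s *: v2.
  rewrite -eV; case/sub_addsmxP=> -[c d] /= ->; exists (c 0 0), (d 0 0).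
  by rewrite {1}[c]mx11_scalar {1}[d]mx11_scalar !mul_scalar_mx.
have b0 : form v2 v2 != 0.
  apply: contra v20 => /eqP b0; apply/eqP; apply: Vnd => // z /VP[q [s ->]].
  by rewrite !formS v21 b0 !mulr0 addr0.
(* Projecting [u] off [v1] and [v2] does not change [u X^m], as both are killed by [X]. *)
pose u' := u - (form u v1 / form v1 v1) *: v1 - (form u v2 / form v2 v2) *: v2.
exists r, v1, v2, u', (form v1 v1), (form v2 v2); split=> //.
- by rewrite !rK // formC.
- move=> y yX; have yK : (y <= kermx X)%MS by apply/sub_kermxP.
  have : (y <= V + r)%MS by rewrite eVr.
  case/sub_addsmxP=> -[c d] /= ->; have [q [s ->]] := VP _ (submxMl c V).
  have /sub_rVP[p ->] : (d *m r <= r)%MS := submxMl _ _.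
  by exists p, q, s; rewrite addrC addrA.
split.
- by rewrite !formS v21 mulr0 subr0 divfK // subrr.
- by rewrite !formS (formC v1 v2) v21 mulr0 subr0 divfK // subrr.
have kill (v : 'rV_N) : v *m X = 0 -> v *m X ^+ m = 0.
  by move=> vX; rewrite -(prednK m0) exprS -mulmxE mulmxA vX mul0mx.
by rewrite !mulmxBl -!scalemxAl (kill v1) // (kill v2) // !scaler0 !subr0.
Qed.

(** Both sides say that [-b/a] is not a square: then the plane is anisotropic and the conic has
    [q + 1] points; otherwise it has [q - 1]. *)
Lemma type3_card_cent : type3 x ->
  ((exists r, one_point A r) <-> #|'C_(SO F n)[x]| = (2 * #|F| ^ n.+1 * #|F|.+1)%N).
Proof.
move=> t3; have [r [v1 [v2 [u [a [b [[h1 h2 h3] [h4 h5 h6 h7] [h8 h9 h10 h11 h12] h13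
  [h14 h15 h16]]]]]]]] := type3_frame t3.
have Xm : X ^+ m.+1 = 0.
  case: t3 => _ e _; have -> : m.+1 = (n.*2).-1 by move: n1; clear; lia.
  exact: e.
have c0 : b / a != 0 by rewrite mulf_neq0 ?invr_eq0.
rewrite (card_frame_cent h1 h2 h3 h4 h5 h6 h8 h9 h7 h10 h11 h12 h13 h14 h15 h16 Xm) (card_conic F2 c0).
case: ifP => [/existsP[t /eqP et]|ns].
  split=> [[r' pr]|/eqP].
    by case: (frame_not_one_point h1 h2 h3 h4 h5 h6 h8 h9 h7 h10 h11 h12 et pr).
  rewrite eqn_pmul2l ?muln_gt0 ?expn_gt0 ?(ltnW (finRing_gt1 _)) //.
  by case: #|F| => // k /eqP; clear; lia.
by split=> // _; exists r; apply: (@frame_one_point r v1 v2 a b) => //; rewrite ns.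
Qed.

End CentraliserOrder.

(** * Dimension of the centraliser *)

Section PolynomialFunctions.
Variables (K : fieldType) (M : nat).
Implicit Types (f g : 'rV[K]_M -> K) (Z : 'rV[K]_M -> Prop).

Definition polyfun f : Prop := exists p : {mpoly K[M]}, forall v, f v = meval (v 0) p.

Lemma polyfun_eq f g : f =1 g -> polyfun f -> polyfun g.
Proof. by move=> e [p h]; exists p => v; rewrite -e. Qed.

Lemma polyfunC c : polyfun (fun=> c).
Proof. by exists (mpolyC M c) => v; rewrite mevalC. Qed.

Lemma polyfun_coord j : polyfun (fun v => v 0 j).
Proof. by exists (@mpolyX M K (mnm1 j)) => v; rewrite mevalXU. Qed.

Lemma polyfunD f g : polyfun f -> polyfun g -> polyfun (fun v => f v + g v).
Proof. by move=> [p hp] [q hq]; exists (p + q) => v; rewrite mevalD hp hq. Qed.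

Lemma polyfunM f g : polyfun f -> polyfun g -> polyfun (fun v => f v * g v).
Proof. by move=> [p hp] [q hq]; exists (p * q) => v; rewrite mevalM hp hq. Qed.

Lemma polyfunN f : polyfun f -> polyfun (fun v => - f v).
Proof. by move=> [p hp]; exists (- p) => v; rewrite mevalN hp. Qed.

Lemma polyfun_sum (I : Type) (r : seq I) (P : pred I) (E : I -> 'rV[K]_M -> K) :
  (forall i, polyfun (E i)) -> polyfun (fun v => \sum_(i <- r | P i) E i v).
Proof.
move=> h; elim: r => [|i r IH].
  by apply: polyfun_eq (polyfunC 0) => v; rewrite big_nil.
have [Pi|Pi] := boolP (P i).
  by apply: polyfun_eq (polyfunD (h i) IH) => v; rewrite big_cons Pi.
by apply: polyfun_eq IH => v; rewrite big_cons (negPf Pi).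
Qed.

Lemma polyfun_prod (I : Type) (r : seq I) (P : pred I) (E : I -> 'rV[K]_M -> K) :
  (forall i, polyfun (E i)) -> polyfun (fun v => \prod_(i <- r | P i) E i v).
Proof.
move=> h; elim: r => [|i r IH].
  by apply: polyfun_eq (polyfunC 1) => v; rewrite big_nil.
have [Pi|Pi] := boolP (P i).
  by apply: polyfun_eq (polyfunM (h i) IH) => v; rewrite big_cons Pi.
by apply: polyfun_eq IH => v; rewrite big_cons (negPf Pi).
Qed.

Definition polyfun_mx m n (G : 'rV[K]_M -> 'M[K]_(m, n)) : Prop :=
  forall i j, polyfun (fun v => G v i j).

Lemma polyfun_mxC m n (B : 'M[K]_(m, n)) : polyfun_mx (fun=> B).
Proof. by move=> i j; apply: polyfunC. Qed.

Lemma polyfun_mxD m n (G H : 'rV[K]_M -> 'M[K]_(m, n)) :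
  polyfun_mx G -> polyfun_mx H -> polyfun_mx (fun v => G v + H v).
Proof. by move=> hG hH i j; apply: polyfun_eq (polyfunD (hG i j) (hH i j)) => v; rewrite mxE. Qed.

Lemma polyfun_mxN m n (G : 'rV[K]_M -> 'M[K]_(m, n)) :
  polyfun_mx G -> polyfun_mx (fun v => - G v).
Proof. by move=> hG i j; apply: polyfun_eq (polyfunN (hG i j)) => v; rewrite mxE. Qed.

Lemma polyfun_mxM m n p (G : 'rV[K]_M -> 'M[K]_(m, n)) (H : 'rV[K]_M -> 'M[K]_(n, p)) :
  polyfun_mx G -> polyfun_mx H -> polyfun_mx (fun v => G v *m H v).
Proof.
move=> hG hH i j; apply: polyfun_eq (polyfun_sum _ _ (fun k => polyfunM (hG i k) (hH k j))) => v.
by rewrite mxE.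
Qed.

Lemma polyfun_mxT m n (G : 'rV[K]_M -> 'M[K]_(m, n)) :
  polyfun_mx G -> polyfun_mx (fun v => (G v)^T).
Proof. by move=> hG i j; apply: polyfun_eq (hG j i) => v; rewrite mxE. Qed.

Lemma polyfun_mxZ m n f (G : 'rV[K]_M -> 'M[K]_(m, n)) :
  polyfun f -> polyfun_mx G -> polyfun_mx (fun v => f v *: G v).
Proof. by move=> hf hG i j; apply: polyfun_eq (polyfunM hf (hG i j)) => v; rewrite mxE. Qed.

Lemma polyfun_mxX m (G : 'rV[K]_M -> 'M[K]_m) k :
  polyfun_mx G -> polyfun_mx (fun v => G v ^+ k).
Proof.
move=> hG; elim: k => [|k IH] i j; first exact: polyfunC.
by apply: polyfun_eq (polyfun_mxM hG IH i j) => v; rewrite exprS.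
Qed.

Lemma polyfun_mx_sum m n (I : Type) (r : seq I) (P : pred I) (E : I -> 'rV[K]_M -> 'M[K]_(m, n)) :
  (forall i, polyfun_mx (E i)) -> polyfun_mx (fun v => \sum_(i <- r | P i) E i v).
Proof.
by move=> h i j; apply: polyfun_eq (polyfun_sum r P (fun l => h l i j)) => v; rewrite summxE.
Qed.

Lemma polyfun_det m (G : 'rV[K]_M -> 'M[K]_m) : polyfun_mx G -> polyfun (fun v => \det (G v)).
Proof.
move=> hG; apply: polyfun_sum => s; apply: polyfunM; first exact: polyfunC.
by apply: polyfun_prod => i; apply: hG.
Qed.

Lemma polyfun_adj m (G : 'rV[K]_M -> 'M[K]_m) : polyfun_mx G -> polyfun_mx (fun v => \adj (G v)).
Proof.
move=> hG i j; have h : polyfun (fun v => cofactor (G v) j i).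
  apply: polyfunM; first exact: polyfunC.
  apply: polyfun_det => k l; apply: polyfun_eq (hG (lift j k) (lift i l)) => v.
  by rewrite !mxE.
by apply: polyfun_eq h => v; rewrite mxE.
Qed.

Definition zclosure Z : 'rV[K]_M -> Prop := fun v =>
  forall f, polyfun f -> (forall w, Z w -> f w = 0) -> f v = 0.

Lemma sub_zclosure Z : zsub Z (zclosure Z).
Proof. by move=> v Zv f _; apply. Qed.

Lemma zclosure_closed Z : zclosed (zclosure Z).
Proof.
exists (fun p => forall w, Z w -> meval (w 0) p = 0) => v; split.
  by move=> h p hp; apply: (h (fun v => meval (v 0) p)) => //; exists p.
by move=> h f [p fp] hf; rewrite fp; apply: h => w Zw; rewrite -fp; apply: hf.
Qed.

Lemma zclosureS Z Z' : zsub Z Z' -> zsub (zclosure Z) (zclosure Z').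
Proof. by move=> h v Zv f pf hf; apply: Zv => // w /h; apply: hf. Qed.

Lemma zclosed_zero f : polyfun f -> zclosed (fun v => f v = 0).
Proof.
case=> p fp; exists (fun q => q = p) => v; split; first by move=> fv q ->; rewrite -fp.
by move=> h; rewrite fp; apply: h.
Qed.

Lemma zclosed_separate Z v : zclosed Z -> ~ Z v ->
  exists2 f, polyfun f & (forall w, Z w -> f w = 0) /\ f v <> 0.
Proof.
case=> I hI nZ; apply: NNPP => h; apply: nZ; apply/hI => p Ip; apply: NNPP => pv.
apply: h; exists (fun w => meval (w 0) p); first by exists p.
by split=> // w /hI; apply.
Qed.

(** A rational curve with common denominator [d]. *)
Definition curve_pt (P : 'I_M -> {poly K}) (d : {poly K}) (t : K) : 'rV[K]_M :=
  \row_j ((P j).[t] / d.[t]).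

Lemma polyfun_curve f P d : polyfun f -> exists k (Q : {poly K}),
  forall t, d.[t] != 0 -> f (curve_pt P d t) * d.[t] ^+ k = Q.[t].
Proof.
case=> p fp; suff [k [Q h]] : exists k (Q : {poly K}), forall t, d.[t] != 0 ->
    meval (curve_pt P d t 0) p * d.[t] ^+ k = Q.[t].
  by exists k, Q => t dt; rewrite fp h.
elim/mpolyind: p {fp} => [|c m p _ _ [k [Q h]]].
  by exists 0%N, 0 => t _; rewrite meval0 mul0r horner0.
exists (k + \sum_i fun_of_multinom m i)%N.
exists (c *: \prod_i P i ^+ (fun_of_multinom m i) * d ^+ k + Q * d ^+ (\sum_i fun_of_multinom m i)).
move=> t dt; rewrite mevalD mevalZ mevalX hornerD !hornerM !horner_exp hornerZ.
rewrite horner_prod -h // mulrDl !exprD; congr (_ + _); last by rewrite mulrA.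
rewrite expr_sum -!mulrA; congr (_ * _); rewrite [d.[t] ^+ k * _]mulrC mulrA; congr (_ * _).
rewrite -big_split; apply: eq_bigr => i _ /=; rewrite mxE horner_exp -exprMn divfK //.
Qed.

End PolynomialFunctions.

(** * Irreducible closures *)

Section Irreducible.
Variables (K : closedFieldType) (M : nat).

(** Any two points of [Z] lie on a rational curve inside [Z]. Equations separating the two closed
    sets restrict to nonzero polynomials on such a curve, and these have a common nonroot. *)
Lemma zclosure_irreducible (Z : 'rV[K]_M -> Prop) :
  (exists v, Z v) ->
  (forall v w, Z v -> Z w -> exists P d, [/\ d.[0] != 0, d.[1] != 0,
    v = curve_pt P d 0, w = curve_pt P d 1 & forall t, d.[t] != 0 -> Z (curve_pt P d t)]) ->
  zirreducible (zclosure Z).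
Proof.
move=> [v0 Zv0] join; split; first by exists v0; apply: sub_zclosure.
move=> Z1 Z2 c1 c2 cov; apply: NNPP => /not_or_and[n1 n2].
have sep Z' : zclosed Z' -> ~ zsub (zclosure Z) Z' ->
    exists2 f, polyfun f & (forall w, Z' w -> f w = 0) /\ exists2 w, Z w & f w <> 0.
  move=> cZ' nsub; have [v hv] := not_all_ex_not _ _ nsub.
  have [cv nv] := imply_to_and _ _ hv; have [f pf [fZ fv]] := zclosed_separate cZ' nv.
  exists f => //; split=> //; apply: NNPP => h; apply: fv; apply: cv => // w Zw.
  by apply: NNPP => fw; apply: h; exists w.
have [f pf [fZ1 [w1 Zw1 fw1]]] := sep _ c1 n1; have [g pg [gZ2 [w2 Zw2 gw2]]] := sep _ c2 n2.
have [P [d [d0 d1 e1 e2 on]]] := join _ _ Zw1 Zw2.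
have [k1 [Q1 h1]] := polyfun_curve P d pf; have [k2 [Q2 h2]] := polyfun_curve P d pg.
have nz : Q1 * Q2 * d != 0.
  rewrite !mulf_neq0 //.
  - apply: contra_not_neq fw1 => Q0; have := h1 0 d0; rewrite -e1 Q0 horner0 => /eqP.
    by rewrite mulf_eq0 expf_eq0 (negPf d0) andbF orbF => /eqP.
  - apply: contra_not_neq gw2 => Q0; have := h2 1 d1; rewrite -e2 Q0 horner0 => /eqP.
    by rewrite mulf_eq0 expf_eq0 (negPf d1) andbF orbF => /eqP.
  - by apply: contraNneq d0 => ->; rewrite horner0.
have [t] := closed_nonrootP _ nz; rewrite /root !hornerM !mulf_eq0 !negb_or => /andP[/andP[q1 q2] dt].
have [z1|z2] := cov _ (sub_zclosure (on t dt)).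
  by case/eqP: q1; rewrite -h1 // fZ1 // mul0r.
by case/eqP: q2; rewrite -h2 // gZ2 // mul0r.
Qed.

Lemma zirreducible_mul (Z : 'rV[K]_M -> Prop) f g : zirreducible Z -> polyfun f -> polyfun g ->
  (forall v, Z v -> f v * g v = 0) -> (forall v, Z v -> f v = 0) \/ (forall v, Z v -> g v = 0).
Proof.
move=> [_ irr] pf pg h; apply: irr (zclosed_zero pf) (zclosed_zero pg) _ => v /h/eqP.
by rewrite mulf_eq0 => /orP[] /eqP; [left | right].
Qed.

End Irreducible.

Section CayleyChain.
Variables (K : closedFieldType) (N : nat).
Hypothesis K2 : 2%:R != 0 :> K.
Variables (B : 'M[K]_N) (d : nat) (G : 'M[K]_(d, N * N)).
Hypothesis G_free : row_free G.
Hypothesis G_skew : forall i, skew (vec_mx (row i G) : 'M[K]_N).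
Hypothesis G_comm : forall i, B *m vec_mx (row i G) = vec_mx (row i G) *m B.

Lemma horner_eval_XM (t c : K) : horner_eval t ('X * c%:P) = t * c.
Proof. by rewrite /horner_eval hornerM hornerX hornerC. Qed.

Definition comb (c : 'rV[K]_d) : 'M[K]_N := vec_mx (c *m G).

Lemma combE c : comb c = \sum_i c 0 i *: vec_mx (row i G).
Proof. by rewrite /comb mulmx_sum_row linear_sum; apply: eq_bigr => i _; rewrite linearZ. Qed.

Lemma comb_skew c : skew (comb c).
Proof.
move=> y z; rewrite combE !mulmx_sumr.
rewrite (big_morph (fun y => form y z) (fun y z' => formDl y z' z) (form0l z)).
rewrite (big_morph (form y) (formDr y) (form0r y)) -sumrN; apply: eq_bigr => l _.
by rewrite -!scalemxAr formZl formZr G_skew mulrN.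
Qed.

Lemma comb_comm c : B *m comb c = comb c *m B.
Proof.
rewrite combE mulmx_sumr mulmx_suml; apply: eq_bigr => i _.
by rewrite -scalemxAr -scalemxAl G_comm.
Qed.

Definition cayley_img (i : nat) : 'rV[K]_(N * N) -> Prop := fun v => exists c : 'rV[K]_d,
  [/\ forall j : 'I_d, (i <= j)%N -> c 0 j = 0, 1%:M - comb c \in unitmx & v = mxvec (cay (comb c))].

Lemma cayley_img0 i : cayley_img i (mxvec 1%:M).
Proof.
have e : comb 0 = 0 by rewrite /comb mul0mx linear0.
exists 0; rewrite e subr0 unitmx1 /cay addr0 subr0 invmx1 mulmx1; split=> // j _.
by rewrite mxE.
Qed.

Lemma comm_invmx (S T : 'M[K]_N) : S \in unitmx -> T *m S = S *m T -> T *m invmx S = invmx S *m T.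
Proof. by move=> U c; apply: (can_inj (mulKmx U)); rewrite mulKVmx // mulmxA -c mulmxK. Qed.

Lemma cayley_img_sub i v : cayley_img i v -> SO_centraliser B v.
Proof.
case=> c [_ U ->]; rewrite /SO_centraliser mxvecK; split.
  by rewrite is_SOE cay_isometry ?cay_det ?eqxx //; apply: comb_skew.
rewrite /comm_mx /cay; have cB := comb_comm c.
have e1 : B *m (1%:M - comb c) = (1%:M - comb c) *m B by rewrite mulmxBl mulmxBr mul1mx mulmx1 cB.
rewrite -[RHS]mulmxA -(comm_invmx U e1) !mulmxA; congr (_ *m _).
by rewrite mulmxDl mulmxDr mul1mx mulmx1 cB.
Qed.

Lemma polyfun_vec_mx : polyfun_mx (fun v : 'rV[K]_(N * N) => vec_mx v : 'M[K]_N).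
Proof. by move=> i j; apply: polyfun_eq (polyfun_coord K (mxvec_index i j)) => v; rewrite mxE. Qed.

Lemma SO_centraliser_closure Z : zsub Z (SO_centraliser B) -> zsub (zclosure Z) (SO_centraliser B).
Proof.
move=> sub v cv; have pV := polyfun_vec_mx.
have zero m p (H : 'rV[K]_(N * N) -> 'M[K]_(m, p)) : polyfun_mx H ->
    (forall w, Z w -> H w = 0) -> H v = 0.
  move=> pH hH; apply/matrixP=> i j; rewrite [RHS]mxE.
  by apply: (cv (fun w => H w i j)) => // w /hH->; rewrite mxE.
have h1 : vec_mx v *m antidiag K N *m (vec_mx v)^T - antidiag K N = 0.
  apply: (zero _ _ (fun w => vec_mx w *m antidiag K N *m (vec_mx w)^T - antidiag K N)).
    apply: polyfun_mxD; last exact: polyfun_mxC.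
    apply: polyfun_mxM; last exact: polyfun_mxT pV.
    by apply: polyfun_mxM pV _; apply: polyfun_mxC.
  by move=> w /sub[/andP[/eqP e _] _]; rewrite e subrr.
have h2 : \det (vec_mx v) - 1 = 0.
  apply: (cv (fun w => \det (vec_mx w) - 1)).
    by apply: polyfunD; [apply: polyfun_det | apply: polyfunC].
  by move=> w /sub[/andP[_ /eqP e] _]; rewrite e subrr.
have h3 : B *m vec_mx v - vec_mx v *m B = 0.
  apply: (zero _ _ (fun w => B *m vec_mx w - vec_mx w *m B)).
    apply: polyfun_mxD; first by apply: polyfun_mxM => //; apply: polyfun_mxC.
    by apply: polyfun_mxN; apply: polyfun_mxM => //; apply: polyfun_mxC.
  by move=> w /sub[_ e]; rewrite e subrr.
split; first by apply/andP; split; rewrite -subr_eq0 ?h1 ?h2.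
by apply/eqP; rewrite -subr_eq0 h3.
Qed.

(** The curve is the Cayley image of the segment between the two parameters; writing the inverse by
    the adjugate provides the common denominator. *)
Lemma cayley_join i v w : cayley_img i v -> cayley_img i w -> exists P (e : {poly K}),
  [/\ e.[0] != 0, e.[1] != 0, v = curve_pt P e 0, w = curve_pt P e 1 &
    forall t, e.[t] != 0 -> cayley_img i (curve_pt P e t)].
Proof.
case=> c [c0 cU ->] [c' [c0' cU' ->]].
pose Yp : 'M[{poly K}]_N := map_mx polyC (comb c) + 'X *: map_mx polyC (comb (c' - c)).
pose ct t : 'rV[K]_d := c + t *: (c' - c).
have YpE t : map_mx (horner_eval t) Yp = comb (ct t).
  rewrite /comb mulmxDl -scalemxAl linearD linearZ /=.
  by apply/matrixP=> a b; rewrite !mxE /horner_eval hornerD hornerM !hornerC hornerX.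
pose Dp := 1%:M - Yp.
have DpE t : map_mx (horner_eval t) Dp = 1%:M - comb (ct t).
  by rewrite map_mxB map_mx1 YpE.
pose Mp := (1%:M + Yp) *m \adj Dp.
have eE t : (\det Dp).[t] = \det (1%:M - comb (ct t)).
  by rewrite -DpE det_map_mx.
have MpE t : map_mx (horner_eval t) Mp = (1%:M + comb (ct t)) *m \adj (1%:M - comb (ct t)).
  by rewrite map_mxM map_mx_adj DpE map_mxD map_mx1 YpE.
exists (fun j => mxvec Mp 0 j), (\det Dp).
have ptE t : (\det Dp).[t] != 0 ->
    curve_pt (fun j => mxvec Mp 0 j) (\det Dp) t = mxvec (cay (comb (ct t))).
  move=> dt; have U : 1%:M - comb (ct t) \in unitmx by rewrite unitmxE unitfE -eE.
  rewrite /cay /invmx U -scalemxAr -MpE -eE linearZ /= -map_mxvec.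
  by apply/rowP=> j; rewrite !mxE mulrC.
have ct0 : ct 0 = c by rewrite /ct scale0r addr0.
have ct1 : ct 1 = c' by rewrite /ct scale1r addrC subrK.
have d0 : (\det Dp).[0] != 0 by rewrite eE ct0 -unitfE -unitmxE.
have d1 : (\det Dp).[1] != 0 by rewrite eE ct1 -unitfE -unitmxE.
split=> //; rewrite ?ptE ?ct0 ?ct1 // => t dt; rewrite ptE //; exists (ct t); split=> //.
  by move=> j ij; rewrite !mxE c0 // c0' // subrr mulr0 addr0.
by rewrite unitmxE unitfE -eE.
Qed.

(** Recovers [H], up to a scalar, by a polynomial expression in its Cayley transform. *)
Lemma cayley_adj (H : 'M[K]_N) : 1%:M - H \in unitmx ->
  \adj (cay H + 1%:M) *m (cay H - 1%:M) = \det (cay H + 1%:M) *: H.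
Proof.
move=> U; have h : cay H *m (1%:M - H) = 1%:M + H by rewrite /cay mulmxKV.
have e : (cay H + 1%:M) *m H = cay H - 1%:M.
  move: h; rewrite mulmxBr mulmx1 => /eqP; rewrite subr_eq => /eqP h.
  by rewrite mulmxDl mul1mx; apply/esym/eqP; rewrite subr_eq {1}h addrC [1%:M + _]addrC addrA.
by rewrite -e mulmxA mul_adj_mx mul_scalar_mx.
Qed.

(* The members of the chain are the closures of the Cayley transforms of the
   spans of the first [i] rows of [G]. *)
Lemma cayley_chain : zchain (SO_centraliser B) d.
Proof.
exists (fun i => zclosure (cayley_img i)); split.
  move=> i _; split; first exact: zclosure_closed.
    apply: zclosure_irreducible; first by exists (mxvec 1%:M); apply: cayley_img0.
    exact: cayley_join.
  by apply: SO_centraliser_closure => v; apply: cayley_img_sub.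
move=> i id; split.
  apply: zclosureS => v [c [c0 U ->]]; exists c; split=> // j ij.
  by apply: c0; apply: ltnW.
pose i0 := Ordinal id; pose Y0 := vec_mx (row i0 G) : 'M[K]_N.
have [t t0 tU] : exists2 t, t != 0 & 1%:M - t *: Y0 \in unitmx.
  pose Dp : 'M[{poly K}]_N := 1%:M - 'X *: map_mx polyC Y0.
  have DpE t : map_mx (horner_eval t) Dp = 1%:M - t *: Y0.
    rewrite map_mxB map_mx1; congr (_ - _).
    by apply/matrixP=> a b; rewrite !mxE; apply: horner_eval_XM.
  have nz : \det Dp * 'X != 0.
    rewrite mulf_neq0 ?polyX_eq0 //; apply: contraTneq (oner_neq0 K) => D0.
    have : (\det Dp).[0] = 1 by rewrite -[_.[0]]/(horner_eval 0 _) -det_map_mx DpE scale0r subr0 det1.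
    by rewrite D0 horner0 => <-; rewrite eqxx.
  have [t] := closed_nonrootP _ nz; rewrite /root hornerM hornerX mulf_eq0 negb_or => /andP[dt t0].
  exists t => //; rewrite unitmxE unitfE -DpE det_map_mx; exact: dt.
pose c := t *: delta_mx 0 i0 : 'rV[K]_d.
have cE : comb c = t *: Y0 by rewrite /comb -scalemxAl -rowE linearZ.
move=> sub; have [C GC] := row_freeP G_free.
(* [l] reads the coordinate of [H] along row [i] of [G], so [f] vanishes on the smaller Cayley image
   but not at the transform of [t *: Y0]. *)
pose l (H : 'M[K]_N) : K := (mxvec H *m C) 0 i0.
pose f v := l (\adj (vec_mx v + 1%:M) *m (vec_mx v - 1%:M)).
have pf : polyfun f.
  have pV := polyfun_vec_mx.
  apply: (polyfun_mxM (G := fun v => mxvec _) (H := fun=> C)); last exact: polyfun_mxC.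
  move=> a b; case/mxvec_indexP: b => b1 b2.
  have h : polyfun_mx (fun v : 'rV[K]_(N * N) => \adj (vec_mx v + 1%:M) *m (vec_mx v - 1%:M)).
    apply: polyfun_mxM; last by apply: polyfun_mxD => //; apply: polyfun_mxC.
    by apply: polyfun_adj; apply: polyfun_mxD => //; apply: polyfun_mxC.
  by apply: polyfun_eq (h b1 b2) => v; rewrite [a]ord1 mxvecE.
have fE a : 1%:M - comb a \in unitmx ->
    f (mxvec (cay (comb a))) = \det (cay (comb a) + 1%:M) * a 0 i0.
  move=> U; rewrite /f /l mxvecK cayley_adj // linearZ -scalemxAl mxE; congr (_ * _).
  by rewrite /= /comb vec_mxK -mulmxA GC mulmx1.
have : f (mxvec (cay (comb c))) = 0.
  apply: sub pf _.
    apply: sub_zclosure; exists c; rewrite cE; split=> // j ij.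
    rewrite !mxE eqxx /=; case: eqP => [e|_]; last by rewrite mulr0.
    by move: ij; rewrite e ltnn.
  by move=> _ [a [a0 U ->]]; rewrite fE // a0 ?mulr0.
rewrite fE ?cE // => /eqP; rewrite mulf_eq0 !mxE !eqxx mulr1 (negPf t0) orbF => dz.
have : cay (t *: Y0) + 1%:M \in unitmx.
  have h : (cay (t *: Y0) + 1%:M) *m (2%:R^-1 *: (1%:M - t *: Y0)) = 1%:M.
    rewrite -scalemxAr mulmxDl mul1mx /cay mulmxKV // addrACA subrr addr0 -mulr2n -scaler_nat scalerA.
    by rewrite mulVf // scale1r.
  by have [] := mulmx1_unit h.
by rewrite unitmxE unitfE dz.
Qed.

End CayleyChain.

(** * Upper bound for the length of chains *)

Section ChainBound.
Variables (K : closedFieldType) (M n : nat).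

Lemma polyfunX m (f : 'rV[K]_m -> K) k : polyfun f -> polyfun (fun v => f v ^+ k).
Proof.
move=> pf; elim: k => [|k IH]; first exact: polyfunC.
by apply: polyfun_eq (polyfunM pf IH) => v; rewrite exprS.
Qed.

Definition zindep (C : 'rV[K]_M -> Prop) (I : finType) (Q : I -> 'rV[K]_M -> K) : Prop :=
  forall c : I -> K, (forall v, C v -> \sum_a c a * Q a v = 0) -> forall a, c a = 0.

(** Restricting a relation to [C] kills every term with a positive power of [f], so the terms free
    of [f] vanish; irreducibility of [C'] allows division by [f], and the exponent drops. *)
Lemma zindep_step C C' f (I : finType) Q d : zsub C C' -> zirreducible C' ->
  polyfun f -> (forall v, C v -> f v = 0) -> (exists2 v, C' v & f v <> 0) ->
  (forall a, polyfun (Q a)) -> zindep C (I := I) Q ->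
  zindep C' (fun (p : 'I_d * I) v => f v ^+ p.1 * Q p.2 v).
Proof.
move=> sub irr pf f0 [v0 v0C fv0] pQ ind.
suff key : forall c : nat -> I -> K,
    (forall v, C' v -> \sum_(b < d) \sum_a c b a * (f v ^+ b * Q a v) = 0) ->
    forall b a, (b < d)%N -> c b a = 0.
  move=> c hc [b a]; pose c' b' a' := if insub b' is Some b0 then c (b0, a') else 0.
  have c'E (b' : 'I_d) a' : c' b' a' = c (b', a') by rewrite /c' valK.
  rewrite -c'E; apply: key (ltn_ord b) => v Cv.
  rewrite -[RHS](hc v Cv) pair_bigA; apply: eq_bigr => p _ /=.
  by case: p => b1 a1; rewrite c'E.
elim: d => [|d IH] // c hc.
have hE v : \sum_(b < d.+1) \sum_a c b a * (f v ^+ b * Q a v) =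
    \sum_a c 0%N a * Q a v + f v * \sum_(b < d) \sum_a c b.+1 a * (f v ^+ b * Q a v).
  rewrite big_ord_recl; congr (_ + _).
    by apply: eq_bigr => a _; rewrite expr0 mul1r.
  rewrite mulr_sumr; apply: eq_bigr => b _; rewrite mulr_sumr; apply: eq_bigr => a _.
  by rewrite /= /bump leq0n add1n exprS -!mulrA mulrCA.
have c0 a : c 0%N a = 0.
  by apply: ind a => v Cv; have := hc v (sub v Cv); rewrite hE f0 // mul0r addr0.
pose g v := \sum_(b < d) \sum_a c b.+1 a * (f v ^+ b * Q a v).
have pg : polyfun g.
  apply: polyfun_sum => b; apply: polyfun_sum => a; apply: polyfunM; first exact: polyfunC.
  by apply: polyfunM => //; apply: polyfunX.
have fg v : C' v -> f v * g v = 0.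
  move=> C'v; have := hc v C'v; rewrite hE big1 ?add0r // => a _.
  by rewrite c0 mul0r.
have [h|h] := zirreducible_mul irr pf pg fg; first by move: (h v0 v0C).
by move=> [|b] a ltb //; apply: (IH (fun b => c b.+1)).
Qed.

(* In the application [P f b] means that [f] pulls back along the parametrisation
   to a polynomial of degree at most [b]. *)
Lemma zclosure_chain_indep Z e : zchain Z e -> exists2 C, zsub C Z &
  forall (P : ('rV[K]_M -> K) -> nat -> Prop),
    P (fun=> 1) 0%N ->
    (forall f, polyfun f -> exists b, P f b) ->
    (forall f g h b b', P f b -> P g b' -> (forall v, h v = f v * g v) -> P h (b + b')%N) ->
  exists b, forall d, exists (I : finType) (Q : I -> 'rV[K]_M -> K),
    [/\ #|I| = (d ^ e)%N, zindep C Q &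
      forall a, polyfun (Q a) /\ exists2 k, P (Q a) k & (k <= d * b)%N].
Proof.
move=> [C [hC hS]]; exists (C e); first by have [] := hC e (leqnn e).
move=> P P1 Pf PM.
have PX f b k : P f b -> P (fun v => f v ^+ k) (k * b)%N.
  move=> Pfb; elim: k => [|k IH] //.
  by rewrite mulSn; apply: PM Pfb IH _ => v; rewrite exprS.
(* Each link of the chain contributes a function that vanishes on [C i] but not on [C i.+1], and
   multiplies the family by its [d] first powers. The bound [b] has to be chosen before [d]. *)
suff key i : (i <= e)%N -> exists b, forall d, exists (I : finType) (Q : I -> 'rV[K]_M -> K),
    [/\ #|I| = (d ^ i)%N, zindep (C i) Q &
      forall a, polyfun (Q a) /\ exists2 k, P (Q a) k & (k <= d * b)%N].
  exact: key.
elim: i => [|i IH] ie.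
  exists 0%N => d; exists unit, (fun _ _ => 1); split.
  - by rewrite card_unit.
  - have [_ [[v Cv] _] _] := hC 0%N ie.
    by move=> c /(_ v Cv); rewrite (big_pred1 tt) => [|[]//]; rewrite mulr1 => ? [].
  - by move=> _; split; [apply: polyfunC | exists 0%N].
have [b hb] := IH (ltnW ie); have [sub nsub] := hS i ie.
have [closed _ _] := hC i (ltnW ie); have [_ irr _] := hC i.+1 ie.
have [v hv] := not_all_ex_not _ _ nsub; have [Cv nCv] := imply_to_and _ _ hv.
have [f pf [f0 fv]] := zclosed_separate closed nCv; have [b' Pfb] := Pf f pf.
exists (b' + b)%N => d; have [I [Q [cI ind hQ]]] := hb d.
exists (('I_d * I)%type : finType), (fun (p : 'I_d * I) v => f v ^+ p.1 * Q p.2 v); split.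
- by rewrite card_prod card_ord cI expnS.
- by apply: zindep_step sub irr pf f0 _ _ ind; [exists v | move=> a; have [] := hQ a].
- case=> l a /=; have [pQ [k Pk kb]] := hQ a; split.
    by apply: polyfunM => //; apply: polyfunX.
  exists (l * b' + k)%N; first by apply: PM (PX _ _ l Pfb) Pk _.
  by rewrite mulnDr leq_add // leq_mul2r ltnW ?orbT.
Qed.

(** All monomials involved have exponents below [s], so the coefficient matrix has [s ^ n]
    columns. *)
Lemma ncoef_bound (I : finType) (q : I -> {mpoly K[n]}) s :
  (forall a, (msize (q a) <= s)%N) ->
  (forall c : I -> K, \sum_a c a *: q a = 0 -> forall a, c a = 0) ->
  (#|I| <= s ^ n)%N.
Proof.
move=> sq ind; pose T := {ffun 'I_n -> 'I_s}.
pose mon (t : T) : 'X_{1..n} := [multinom (t i : nat) | i < n].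
pose A : 'M[K]_(#|I|, #|{: T}|) := \matrix_(i, j) (q (enum_val i))@_(mon (enum_val j)).
have -> : (s ^ n)%N = #|{: T}| by rewrite card_ffun !card_ord.
suff /eqP <- : row_free A by apply: rank_leq_col.
rewrite -kermx_eq0; apply/rowV0P => u /sub_kermxP uA.
pose c a := u 0 (enum_rank a).
suff c0 : forall a, c a = 0.
  by apply/rowP=> i; rewrite mxE -(c0 (enum_val i)) /c enum_valK.
apply: ind; apply/mpolyP=> m; rewrite mcoeff0 raddf_sum /=.
have [ms|ms] := ltnP (mdeg m) s; last first.
  rewrite big1 // => a _; rewrite mcoeffZ memN_msupp_eq0 ?mulr0 //.
  by apply: msize_mdeg_ge; apply: leq_trans ms.
have lt i : (m i < s)%N.
  by apply: leq_ltn_trans ms; rewrite mdegE (bigD1 i) //= leq_addr.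
pose t : T := [ffun i => Ordinal (lt i)].
have mt : mon t = m by apply/mnmP=> i; rewrite mnmE ffunE.
have := congr1 (fun w : 'rV_(#|{: T}|) => w 0 (enum_rank t)) uA.
rewrite !mxE => uA0; rewrite -[RHS]uA0 (reindex enum_rank) /=; last first.
  by apply: onW_bij; apply: enum_rank_bij.
by apply: eq_bigr => a _; rewrite mcoeffZ mxE !enum_rankK mt.
Qed.

Lemma expn_linear_bound e b : (forall d, d ^ e <= (d * b).+1 ^ n)%N -> (e <= n)%N.
Proof.
move=> h; rewrite leqNgt; apply/negP=> ne; pose c := (b.+1 ^ n)%N.
(* At [d = c + 1] the right side is at most [d^n c], which is below [d^(n+1)]. *)
have := h c.+1; rewrite leqNgt => /negP; apply.
apply: (@leq_ltn_trans ((c.+1 * b.+1) ^ n)).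
  by have [->//|n0] := posnP n; rewrite leq_exp2r // mulnS addSn ltnS leq_addl.
rewrite expnMn; apply: (@leq_trans (c.+1 ^ n.+1)); last by rewrite leq_exp2l // ltnS expn_gt0.
by rewrite expnSr ltn_pmul2l ?expn_gt0.
Qed.

(* Along a chain of length e the functions separating its members are
   algebraically independent: their d ^ e monomials with exponents below d pull
   back to linearly independent polynomials of degree O(d), and the latter span
   a space of dimension O(d ^ n). *)
Lemma zchain_param (phi : 'rV[K]_n -> 'rV[K]_M) (Z : 'rV[K]_M -> Prop) e :
  (forall j, polyfun (fun c => phi c 0 j)) -> (forall v, Z v -> exists c, v = phi c) ->
  zchain Z e -> (e <= n)%N.
Proof.
move=> pphi onto /zclosure_chain_indep[C CZ].
pose pull (f : 'rV[K]_M -> K) (b : nat) := exists q : {mpoly K[n]},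
  (msize q <= b.+1)%N /\ forall c : 'rV[K]_n, f (phi c) = q.@[c 0].
case/(_ pull).
- by exists 1; rewrite msize1; split=> // c; rewrite meval1.
- move=> f [p fp]; have [q hq] : polyfun (fun c => f (phi c)).
    apply: (@polyfun_eq _ _ (fun c => \sum_(m <- msupp p) p@_m * \prod_i phi c 0 i ^+ m i)).
      by move=> c; rewrite fp mevalE.
    apply: polyfun_sum => m; apply: polyfunM; first exact: polyfunC.
    by apply: polyfun_prod => i; apply: polyfunX.
  by exists (msize q), q; split.
- move=> f g h b b' [q [sq hq]] [q' [sq' hq']] hE; exists (q * q'); split.
    have [->|nz] := eqVneq q 0; first by rewrite mul0r msize0.
    have [->|nz'] := eqVneq q' 0; first by rewrite mulr0 msize0.
    by rewrite msizeM //; move: (msize q) (msize q') sq sq'; clear; lia.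
  by move=> c; rewrite hE mevalM hq hq'.
move=> b hb; apply: (@expn_linear_bound e b) => d.
have [I [Q [<- ind hQ]]] := hb d.
have hq a : exists q : {mpoly K[n]}, (msize q <= (d * b).+1)%N /\
    forall c : 'rV[K]_n, Q a (phi c) = q.@[c 0].
  have [_ [k [q [sq hq]] kb]] := hQ a; exists q; split=> //.
  by apply: leq_trans sq _.
have [q qP] := fin_all_exists hq.
apply: (ncoef_bound (q := q)) => [a|c c0]; first by have [] := qP a.
apply: ind => v /CZ/onto[w ->].
transitivity ((\sum_a c a *: q a).@[w 0]); last by rewrite c0 meval0.
by rewrite raddf_sum; apply: eq_bigr => a _ /=; rewrite mevalZ; have [_ ->] := qP a.
Qed.

End ChainBound.

(** Geometric series; it makes the Cayley parametrisation polynomial, as [zchain_param] demands. *)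
Lemma cay_nilp (R : fieldType) N (H : 'M[R]_N) k : H ^+ k = 0 ->
  cay H = (1%:M + H) *m \sum_(i < k) H ^+ i.
Proof.
move=> Hk; rewrite /cay; congr (_ *m _).
have h : (1%:M - H) *m \sum_(i < k) H ^+ i = 1%:M.
  have := subrX1 H k; rewrite Hk sub0r -[1%R]/(1%:M : 'M_N) => /(congr1 -%R).
  by rewrite opprK mulmxE -mulNr opprB => <-.
by have [U _] := mulmx1_unit h; rewrite -[RHS](mulKmx U) h mulmx1.
Qed.

Section RegularBound.
Variables (K : closedFieldType) (n : nat).
Hypothesis K2 : 2%:R != 0 :> K.
Local Notation N := (n.*2.+1).
Variable B : 'M[K]_N.
Hypotheses (iB : isometry B) (Xm1 : (B - 1%:M) ^+ n.*2.+1 = 0).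
Hypothesis Xm : (B - 1%:M) ^+ n.*2 != 0.
Let Y := unip_skew B.
Let sY : skew Y := unip_skewP iB.

Let Z0 : 'M[K]_N := 0.

Let submZ0 (z : 'rV[K]_N) : (z <= Z0)%MS = (z == 0) := submx0 z.

Let rkZ0 : (N + \rank Z0 = N)%N.
Proof. by rewrite mxrank0 addn0. Qed.

Let Ym1 : Y ^+ n.*2.+1 = 0 := unip_skew_nilp K2 iB Xm1.

(** Any [u] with [u Y^(2n)] nonzero is a cyclic vector, and [u Y^(2n)] is orthogonal to all basis
    vectors [u Y^i] with [i > 0]; by nondegeneracy it is not orthogonal to [u]. *)
Lemma regular_cyclic : exists2 u : 'rV[K]_N, u *m Y ^+ n.*2 != 0 & form u (u *m Y ^+ n.*2) != 0.
Proof.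
have Ym : Y ^+ n.*2 != 0.
  have [U UU ->] := unip_skew_powE K2 iB Xm1 n.*2.
  by apply: contra Xm => /eqP e; rewrite -(mulmxK UU (_ ^+ _)) e mul0mx.
have [u uY] : exists u : 'rV[K]_N, u *m Y ^+ n.*2 != 0.
  have /rowV0Pn[v /submxP[u ->] v0] := Ym; by exists u.
exists u => //; apply: contra (uY) => /eqP e0; apply/eqP/form_nondeg => y.
have uZ : ~~ (u *m Y ^+ n.*2 <= Z0)%MS by rewrite submZ0 uY.
have [p [z [z0 ->]]] := krylov_full Ym1 uY (mul0mx _ _) uZ rkZ0 y.
have -> : z = 0 by apply/eqP; rewrite -submZ0.
by rewrite addr0 formC (form_krylov u sY Ym1) e0 mulr0.
Qed.

Definition odd_param (c : 'rV[K]_n) : 'M[K]_N := \sum_(l < n) c 0 l *: Y ^+ l.*2.+1.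

Lemma odd_param_nilp c : odd_param c ^+ n.*2.+1 = 0.
Proof.
have -> : odd_param c = (\sum_(l < n) c 0 l *: Y ^+ l.*2) * Y.
  by rewrite mulr_suml; apply: eq_bigr => l _; rewrite exprSr scalerAl.
rewrite exprMn_comm ?Ym1 ?mulr0 //; apply/commr_sym/commr_sum => l _.
by rewrite /GRing.comm -scalerAl -scalerAr -exprSr -exprS.
Qed.

Lemma odd_param_skew c : skew (odd_param c).
Proof.
move=> y z; rewrite /odd_param !mulmx_sumr.
rewrite (big_morph (fun y => form y z) (fun y z' => formDl y z' z) (form0l z)).
rewrite (big_morph (form y) (formDr y) (form0r y)) -sumrN; apply: eq_bigr => l _.
by rewrite -!scalemxAr formZl formZr form_skew_pow // -signr_odd /= odd_double expr1 mulN1r mulrN.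
Qed.

Lemma regular_centraliser_cay v : SO_centraliser B v ->
  exists c, v = mxvec ((1%:M + odd_param c) *m \sum_(i < n.*2.+1) odd_param c ^+ i).
Proof.
case=> SOM cM; set M := vec_mx v in SOM cM; have [iM dM] : isometry M /\ \det M = 1.
  by move: SOM; rewrite is_SOE => /andP[? /eqP].
have [u uY ue] := regular_cyclic.
have uZ : ~~ (u *m Y ^+ n.*2 <= Z0)%MS by rewrite submZ0.
have full := krylov_full Ym1 uY (mul0mx _ _) uZ rkZ0.
have z0 (z : 'rV[K]_N) : (z <= Z0)%MS -> z = 0 by rewrite submZ0 => /eqP.
have uz (z : 'rV[K]_N) : (z <= Z0)%MS -> form u z = 0 by move/z0->; rewrite form0r.
have znd (z : 'rV[K]_N) : (z <= Z0)%MS ->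
    (forall z' : 'rV[K]_N, (z' <= Z0)%MS -> form z z' = 0) -> z = 0 by move/z0.
have cYM : Y *m M = M *m Y by apply: unip_skew_commA.
have param M' : isometry M' -> Y *m M' = M' *m Y ->
    form (u *m M') (u *m Y ^+ n.*2) = form u (u *m Y ^+ n.*2) -> exists c, M' = cay (odd_param c).
  move=> iM' cM' eM.
  have [p [_ ->]] := cayley_param K2 sY Ym1 (mul0mx _ _) full uz znd ue iM' cM' (mul0mx _ _) eM.
  exists (\row_l p l.*2.+1); congr cay; rewrite (sum_odd_ord (fun i => p i *: Y ^+ i)).
  by apply: eq_bigr => l _; rewrite mxE.
have [eM|eM] := krylov_sign sY Ym1 (mul0mx _ _) full uz znd ue iM cYM (mul0mx _ _).
  have [c Mc] := param M iM cYM eM; exists c.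
  by rewrite -(cay_nilp (odd_param_nilp c)) -Mc vec_mxK.
(* The negative sign is impossible: [-M] would be a Cayley transform, of determinant [1], whereas
   its determinant is [-1] in odd dimension. *)
have [|||c Mc] := param (- M); first by rewrite isometryN.
- by rewrite mulmxN mulNmx cYM.
- by rewrite mulmxN formNl eM opprK.
have nilp := odd_param_nilp c.
have dc : \det (cay (odd_param c)) = 1.
  apply: cay_det; first exact: odd_param_skew.
  have e : (- odd_param c) ^+ n.*2.+1 = 0 by rewrite exprNn nilp mulr0.
  exact: (unitmx_add_nilp (oner_neq0 K) e).
have e1 : 1 = -1 :> K by rewrite -[LHS]dc -Mc det_opp_odd dM.
by case/eqP: K2; rewrite mulr2n {1}e1 addNr.
Qed.

Lemma regular_chain_le e : zchain (SO_centraliser B) e -> (e <= n)%N.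
Proof.
apply: zchain_param regular_centraliser_cay.
have pH : polyfun_mx odd_param.
  apply: polyfun_mx_sum => l; apply: polyfun_mxZ; first exact: polyfun_coord.
  exact: polyfun_mxC.
have pM : polyfun_mx (fun c => (1%:M + odd_param c) *m \sum_(i < n.*2.+1) odd_param c ^+ i).
  apply: polyfun_mxM; first by apply: polyfun_mxD => //; apply: polyfun_mxC.
  by apply: polyfun_mx_sum => i; apply: polyfun_mxX.
by case/mxvec_indexP=> i j; apply: polyfun_eq (pM i j) => v; rewrite mxvecE.
Qed.

Lemma odd_param_inj c : odd_param c = 0 -> c = 0.
Proof.
have [u uY _] := regular_cyclic => c0.
pose p i := if odd i then \sum_(l < n | l.*2.+1 == i) c 0 l else 0.
have pE (l : 'I_n) : p l.*2.+1 = c 0 l.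
  rewrite /p /= odd_double /= (big_pred1 l) // => l'.
  by rewrite eqSS -!muln2 eqn_pmul2r.
have s0 : \sum_(i < n.*2.+1) p i *: (u *m Y ^+ i) = 0.
  have -> : \sum_(i < n.*2.+1) p i *: (u *m Y ^+ i) = \sum_(i < n.*2.+1 | odd i) p i *: (u *m Y ^+ i).
    by rewrite [RHS]big_mkcond; apply: eq_bigr => i _; rewrite /p; case: ifP; rewrite ?scale0r.
  rewrite (sum_odd_ord (fun i => p i *: (u *m Y ^+ i))) -[RHS](mulmx0 _ u) -[in RHS]c0 mulmx_sumr.
  by apply: eq_bigr => l _; rewrite pE -scalemxAr.
apply/rowP=> l; rewrite mxE -pE; apply: (krylov_inj Ym1 uY (leqnn _) s0).
by have := ltn_ord l; move: (nat_of_ord l); clear; lia.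
Qed.

Lemma regular_chain : zchain (SO_centraliser B) n.
Proof.
pose G : 'M[K]_(n, N * N) := \matrix_(l < n) mxvec (Y ^+ l.*2.+1).
have GE l : vec_mx (row l G) = Y ^+ l.*2.+1 by rewrite rowK mxvecK.
apply: (cayley_chain K2 (G := G)).
- rewrite -kermx_eq0; apply/rowV0P=> c /sub_kermxP cG; apply: odd_param_inj.
  rewrite -[RHS](linear0 (@vec_mx K N N)) -cG mulmx_sum_row linear_sum.
  by apply: eq_bigr => l _; rewrite linearZ /= GE.
- move=> l; have := odd_param_skew (delta_mx 0 l); congr skew; rewrite GE /odd_param.
  rewrite (bigD1 l) //= big1 ?addr0 => [|i /negPf il]; first by rewrite mxE !eqxx scale1r.
  by rewrite mxE il scale0r.
- move=> l; rewrite GE; have c : GRing.comm B Y.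
    by rewrite /GRing.comm -!mulmxE (unip_skew_commA iB (erefl (B *m B))).
  exact: commrX c.
Qed.

End RegularBound.

Section Upper.
Variables (R : fieldType) (m : nat).
Implicit Types (S T U : 'M[R]_m).

Definition upper S : Prop := forall i k : 'I_m, (k < i)%N -> S i k = 0.

Lemma upperM S T : upper S -> upper T -> upper (S *m T).
Proof.
move=> uS uT i k ki; rewrite mxE big1 // => j _.
have [ji|ij] := ltnP j i; first by rewrite uS ?mul0r.
by rewrite uT ?mulr0 // (leq_trans ki).
Qed.

Lemma upper_diag S T i : upper S -> upper T -> (S *m T) i i = S i i * T i i.
Proof.
move=> uS uT; rewrite mxE (bigD1 i) //= big1 ?addr0 // => j; rewrite -val_eqE neq_ltn.
by case/orP=> [ji|ij]; [rewrite uS ?mul0r | rewrite uT ?mulr0].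
Qed.

Lemma upper_superdiag S T (i k : 'I_m) : k = i.+1 :> nat -> upper S -> upper T ->
  (S *m T) i k = S i i * T i k + S i k * T k k.
Proof.
move=> ki uS uT; have ik : k != i by rewrite -val_eqE /= ki neq_ltn leqnn orbT.
rewrite mxE (bigD1 i) //= (bigD1 k) //= big1 ?addr0 // => j /andP[ji jk].
have [lt|ge] := ltnP j i; first by rewrite uS ?mul0r.
have ij : (k < j)%N.
  move: ji jk; rewrite -val_eqE -[j == k]val_eqE /= ki.
  by move: (nat_of_ord i) (nat_of_ord j) ge; clear; lia.
by rewrite uT ?mulr0.
Qed.

Lemma subr1_diag S i : (S - 1%:M) i i = S i i - 1.
Proof. by rewrite !mxE eqxx. Qed.

Lemma subr1_offdiag S i k : i != k -> (S - 1%:M) i k = S i k.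
Proof. by move=> ik; rewrite !mxE (negPf ik) subr0. Qed.

Lemma upper_subr1 S : upper S -> upper (S - 1%:M).
Proof. by move=> uS i k ki; rewrite subr1_offdiag ?uS // -val_eqE gtn_eqF. Qed.

Lemma conj_subr1X S P k : P \in unitmx ->
  (invmx P *m S *m P - 1%:M) ^+ k = invmx P *m (S - 1%:M) ^+ k *m P.
Proof.
move=> PU; elim: k => [|k IH]; first by rewrite !expr0 mulmx1 mulVmx.
have e : invmx P *m S *m P - 1%:M = invmx P *m (S - 1%:M) *m P.
  by rewrite mulmxBr mulmxBl mulmx1 mulVmx.
by rewrite !exprS -!mulmxE IH e !mulmxA mulmxK.
Qed.

Lemma upper_nilp_diag S k i : upper S -> S ^+ k = 0 -> S i i = 0.
Proof.
move=> uS Sk; have [uk dk] : upper (S ^+ k) /\ (S ^+ k) i i = S i i ^+ k.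
  elim: k {Sk} => [|k [uk dk]].
    by split=> [a b ba|]; rewrite mxE ?eqxx // -val_eqE gtn_eqF.
  by rewrite exprS -mulmxE upper_diag // dk -exprS; split=> //; apply: upperM.
have : S i i ^+ k = 0 by rewrite -dk Sk mxE.
by move/eqP; rewrite expf_eq0 => /andP[_ /eqP].
Qed.

End Upper.

(** If no superdiagonal entry were zero, the corner entry of [U^m], their product, would not
    vanish. *)
Lemma upper_nilp_superdiag (R : fieldType) m (U : 'M[R]_m.+1) : upper U ->
  (forall i, U i i = 0) -> U ^+ m = 0 ->
  exists i k : 'I_m.+1, k = i.+1 :> nat /\ U i k = 0.
Proof.
move=> uU dU Um; apply: NNPP => no.
have nz (i k : 'I_m.+1) : k = i.+1 :> nat -> U i k != 0.
  by move=> ki; apply/eqP => e; apply: no; exists i, k.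
have z (i k : 'I_m.+1) : (k <= i)%N -> U i k = 0.
  by rewrite leq_eqVlt => /predU1P[/val_inj->|/uU].
have key j (a b : 'I_m.+1) : ((b < a + j)%N -> (U ^+ j) a b = 0) /\
    ((b = a + j :> nat)%N -> (U ^+ j) a b != 0).
  elim: j a b => [|j IH] a b.
    rewrite addn0 expr0; split=> [ba|/val_inj->]; rewrite mxE ?eqxx ?oner_neq0 //.
    by rewrite -val_eqE gtn_eqF.
  rewrite exprS -mulmxE; split=> [ba|ba].
    rewrite mxE big1 // => c _; have [ca|ac] := leqP c a; first by rewrite z ?mul0r.
    have [-> //] := IH c b; rewrite ?mulr0 //; move: ba ac.
    by move: (a : nat) (b : nat) (c : nat); clear; lia.
  have am : (a.+1 < m.+1)%N by have := ltn_ord b; rewrite ba; move: (a : nat); clear; lia.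
  rewrite mxE (bigD1 (Ordinal am)) //= big1 ?addr0 => [|c].
    by rewrite mulf_neq0 ?nz //; have [_ ->] := IH (Ordinal am) b; rewrite //= ba addnS.
  rewrite -val_eqE /= => ca1; have [ca|ac] := leqP c a; first by rewrite z ?mul0r.
  have [-> //] := IH c b; rewrite ?mulr0 //; move: ba ac ca1.
  by move: (a : nat) (b : nat) (c : nat); clear; lia.
have [_ /(_ erefl)] := key m ord0 ord_max.
by rewrite Um mxE eqxx.
Qed.

Section SkewEntries.
Variables (R : fieldType) (N : nat).
Local Notation J := (antidiag R N).
Implicit Types S : 'M[R]_N.

Lemma mulmx_antidiagE S i j : (S *m J) i j = S i (rev_ord j).
Proof. by have := mul_antidiagE (row i S) j; rewrite -row_mul !mxE. Qed.

Lemma antidiag_mulmxE S i j : (J *m S) i j = S (rev_ord i) j.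
Proof.
have := mulmx_antidiagE S^T j i; rewrite [X in _ = X]mxE => <-.
by rewrite -{2}tr_antidiag -trmx_mul [RHS]mxE.
Qed.

Lemma skewP S : skew S <-> S *m J + J *m S^T = 0.
Proof.
split=> [/skew_mx->|e y z]; first by rewrite addNr.
rewrite /form -(mulmxA y S); move/eqP: e; rewrite addr_eq0 => /eqP ->.
by rewrite mulmxN mulNmx mxE trmx_mul !mulmxA.
Qed.

Lemma skew_entries S : (forall i j, S i j + S (rev_ord j) (rev_ord i) = 0) -> skew S.
Proof.
move=> h; apply/skewP/matrixP=> i j; rewrite mxE mulmx_antidiagE antidiag_mulmxE !mxE.
by rewrite -[RHS](h i (rev_ord j)) rev_ordK.
Qed.

Lemma isometry_inv S : isometry S -> invmx S = J *m S^T *m J.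
Proof.
move=> iS; have SU := isometry_unit iS; rewrite -[RHS](mulKmx SU).
have -> : S *m (J *m S^T *m J) = 1%:M by rewrite !mulmxA (eqP iS) antidiag_sq.
by rewrite mulmx1.
Qed.

Lemma isometry_invE S i j : isometry S -> (invmx S) i j = S (rev_ord j) (rev_ord i).
Proof. by move=> iS; rewrite isometry_inv // mulmx_antidiagE antidiag_mulmxE mxE. Qed.

End SkewEntries.

Section CommutantMaps.
Variables (R : fieldType) (n : nat).
Local Notation N := n.*2.+1.
Local Notation J := (antidiag R N).
Implicit Types S T : 'M[R]_N.
Variables (T0 : 'M[R]_N) (i k : 'I_N).

Definition skew_defect S : 'M[R]_N := S *m J + J *m S^T.
Definition lower_part S : 'M[R]_N := \matrix_(a, b) (if (b < a)%N then S a b else 0).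
Definition conj_defect S : 'M[R]_N := T0 *m S *m invmx T0 - S.
(** The first [n] diagonal entries, followed by the entry at [(i, k)], the superdiagonal position
    where [T0] has a zero. *)
Definition torus_part S : 'rV[R]_n.+1 :=
  \row_l (if (l < n)%N then S (inord l) (inord l) else S i k).

Fact skew_defect_linear : linear skew_defect.
Proof.
move=> a S S'; rewrite /skew_defect mulmxDl linearD linearZ /= mulmxDr -scalemxAl -scalemxAr.
by rewrite scalerDr addrACA.
Qed.
HB.instance Definition _ := GRing.isLinear.Build R _ _ _ skew_defect skew_defect_linear.

Fact lower_part_linear : linear lower_part.
Proof. by move=> a S S'; apply/matrixP=> b c; rewrite !mxE; case: ifP => // _; rewrite mulr0 addr0. Qed.
HB.instance Definition _ := GRing.isLinear.Build R _ _ _ lower_part lower_part_linear.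

Fact conj_defect_linear : linear conj_defect.
Proof.
move=> a S S'; rewrite /conj_defect mulmxDr mulmxDl -scalemxAr -scalemxAl opprD addrACA.
by rewrite -scalerBr.
Qed.
HB.instance Definition _ := GRing.isLinear.Build R _ _ _ conj_defect conj_defect_linear.

Fact torus_part_linear : linear torus_part.
Proof. by move=> a S S'; apply/rowP=> l; rewrite !mxE; case: ifP. Qed.
HB.instance Definition _ := GRing.isLinear.Build R _ _ _ torus_part torus_part_linear.

Definition upper_skew : 'M[R]_(N * N) :=
  (kermx (lin_mx skew_defect) :&: kermx (lin_mx lower_part))%MS.

Lemma mxvec_kerP (m1 m2 : nat) (f : {linear 'M[R]_N -> 'M[R]_(m1, m2)}) S :
  reflect (f S = 0) (mxvec S <= kermx (lin_mx f))%MS.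
Proof.
apply: (iffP sub_kermxP); rewrite mul_vec_lin; last by move->; rewrite linear0.
by move=> e; apply: (can_inj mxvecK); rewrite linear0.
Qed.

Lemma upper_skewP S : reflect (skew S /\ upper S) (mxvec S <= upper_skew)%MS.
Proof.
rewrite sub_capmx; apply: (iffP andP) => [[/mxvec_kerP h /mxvec_kerP u]|[sS uS]].
  split; first exact/skewP.
  by move=> a b ba; have := congr1 (fun M : 'M[R]_N => M a b) u; rewrite /= !mxE ba.
split; apply/mxvec_kerP; first by move/skewP: sS.
by apply/matrixP=> a b; rewrite !mxE; case: ifP => // /uS.
Qed.

Hypotheses (iT : isometry T0) (uT : upper T0) (dT : forall j, T0 j j = 1).
Hypotheses (ki : k = i.+1 :> nat) (T0ik : T0 i k = 0).

Let TU : T0 \in unitmx := isometry_unit iT.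

Let uTV : upper (invmx T0).
Proof.
move=> a b ba; rewrite isometry_invE // uT //= !subSS; have := ltn_ord a.
by move: (nat_of_ord a) (nat_of_ord b) ba; clear; lia.
Qed.

Let dTV j : (invmx T0) j j = 1.
Proof. by rewrite isometry_invE. Qed.

Lemma conj_defect_upper_skew S : (mxvec S <= upper_skew)%MS -> (mxvec (conj_defect S) <= upper_skew)%MS.
Proof.
case/upper_skewP=> sS uS; apply/upper_skewP; split.
  have h v w : form (v *m invmx T0) w = form v (w *m T0).
    by rewrite -(form_isometry _ _ iT) mulmxKV.
  have c y z : form (y *m (T0 *m S *m invmx T0)) z = form (y *m T0 *m S) (z *m T0).
    by rewrite !mulmxA h.
  move=> y z; rewrite /conj_defect !mulmxBr formBl formBr c (formC y (_ *m (_ *m _))) c.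
  by rewrite (formC (z *m T0 *m S)) !sS; ring.
by move=> a b ba; rewrite mxE (upperM (upperM uT uS) uTV) // mxE uS // subr0.
Qed.

(** Unitriangular conjugation preserves the diagonal; it changes a superdiagonal entry only through
    the entry of [T0] at the same place, which is zero at [(i, k)]. *)
Lemma conj_defect_torus S : (mxvec S <= upper_skew)%MS -> torus_part (conj_defect S) = 0.
Proof.
case/upper_skewP=> _ uS; have uTS := upperM uT uS.
have TVik : (invmx T0) i k = 0.
  have := congr1 (fun M : 'M[R]_N => M i k) (mulmxV TU).
  rewrite (upper_superdiag ki uT uTV) dT mul1r T0ik mul0r addr0 mxE => ->.
  by rewrite -val_eqE /= ki ltn_eqF.
have cE a b : conj_defect S a b = (T0 *m S *m invmx T0) a b - S a b.
  by rewrite [LHS]mxE [(- S) a b]mxE.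
apply/rowP=> l; rewrite [LHS]mxE [RHS]mxE !cE; case: ifP => _.
  by rewrite (upper_diag _ uTS uTV) (upper_diag _ uT uS) dT dTV mul1r mulr1 subrr.
rewrite (upper_superdiag ki uTS uTV) TVik mulr0 add0r dTV mulr1.
by rewrite (upper_superdiag ki uT uS) dT mul1r T0ik mul0r addr0 subrr.
Qed.

Lemma torus_part_onto (c : 'rV[R]_n.+1) : exists2 S, (mxvec S <= upper_skew)%MS & torus_part S = c.
Proof.
pose S : 'M[R]_N := \matrix_(a, b)
  (if a == b then (if (a < n)%N then c 0 (inord a) else
                   if (n < a)%N then - c 0 (inord (n.*2 - a)) else 0)
   else if (a == i) && (b == k) then c 0 ord_max
   else if (rev_ord b == i) && (rev_ord a == k) then - c 0 ord_max else 0).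
exists S.
  apply/upper_skewP; split.
    apply: skew_entries => a b; rewrite !mxE !rev_ordK (inj_eq rev_ord_inj) (eq_sym b a).
    have [<-|_] := eqVneq a b.
      have aN := ltn_ord a; rewrite rev_ordE; have [lt|gt|->] := ltngtP a n.
      - have [-> ->] : (n.*2 - a < n)%N = false /\ (n < n.*2 - a)%N.
          by move: (nat_of_ord a) lt; clear; lia.
        by rewrite subKn ?subrr.
      - have -> : (n.*2 - a < n)%N by move: (nat_of_ord a) gt aN; clear; lia.
        by rewrite addNr.
      - by rewrite -addnn addnK ltnn addr0.
    case: andP => [[/eqP ai /eqP bk]|_]; case: andP => [[/eqP bi _]|_];
      rewrite ?addr0 ?add0r ?subrr ?addNr //.
    (* The position [(i, k)] is not its own mirror image, since [i + k = 2i + 1] is odd and cannot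
       equal [2n]. *)
    have := congr1 (@nat_of_ord N) bi; rewrite rev_ordE bk ki; have := ltn_ord k; rewrite ki.
    by move: (nat_of_ord i); clear; lia.
  move=> a b ba; rewrite mxE -val_eqE gtn_eqF //.
  case: andP => [[/eqP ai /eqP bk]|_]; first by move: ba; rewrite ai bk ki ltnNge leqnSn.
  case: andP => [[/eqP bi /eqP ak]|//]; move: ki; rewrite -bi -ak !rev_ordE.
  by have := ltn_ord a; move: (nat_of_ord a) (nat_of_ord b) ba; clear; lia.
apply/rowP=> l; rewrite mxE; case: ltnP => ln.
  rewrite mxE eqxx inordK ?ln ?inord_val //.
  by move: ln; move: (nat_of_ord l); clear; lia.
rewrite mxE -val_eqE /= ki ltn_eqF // !eqxx /=; congr (c _ _).
by apply/val_inj=> /=; apply/eqP; rewrite eqn_leq ln -ltnS ltn_ord.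
Qed.

(* Rank-nullity: [conj_defect] maps [upper_skew] to itself, into the kernel of
   [torus_part], while [torus_part] maps [upper_skew] onto a space of dimension
   [n.+1]. *)
Lemma upper_skew_commutant : exists2 d, (n.+1 <= d)%N & exists G : 'M[R]_(d, N * N),
  row_free G /\ forall j, skew (vec_mx (row j G) : 'M[R]_N) /\
    T0 *m vec_mx (row j G) = vec_mx (row j G) *m T0.
Proof.
pose C := (upper_skew :&: kermx (lin_mx conj_defect))%MS.
exists (\rank C); last first.
  exists (row_base C); split; first exact: row_base_free.
  move=> j; have : (mxvec (vec_mx (row j (row_base C)) : 'M[R]_N) <= C)%MS.
    by rewrite vec_mxK; apply: submx_trans (row_sub _ _) _; rewrite eq_row_base.
  rewrite sub_capmx => /andP[/upper_skewP[sS _] /mxvec_kerP e]; split=> //.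
  by move/eqP: e; rewrite /conj_defect subr_eq0 => /eqP {2}<-; rewrite mulmxKV.
have e1 := mxrank_mul_ker upper_skew (lin_mx conj_defect).
have e2 := mxrank_mul_ker upper_skew (lin_mx torus_part).
have sub : (upper_skew *m lin_mx conj_defect <= upper_skew :&: kermx (lin_mx torus_part))%MS.
  apply/row_subP=> j; rewrite row_mul -[row j _]vec_mxK mul_vec_lin sub_capmx.
  have h : (mxvec (vec_mx (row j upper_skew) : 'M[R]_N) <= upper_skew)%MS by rewrite vec_mxK row_sub.
  by rewrite conj_defect_upper_skew //=; apply/mxvec_kerP; apply: conj_defect_torus.
have full : (n.+1 <= \rank (upper_skew *m lin_mx torus_part))%N.
  rewrite -{1}[n.+1]mul1n -{1}(mxrank1 R (1 * n.+1)); apply: mxrankS; apply/row_subP=> j.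
  have [S uS eS] := torus_part_onto (vec_mx (row j 1%:M)).
  by rewrite -[row j _]vec_mxK -eS -mul_vec_lin submxMr.
have := mxrankS sub; move: full e1 e2; rewrite -/C.
move: (\rank C) (\rank (upper_skew *m lin_mx conj_defect)) (\rank (upper_skew *m _)).
move: (\rank (_ :&: _)%MS) (\rank upper_skew); clear; lia.
Qed.

End CommutantMaps.

Section RegularIff.
Variables (F : finFieldType) (n : nat).
Local Notation N := n.*2.+1.
Hypothesis F2 : 2%:R != 0 :> F.
Variables (x : {'GL_N[F]}) (e : nat).
Hypotheses (xG : x \in SO F n) (Xe : (mx_of x - 1%:M) ^+ e = 0).
Local Notation A := (mx_of x).
Local Notation X := (A - 1%:M).

Let iA : isometry A := SO_isometry xG.

(** A stable full flag is moved to the standard one, whose stabiliser consists of upper triangular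
    isometries. *)
Lemma unip_conj_upper : exists2 H : 'M[F]_N, isometry H &
  let T := invmx H *m A *m H in upper T /\ forall j, T j j = 1.
Proof.
have i0 : isot (0 : 'M[F]_N) by rewrite /isot sub0mx.
have s0 : stablemx (0 : 'M[F]_N) A by rewrite mul0mx sub0mx.
have [W [fW sW _]] := flag_through F2 iA Xe i0 s0.
have hE u : u != 0 -> form u u = 0 -> has_eichler (SO F n) u.
  by move=> _ uu w uw; apply: mx_of_SO (eichler_SO F2 uu uw).
have [h hG hW] := flag_move F2 (subxx _) (leqnn n) hE fW (std_flagP F (leqnn n)).
have iH := SO_isometry hG; exists (mx_of h) => //= ; set T := invmx _ *m _ *m _.
have TE : T = invmx (mx_of h) *m A *m mx_of h by [].
have HU := mx_of_unit h.
have iT : isometry T := isometryM (isometryM (isometryV iH) iA) iH.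
clearbody T.
have uT : upper T.
  move=> i k ki; apply: (stable_std_upper iT) ki => j jn.
  rewrite -(stablemx_eqmx _ (hW j jn)) TE !mulmxA mulmxK // submxMr //.
  by have /stable_flagP := sW; apply.
split=> // j.
have T1 : (T - 1%:M) ^+ e = 0 by rewrite TE conj_subr1X // Xe mulmx0 mul0mx.
have := upper_nilp_diag j (upper_subr1 uT) T1; rewrite subr1_diag => /eqP.
by rewrite subr_eq0 => /eqP.
Qed.

Lemma nonregular_skew_commutant : X ^+ n.*2 = 0 ->
  exists2 d, (n.+1 <= d)%N & exists G : 'M[F]_(d, N * N),
  row_free G /\ forall j, skew (vec_mx (row j G) : 'M[F]_N) /\
    A *m vec_mx (row j G) = vec_mx (row j G) *m A.
Proof.
move=> Xm; have [H iH [uT dT]] := unip_conj_upper; set T := invmx H *m A *m H in uT dT.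
have TE : T = invmx H *m A *m H by [].
have HU : H \in unitmx := isometry_unit iH.
have iT : isometry T := isometryM (isometryM (isometryV iH) iA) iH.
clearbody T; have T1 : (T - 1%:M) ^+ n.*2 = 0 by rewrite TE conj_subr1X // Xm mulmx0 mul0mx.
have [|i [k [ki T0]]] := upper_nilp_superdiag (upper_subr1 uT) _ T1.
  by move=> i; rewrite subr1_diag dT subrr.
have {}T0 : T i k = 0 by rewrite -subr1_offdiag // -val_eqE /= ki ltn_eqF.
have [d nd [G [Gf GP]]] := upper_skew_commutant iT uT dT ki T0.
exists d => //; pose L : {linear 'M[F]_N -> 'M[F]_N} := mulmxr (invmx H) \o mulmx H.
have LE S : L S = H *m S *m invmx H by [].
have rowE j : vec_mx (row j (G *m lin_mx L)) = H *m vec_mx (row j G) *m invmx H.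
  by rewrite row_mul -[row j G]vec_mxK mul_vec_lin !mxvecK LE.
exists (G *m lin_mx L); split.
  rewrite -kermx_eq0; apply/rowV0P=> u /sub_kermxP; rewrite mulmxA -[u *m G]vec_mxK mul_vec_lin => e0.
  have : H *m vec_mx (u *m G) *m invmx H = 0 by rewrite -LE -[LHS]mxvecK e0 linear0.
  move/(congr1 (fun S => invmx H *m S *m H)); rewrite mulmx0 mul0mx !mulmxA mulVmx // mul1mx mulmxKV //.
  move/(congr1 mxvec); rewrite vec_mxK linear0 => uG.
  by apply: (row_free_inj Gf); rewrite mul0mx.
move=> j; have [sG cG] := GP j; rewrite rowE; split.
  have hV v w : form (v *m invmx H) w = form v (w *m H).
    by rewrite -(form_isometry _ _ iH) mulmxKV.
  move=> y z; rewrite !mulmxA hV sG [in RHS]formC hV formC.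
  by rewrite formC.
have AE : A = H *m T *m invmx H by rewrite TE !mulmxA mulmxV // mul1mx mulmxK.
rewrite AE !mulmxA mulmxKV // mulmxKV // -!mulmxA; congr (_ *m _).
by rewrite !mulmxA cG.
Qed.

Variables (K : closedFieldType) (iota : {rmorphism F -> K}).

(** The commutant is found over [F] and transported along [iota], which preserves linear
    independence; the chains are built over [K]. *)
Lemma regular_unipotentE : regular_unipotent (map_mx iota A) <-> X ^+ n.*2 != 0.
Proof.
have K2 : 2%:R != 0 :> K by rewrite -(rmorph_nat iota) fmorph_eq0.
set B := map_mx iota A.
have mX k : (B - 1%:M) ^+ k = map_mx iota (X ^+ k).
  by rewrite rmorphXn rmorphB /= map_mx1.
have sB : is_SO B.
  rewrite is_SOE /isometry; move: xG; rewrite mem_SO is_SOE => /andP[/eqP i1 /eqP d1].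
  have mJ : map_mx iota (antidiag F N) = antidiag K N.
    by apply/matrixP=> i j; rewrite !mxE rmorph_nat.
  by rewrite -mJ map_trmx -!map_mxM i1 det_map_mx d1 rmorph1 !eqxx.
have iB : isometry B by move: sB; rewrite is_SOE => /andP[].
have XN : X ^+ N = 0.
  have := stable_nilp Xe (E := 1%:M); rewrite mxrank1 !mul1mx; apply.
  by rewrite submx1.
split=> [[_ _ [_ le]]|Xm].
  apply/eqP => Xm; have [d nd [G [Gf GP]]] := nonregular_skew_commutant Xm.
  have rE j : vec_mx (row j (map_mx iota G)) = map_mx iota (vec_mx (row j G)).
    by apply/matrixP=> a b; rewrite !mxE.
  have : zchain (SO_centraliser B) d.
    apply: (cayley_chain K2 (G := map_mx iota G)) => [|j|j]; rewrite ?row_free_map ?rE //.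
    - have [/skewP s _] := GP j; apply/skewP.
      have mJ : map_mx iota (antidiag F N) = antidiag K N.
        by apply/matrixP=> a b; rewrite !mxE rmorph_nat.
      by rewrite -mJ map_trmx -!map_mxM -map_mxD s map_mx0.
    - by rewrite -!map_mxM; have [_ ->] := GP j.
  by move/le; rewrite leqNgt nd.
have BN : (B - 1%:M) ^+ n.*2.+1 = 0 by rewrite mX XN map_mx0.
have Bm : (B - 1%:M) ^+ n.*2 != 0 by rewrite mX map_mx_eq0.
split=> //; first by exists N.
by split; [apply: regular_chain | apply: regular_chain_le].
Qed.

End RegularIff.

(** * The subnormaliser theorem *)

(** Here [X] has rank at least [2n], so the fixed space is the line of [r]; being in the image of
    [X] as well, [r] is singular. *)
Lemma regular_one_point (F : finFieldType) n (x : {'GL_(n.*2.+1)[F]}) e :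
  x \in SO F n -> (0 < n)%N -> (mx_of x - 1%:M) ^+ e = 0 -> (mx_of x - 1%:M) ^+ n.*2 != 0 ->
  exists r, one_point (mx_of x) r.
Proof.
move=> xG n0 Xe Xm; have iA := SO_isometry xG.
set A := mx_of x in Xe Xm iA *; set X := A - 1%:M in Xe Xm.
have rX : (n.*2 <= \rank X)%N.
  have := stable_nilp Xe (submxMl X X); rewrite mulmxE -exprS leqNgt => X0.
  have X0' d : X ^+ (d + (\rank X).+1) = 0 by rewrite exprD X0 mulr0.
  by apply/negP=> lt; case/eqP: Xm; have := X0' (n.*2 - (\rank X).+1)%N; rewrite subnK.
have XN : X ^+ n.*2.+1 = 0.
  have := stable_nilp Xe (E := 1%:M); rewrite mxrank1 !mul1mx; apply.
  by rewrite submx1.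
have fixX (v : 'rV_(n.*2.+1)) : (v *m A = v) <-> v *m X = 0.
  by rewrite mulmxBr mulmx1; split=> [->|/eqP]; rewrite ?subrr // subr_eq0 => /eqP.
have /rowV0Pn[r /submxP[u ru] r0] := Xm.
have rX0 : r *m X = 0 by rewrite ru -mulmxA mulmxE -exprSr XN mulmx0.
exists r; split=> //.
- have rA : r *m A = r by apply/fixX.
  have rE : r = u *m X ^+ n.*2.-1 *m X.
    by rewrite -mulmxA mulmxE -exprSr prednK // double_gt0.
  by rewrite {1}rE mulmxBr mulmx1 formBl -{1}rA form_isometry // subrr.
- by apply/fixX.
move=> v _ /fixX vX.
have rK : (r <= kermx X)%MS by apply/sub_kermxP.
have /eqmxP e1 : (r == kermx X)%MS.
  rewrite -(mxrank_leqif_eq rK) eqn_leq mxrankS //= mxrank_ker rank_rV r0.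
  by rewrite leq_subLR addn1 ltnS.
by rewrite e1; apply/sub_kermxP.
Qed.

(* K is an algebraic closure of F, through iota. *)
Theorem lemma3p8 (F : finFieldType) (K : closedFieldType)
    (iota : {rmorphism F -> K}) (n : nat) (x : {'GL_(n.*2.+1)[F]})
    (hK : integralRange iota) (hn : (3 <= n)%N) (hq : odd #|F|)
    (xG : x \in SO F n) (xu : unipotent_mx (mx_of x)) :
  let G := SO F n in
  let q := #|F| in
  let exceptional :=
    unipotent_jordan_form (mx_of x) [:: (n.*2).-1; 1%N; 1%N] /\
    #|'C_G[x]| = (2 * q ^ n.+1 * q.+1)%N in
  (subnormaliser G x <> G :> {set _} <->
     regular_unipotent (map_mx iota (mx_of x)) \/ exceptional) /\
  (exceptional ->
     exists2 g, g \in G & subnormaliser G x = (parabolic_n F n :^ g)%g).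
Proof.
move=> G q exceptional; have F2 := odd_card_two_neq0 hq; have n1 := ltnW hn; have n0 := ltnW n1.
have [e Xe] := xu; have reg := regular_unipotentE F2 xG Xe iota.
(* The centraliser order is traded for the geometric condition that the other lemmas use. *)
have excP : exceptional <-> type3 x /\ exists r, one_point (mx_of x) r.
  split=> [[jf card]|[t3 op]].
    by have t3 := jordan_form_type3 n1 jf; split=> //; apply/(type3_card_cent F2 xG n1 t3).
  by split; [apply: type3_jordan_form | apply/(type3_card_cent F2 xG n1 t3)].
split; last first.
  case/excP=> t3 [r pr]; rewrite (type3_subnormaliser xG n1 t3 pr).
  exact: (flag_stab_conj_parabolic F2 n0 (type3_flagP xG n1 t3)).
split=> [/(subnormaliser_one_point F2 xG Xe n1)[r pr]|].
  have [Xm|Xm] := eqVneq ((mx_of x - 1%:M) ^+ n.*2) 0; last by left; apply/reg.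
  by right; apply/excP; split; [apply: one_point_type3 pr n0 Xm | exists r].
have op r := one_point_subnormaliser (r := r) F2 xG Xe n1.
case=> [/reg Xm|/excP[_ [r /op]]] //.
by have [r /op] := regular_one_point xG n0 Xe Xm.
Qed.
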